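(* Let $R$ be a root system in $\mathbb{R}^n$ with positive subsystem $R_+$ and Weyl group $W$, let $k:R\to[0,\infty)$ be $W$-invariant, and let $C=\{x\in\mathbb{R}^n: x\cdot\alpha>0\ \text{for all }\alpha\in R_+\}$. Let $X^W$ be the radial Dunkl process in $\overline C$ with parameter $k$, with $X^W_0\in C$ a.s. Suppose that $k(\alpha)\ge\frac12$ for every $\alpha\in R$. Define $T_0:=\inf\{t>0: X^W_t\in\partial C\}$. Then $T_0=+\infty$ a.s.
   Context: A root system is a finite set $R\subset\mathbb{R}^n\setminus\{0\}$ with $R\cap\mathbb{R}\alpha=\{\pm\alpha\}$ and $\sigma_\alpha(R)=R$ for all $\alpha\in R$, where $\sigma_\alpha$ is the orthogonal reflection in the hyperplane $H_\alpha=\alpha^\perp$. Roots are normalized by $\alpha\cdot\alpha=2$, so $\sigma_\alpha(x)=x-(\alpha\cdot x)\alpha$. The (finite) Weyl group $W$ is generated by $\{\sigma_\alpha:\alpha\in R\}$. A positive subsystem is $R_+=\{\alpha\in R:\alpha\cdot\beta>0\}$ for some $\beta\notin\bigcup_{\alpha\in R}H_\alpha$. $k:R\to[0,\infty)$ is $W$-invariant if $k(w\alpha)=k(\alpha)$ for all $w\in W$, $\alpha\in R$. Dunkl process with parameter $k$: the càdlàg Feller Markov process on $\mathbb{R}^n$ with transition densities $$p_t(x,y)=\frac{1}{c_kt^{\gamma+n/2}}\exp\Big(-\frac{|x|^2+|y|^2}{2t}\Big)D_k\Big(\frac{x}{\sqrt t},\frac{y}{\sqrt t}\Big)\prod_{\alpha\in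 R_+}|\alpha\cdot y|^{2k(\alpha)},$$ $\gamma=\sum_{\alpha\in R_+}k(\alpha)$, $c_k=\int_{\mathbb{R}^n}e^{-|x|^2/2}\prod_{\alpha\in R_+}|\alpha\cdot x|^{2k(\alpha)}dx$, where $D_k$ is the Dunkl kernel: $D_k(\cdot,y)$ is the unique real-analytic $f$ with $f(0)=1$ and $T_\xi f=(\xi\cdot y)f$ for all $\xi\in\mathbb{R}^n$, with $T_\xi f(x)=\partial_\xi f(x)+\sum_{\alpha\in R_+}k(\alpha)(\alpha\cdot\xi)\frac{f(x)-f(\sigma_\alpha x)}{\alpha\cdot x}$. The radial Dunkl process with parameter $k$ is $X^W=\pi(X)$, where $X$ is a Dunkl process with parameter $k$ and $\pi:\mathbb{R}^n\to\overline C$ sends $x$ to the unique point of $Wx\cap\overline C$. It is a continuous Feller process in $\overline C$ with transition densities $\sum_{w\in W}p_t(x,wy)$, $x,y\in\overline C$, and extended generator $$\mathcal{L}^W_ku(x)=\frac12\Delta u(x)+\sum_{\alpha\in R_+}k(\alpha)\frac{\nabla u(x)\cdot\alpha}{x\cdot\alpha}$$ for $u\in\mathbf{C}^2_0(\overline C)$ with $\nabla u(x)\cdot\alpha=0$ for $x\in H_\alpha$, $\alpha\in R_+$; that is, $u(X^W_t)-u(X^W_0)-\int_0^t\mathcal{L}^W_ku(X^W_s)ds$ is a martingale for such $u$. *)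

(* Defs.v *)
From HB Require Import structures.
From mathcomp Require Import all_boot all_order all_algebra.
From mathcomp Require Import finmap.
From mathcomp Require Import all_classical all_reals all_analysis.

Set Implicit Arguments.
Unset Strict Implicit.
Unset Printing Implicit Defensive.
Import Order.TTheory GRing.Theory Num.Theory.
Import numFieldNormedType.Exports.
Local Open Scope classical_set_scope.
Local Open Scope ring_scope.

Definition rV_display : measure_display.
Proof. exact: (measure_tuple_display default_measure_display). Qed.

(* The Borel sigma-algebra of R^n, generated by the coordinate maps. *)
Section rV_measurable.
Variables (R : realType) (n : nat).

Let coord (i : 'I_n) (x : 'rV[R]_n) : R := x ord0 i.

Let rV_set0 : g_sigma_preimage coord set0.
Proof. exact: sigma_algebra0. Qed.

Let rV_setC A : g_sigma_preimage coord A -> g_sigma_preimage coord (~` A).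
Proof. exact: sigma_algebraC. Qed.

Let rV_bigcup (F : _^nat) : (forall i, g_sigma_preimage coord (F i)) ->
  g_sigma_preimage coord (\bigcup_i (F i)).
Proof. exact: sigma_algebra_bigcup. Qed.

HB.instance Definition _ := @isMeasurable.Build rV_display
  'rV[R]_n (g_sigma_preimage coord) rV_set0 rV_setC rV_bigcup.

End rV_measurable.

Lemma measurable_rV_coord (R : realType) n (i : 'I_n) :
  measurable_fun [set: 'rV[R]_n] (fun x : 'rV[R]_n => x ord0 i).
Proof.
move=> _ Y mY; rewrite setTI; apply: sub_sigma_algebra => /=.
rewrite -bigcup_seq/=; exists i => /=; first by rewrite mem_index_enum.
by exists Y => //; rewrite setTI.
Qed.

Lemma measurable_fun_rV (R : realType) n d (T : measurableType d)
    (f : T -> 'rV[R]_n) :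
  (forall i, measurable_fun setT (fun t => f t ord0 i)) -> measurable_fun setT f.
Proof.
move=> mf; apply: (@measurability _ _ _ _ _ _
  (\big[setU/set0]_(i < n)
    preimage_set_system setT (fun x : 'rV[R]_n => x ord0 i) measurable)) => //.
move=> _ [A + <-]; rewrite -bigcup_seq/= => -[i _ [B mB <-]].
by have := mf i measurableT B mB; rewrite !setTI.
Qed.

Section rV_cons.
Variables (R : realType) (n : nat).

Definition rV_cons (p : R * 'rV[R]_n) : 'rV[R]_n.+1 :=
  row_mx (p.1%:M : 'rV_1) p.2.

Definition rV_uncons (x : 'rV[R]_n.+1) : R * 'rV[R]_n :=
  (x ord0 ord0, \row_j x ord0 (lift ord0 j)).

Lemma rV_consE0 p : rV_cons p ord0 ord0 = p.1.
Proof.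
have := row_mxEl (p.1%:M : 'rV_1) p.2 ord0 ord0; rewrite [RHS]mxE eqxx mulr1n => <-.
by congr (row_mx _ _ _ _); exact/val_inj.
Qed.

Lemma rV_consES p (j : 'I_n) : rV_cons p ord0 (lift ord0 j) = p.2 ord0 j.
Proof.
have <- := row_mxEr (p.1%:M : 'rV_1) p.2 ord0 j.
by congr (row_mx _ _ _ _); exact/val_inj.
Qed.

Lemma rV_consK : cancel rV_cons rV_uncons.
Proof.
move=> p; rewrite /rV_uncons rV_consE0 [RHS]surjective_pairing; congr pair.
by apply/rowP => j; rewrite mxE rV_consES.
Qed.

Lemma measurable_rV_cons : measurable_fun setT rV_cons.
Proof.
apply: measurable_fun_rV => i; case: (unliftP ord0 i) => [j|] ->.
  under eq_fun do rewrite rV_consES.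
  exact: (measurableT_comp (measurable_rV_coord j) measurable_snd).
under eq_fun do rewrite rV_consE0.
exact: measurable_fst.
Qed.

Lemma measurable_rV_uncons : measurable_fun setT rV_uncons.
Proof.
apply/measurable_fun_pairP; split; first exact: measurable_rV_coord.
apply: measurable_fun_rV => j /=.
under eq_fun do rewrite mxE.
exact: measurable_rV_coord.
Qed.

End rV_cons.

Section pushforward_product.
Context d1 d2 d (T1 : measurableType d1) (T2 : measurableType d2)
  (T : measurableType d) (R : realType).
Variables (m1 : {sigma_finite_measure set T1 -> \bar R})
  (m2 : {sigma_finite_measure set T2 -> \bar R}).
Variables (f : T1 * T2 -> T) (g : T -> T1 * T2).
Hypotheses (mf : measurable_fun setT f) (mg : measurable_fun setT g).
Hypothesis fK : cancel f g.

Lemma pushforward_product_sigma_additive :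
  semi_sigma_additive (pushforward (m1 \x m2)%E f).
Proof.
exact: (@measure_semi_sigma_additive _ _ _
  (measure_function_pushforward__canonical__measure_function_Measure
    (m1 \x m2)%E mf)).
Qed.

(* The library proves this too, but its canonical structure on [m1 \x m2] is
   shadowed by the one for products of subprobability measures. *)
Lemma sigma_finite_product : sigma_finite setT (m1 \x m2)%E.
Proof.
have /sigma_finiteP[F [TF ndF Foo]] := sigma_finiteT m1.
have /sigma_finiteP[G [TG ndG Goo]] := sigma_finiteT m2.
exists (fun n => F n `*` G n).
  rewrite -setXTT TF TG predeqE => -[x y]; split.
    move=> [/= [n _ Fnx] [k _ Gky]]; exists (maxn n k) => //; split.
    - by move: x Fnx; exact/subsetPset/ndF/leq_maxl.
    - by move: y Gky; exact/subsetPset/ndG/leq_maxr.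
  by move=> [n _ []/= ? ?]; split; exists n.
move=> k; have [? ?] := Foo k; have [? ?] := Goo k.
split; first exact: measurableX.
by rewrite product_measure1E// lte_mul_pinfty// ge0_fin_numE.
Qed.

Lemma pushforward_product_sigma_finite :
  sigma_finite setT (pushforward (m1 \x m2)%E f).
Proof.
have [F TF Foo] := sigma_finite_product.
exists (fun k => g @^-1` F k).
  by rewrite -preimage_bigcup -TF preimage_setT.
move=> k; have [mF Fk] := Foo k; split.
  by rewrite -[X in measurable X]setTI; exact: mg.
rewrite /pushforward -comp_preimage.
by rewrite (_ : _ \o _ = id) //; apply/funext => p /=; rewrite fK.
Qed.

End pushforward_product.

Section lebesgue_rV_cons.
Variables (R : realType) (n : nat).
Variable nu : {sigma_finite_measure set 'rV[R]_n -> \bar R}.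

Definition lebesgue_rV_cons : set 'rV[R]_n.+1 -> \bar R :=
  pushforward (@lebesgue_measure R \x nu)%E (@rV_cons R n).

Let lebesgue_rV_cons0 : lebesgue_rV_cons set0 = 0%E.
Proof. by rewrite /lebesgue_rV_cons /pushforward preimage_set0 measure0. Qed.

Let lebesgue_rV_cons_ge0 A : (0 <= lebesgue_rV_cons A)%E.
Proof. by apply: integral_ge0 => x _; exact: measure_ge0. Qed.

Let lebesgue_rV_cons_sigma_additive : semi_sigma_additive lebesgue_rV_cons.
Proof.
exact: (@pushforward_product_sigma_additive _ _ _ (measurableTypeR R) 'rV[R]_n
  'rV[R]_n.+1 R lebesgue_measure nu (@rV_cons R n) (@measurable_rV_cons R n)).
Qed.

HB.instance Definition _ := isMeasure.Build _ _ _ lebesgue_rV_cons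
  lebesgue_rV_cons0 lebesgue_rV_cons_ge0 lebesgue_rV_cons_sigma_additive.

Let lebesgue_rV_cons_sigma_finite : sigma_finite setT lebesgue_rV_cons.
Proof.
exact: (@pushforward_product_sigma_finite _ _ _ (measurableTypeR R) 'rV[R]_n
  'rV[R]_n.+1 R lebesgue_measure nu (@rV_cons R n) (@rV_uncons R n)
  (@measurable_rV_uncons R n) (@rV_consK R n)).
Qed.

HB.instance Definition _ := Measure_isSigmaFinite.Build _ _ _ lebesgue_rV_cons
  lebesgue_rV_cons_sigma_finite.

End lebesgue_rV_cons.

Fixpoint lebesgue_rV (R : realType) (n : nat) :
    {sigma_finite_measure set 'rV[R]_n -> \bar R} :=
  match n with
  | 0 => [the {sigma_finite_measure set 'rV[R]_0 -> \bar R} of \d_(0 : 'rV[R]_0)]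
  | m.+1 => [the {sigma_finite_measure set 'rV[R]_m.+1 -> \bar R} of
              lebesgue_rV_cons (lebesgue_rV R m)]
  end.

Section root_systems.
Variables (R : realType) (n : nat).
Implicit Types (Phi Rp : {fset 'rV[R]_n}) (a b x y : 'rV[R]_n).

Definition dot x y : R := \sum_(i < n) x ord0 i * y ord0 i.

(* The orthogonal reflection in the hyperplane orthogonal to a, for a
   normalized by dot a a = 2. *)
Definition reflection a x : 'rV[R]_n := x - dot a x *: a.

Definition root_system Phi : Prop :=
  [/\ 0 \notin Phi,
      forall a, a \in Phi -> dot a a = 2,
      forall a, a \in Phi ->
        forall c : R, (c *: a \in Phi) = (c *: a == a) || (c *: a == - a) &
      forall a, a \in Phi -> [fset reflection a b | b in Phi]%fset = Phi].

Definition positive_subsystem Phi Rp : Prop :=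
  exists2 b, (forall a, a \in Phi -> dot a b != 0) &
    Rp = [fset a in Phi | 0 < dot a b]%fset.

(* Reflections are involutions, so the monoid they generate is a group. *)
Inductive weyl_group Phi : ('rV[R]_n -> 'rV[R]_n) -> Prop :=
| weyl_group_id : weyl_group Phi id
| weyl_group_comp a w : a \in Phi -> weyl_group Phi w ->
    weyl_group Phi (reflection a \o w).

(* Only the values of k on Phi matter. *)
Definition multiplicity_function Phi (k : 'rV[R]_n -> R) : Prop :=
  (forall a, a \in Phi -> 0 <= k a) /\
  (forall w a, weyl_group Phi w -> a \in Phi -> k (w a) = k a).

Definition weyl_chamber Rp : set 'rV[R]_n :=
  [set x | forall a, a \in Rp -> 0 < dot x a].

(* z is the point of the closed chamber in the Weyl orbit of x. *)
Definition chamber_projection Phi Rp x z : Prop :=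
  (exists2 w, weyl_group Phi w & z = w x) /\ closure (weyl_chamber Rp) z.

End root_systems.

Section dunkl_kernel.
Variables (R : realType) (n : nat).
Implicit Types (Rp : {fset 'rV[R]_n}) (k : 'rV[R]_n -> R) (x y xi : 'rV[R]_n).

Definition monomial x (nu : {ffun 'I_n -> nat}) : R :=
  \prod_(i < n) x ord0 i ^+ nu i.

(* Partial sum of a family indexed by multi-indices, over those with all
   entries less than N. *)
Definition multi_sum (u : {ffun 'I_n -> nat} -> R) (N : nat) : R :=
  \sum_(nu : {ffun 'I_n -> 'I_N}) u [ffun i => nat_of_ord (nu i)].

Definition real_analytic (f : 'rV[R]_n -> R) : Prop :=
  forall x0, exists c : {ffun 'I_n -> nat} -> R, exists2 r : R, 0 < r &
    forall x, `|x - x0| < r ->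
      cvgn (multi_sum (fun nu => `|c nu * monomial (x - x0) nu|)) /\
      multi_sum (fun nu => c nu * monomial (x - x0) nu) @ \oo --> f x.

(* (f x - f (reflection a x)) / dot a x, extended to the hyperplane
   dot a x = 0 by its limit there, the derivative of f along a (as
   dot a a = 2). *)
Definition reflection_quotient a (f : 'rV[R]_n -> R) x : R :=
  if dot a x == 0 then 'D_a f x else (f x - f (reflection a x)) / dot a x.

Definition dunkl_operator Rp k xi (f : 'rV[R]_n -> R) x : R :=
  'D_xi f x + \sum_(a <- Rp) k a * dot a xi * reflection_quotient a f x.

Definition is_dunkl_kernel Rp k (D : 'rV[R]_n -> 'rV[R]_n -> R) : Prop :=
  forall y, [/\ real_analytic (D^~ y), D 0 y = 1 &
    forall xi x, dunkl_operator Rp k xi (D^~ y) x = dot xi y * D x y].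

Definition dunkl_weight Rp k y : R :=
  \prod_(a <- Rp) `|dot a y| `^ (2 * k a).

Definition dunkl_gamma Rp k : R := \sum_(a <- Rp) k a.

Definition dunkl_constant Rp k : R :=
  \int[lebesgue_rV R n]_x (expR (- (dot x x / 2)) * dunkl_weight Rp k x).

Definition dunkl_density Rp k (D : 'rV[R]_n -> 'rV[R]_n -> R) (t : R) x y : R :=
  (dunkl_constant Rp k * t `^ (dunkl_gamma Rp k + n%:R / 2))^-1
  * expR (- ((dot x x + dot y y) / (2 * t)))
  * D ((Num.sqrt t)^-1 *: x) ((Num.sqrt t)^-1 *: y)
  * dunkl_weight Rp k y.

End dunkl_kernel.

Section processes.
Variables (R : realType) (n : nat).
Variables (d : measure_display) (Om : measurableType d) (P : probability Om R).
(* Time is indexed by R; only times t >= 0 matter. *)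
Implicit Types (X : R -> Om -> 'rV[R]_n) (p : R -> 'rV[R]_n -> 'rV[R]_n -> R).
Implicit Types (f : 'rV[R]_n -> R).

Definition C0_function f : Prop :=
  continuous f /\
  forall e : R, 0 < e -> exists M : R, forall x, M < `|x| -> `|f x| < e.

Definition transition_operator p (t : R) f (x : 'rV[R]_n) : R :=
  \int[lebesgue_rV R n]_y (p t x y * f y).

Definition feller_semigroup (Q : R -> ('rV[R]_n -> R) -> 'rV[R]_n -> R) : Prop :=
  [/\ forall (t : R) f, 0 < t -> C0_function f -> C0_function (Q t f),
      forall (t : R) f, 0 < t -> C0_function f ->
        (forall x, 0 <= f x <= 1) -> forall x, 0 <= Q t f x <= 1,
      forall (s t : R) f, 0 < s -> 0 < t -> C0_function f ->
        Q (s + t) f = Q s (Q t f) &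
      forall f, C0_function f -> forall e : R, 0 < e ->
        \forall t \near 0^'+, forall x, `|Q t f x - f x| < e].

Definition natural_filtration X (s : R) : set (set Om) :=
  <<s \bigcup_(u in `[0, s]) preimage_set_system setT (X u) measurable >>.

Definition markov_process_with_densities p X : Prop :=
  forall s t : R, 0 <= s -> s < t ->
  forall (A : set Om) (B : set 'rV[R]_n),
    natural_filtration X s A -> measurable B ->
    P (A `&` X t @^-1` B) =
      (\int[P]_(w in A) \int[lebesgue_rV R n]_(y in B) (p (t - s)%R (X s w) y)%:E)%E.

Definition cadlag X : Prop := forall w,
  (forall t : R, 0 <= t -> X s w @[s --> t^'+] --> X t w) /\
  (forall t : R, 0 < t -> cvg (X s w @[s --> t^'-])).

Definition is_dunkl_process (Rp : {fset 'rV[R]_n}) (k : 'rV[R]_n -> R) X : Prop :=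
  exists2 D, is_dunkl_kernel Rp k D &
    [/\ forall t : R, 0 <= t -> measurable_fun setT (X t),
        cadlag X,
        markov_process_with_densities (dunkl_density Rp k D) X &
        feller_semigroup (transition_operator (dunkl_density Rp k D))].

Definition is_radial_dunkl_process (Phi Rp : {fset 'rV[R]_n})
    (k : 'rV[R]_n -> R) (XW : R -> Om -> 'rV[R]_n) : Prop :=
  exists2 X, is_dunkl_process Rp k X &
    forall t w, 0 <= t -> chamber_projection Phi Rp (X t w) (XW t w).

Definition boundary (A : set 'rV[R]_n) : set 'rV[R]_n := closure A `\` interior A.

Definition hitting_time X (A : set 'rV[R]_n) (w : Om) : \bar R :=
  ereal_inf [set t%:E | t in [set t : R | 0 < t /\ A (X t w)]].

End processes.

(* Main.v *)
Require Import Defs.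
From mathcomp Require Import all_boot all_order all_algebra.
From mathcomp Require Import finmap.
From mathcomp Require Import all_classical all_reals all_analysis.
From mathcomp Require Import measurable_realfun ring lra.
Set Implicit Arguments.
Unset Strict Implicit.
Unset Printing Implicit Defensive.
Import Order.TTheory GRing.Theory Num.Theory.
Import numFieldNormedType.Exports.
Local Open Scope classical_set_scope.
Local Open Scope ring_scope.

(* Let beta(x) = exp(-(|Phi| + 1) |x|^2) prod_{a in Phi} |a.x|. It is W-invariant
   and vanishes exactly on the reflecting hyperplanes. Applying the generator to
   -log beta off the hyperplanes produces the cross terms a.b / ((a.x)(b.x)) with
   b <> a, -a, which cancel in the sum, and the terms (1 - 2 k(a)) / (a.x)^2, which
   are nonpositive as k >= 1/2; hence L(-log beta) <= c for a constant c.

   The Dunkl kernel equations give positivity and bounds of D_k, by a maximum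
   principle along rays, and the backward heat equation for p_t off the
   hyperplanes. If f >= 0 is continuous with bounded support, f <= 1 and
   b f <= -log beta, a second maximum principle gives
   b P_t f <= -log beta + c t off the hyperplanes. So g = min (-log beta, lam)
   satisfies P_t g <= g + c t where g < lam, and by the Markov property
   g(X_t) - c t, stopped when g(X_t) reaches lam, is a supermartingale along any
   discrete set of times. The probability that a process started where
   -log beta <= M has -log beta >= lam at some dyadic time before T is thus at
   most (M + c T) / lam. Letting lam tend to infinity, right-continuity shows that
   beta(X_t) almost surely never vanishes at t > 0, and beta(X^W_t) = beta(X_t)
   vanishes whenever X^W_t is on the boundary of the chamber. *)

(** * Reflections and sums over pairs of roots *)

(** The estimates are made for X and not for the radial process, since it is X whose Markov property
    and Feller semigroup are given by explicit densities. The price is a nonlocal reflection term in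
    the generator, which vanishes on a W-invariant barrier.

    The obstacle is that -log beta is singular on the hyperplanes and grows at infinity, so it
    belongs neither to C_0 nor to the domain of the generator. The comparison is therefore run from
    below: functions f in C_0 lying under the barrier are propagated, and P_t f is compared
    pointwise with the barrier. No contact point can lie on a hyperplane, where -log beta is
    infinite; so the heat equation is wanted only at regular points, and there the Dunkl equations
    express the gradient by values of the kernel and can be differentiated once more.

    The constant c is the generator of (|Phi| + 1) |x|^2, namely (|Phi| + 1)(n + 2 gamma), plus 1 to
    make an inequality strict. Stopping is expressed by events on a finite mesh of times, so that
    neither stopping times nor the measurability of hitting times enter. *)

Section dot_theory.
Variables (R : realType) (n : nat).
Implicit Types (a b x y z : 'rV[R]_n) (c : R).

Lemma dotC x y : dot x y = dot y x.
Proof. by apply: eq_bigr => i _; rewrite mulrC. Qed.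

Lemma dotDl x y z : dot (x + y) z = dot x z + dot y z.
Proof. by rewrite -big_split; apply: eq_bigr => i _; rewrite mxE mulrDl. Qed.

Lemma dotZl c x y : dot (c *: x) y = c * dot x y.
Proof. by rewrite /dot mulr_sumr; apply: eq_bigr => i _; rewrite mxE mulrA. Qed.

Lemma dotNl x y : dot (- x) y = - dot x y.
Proof. by rewrite -scaleN1r dotZl mulN1r. Qed.

Lemma dotBl x y z : dot (x - y) z = dot x z - dot y z.
Proof. by rewrite dotDl dotNl. Qed.

Lemma dotDr x y z : dot x (y + z) = dot x y + dot x z.
Proof. by rewrite dotC dotDl !(dotC x). Qed.

Lemma dotZr c x y : dot x (c *: y) = c * dot x y.
Proof. by rewrite dotC dotZl dotC. Qed.

Lemma dotNr x y : dot x (- y) = - dot x y.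
Proof. by rewrite dotC dotNl dotC. Qed.

Lemma dotBr x y z : dot x (y - z) = dot x y - dot x z.
Proof. by rewrite dotDr dotNr. Qed.

Lemma dot0l x : dot 0 x = 0.
Proof. by rewrite -[X in dot X _](scale0r 0) dotZl mul0r. Qed.

Lemma dot0r x : dot x 0 = 0.
Proof. by rewrite dotC dot0l. Qed.

Definition dotE := (dotDl, dotDr, dotBl, dotBr, dotNl, dotNr, dotZl, dotZr, dot0l, dot0r).

Lemma dot_ge0 x : 0 <= dot x x.
Proof. by apply: sumr_ge0 => i _; rewrite -expr2 sqr_ge0. Qed.

Lemma dot_eq0 x : (dot x x == 0) = (x == 0).
Proof.
apply/idP/eqP => [|->]; last by rewrite dot0l.
rewrite psumr_eq0 => [/allP x0|i _]; last by rewrite -expr2 sqr_ge0.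
apply/rowP => i; rewrite mxE; have := x0 i (mem_index_enum _).
by rewrite -expr2 sqrf_eq0 => /eqP.
Qed.

Lemma dot_delta x (i : 'I_n) : dot x (delta_mx ord0 i) = x ord0 i.
Proof.
rewrite /dot (bigD1 i)//= mxE !eqxx mulr1 big1 ?addr0// => j /negPf ji.
by rewrite mxE eqxx ji mulr0.
Qed.

Lemma dot_sumr (I : Type) (r : seq I) (P : pred I) (F : I -> 'rV[R]_n) x :
  dot x (\sum_(i <- r | P i) F i) = \sum_(i <- r | P i) dot x (F i).
Proof. by elim/big_rec2: _ => [|i u v _ <-]; rewrite ?dot0r// dotDr. Qed.

Lemma dot_sum_delta x y :
  \sum_(i < n) dot x (delta_mx ord0 i) * dot y (delta_mx ord0 i) = dot x y.
Proof. by apply: eq_bigr => i _; rewrite !dot_delta. Qed.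

Lemma reflectionD a x y : reflection a (x + y) = reflection a x + reflection a y.
Proof. by rewrite /reflection dotDr scalerDl opprD addrACA. Qed.

Lemma reflectionZ a c x : reflection a (c *: x) = c *: reflection a x.
Proof. by rewrite /reflection dotZr scalerBr scalerA. Qed.

Lemma reflectionN a x : reflection (- a) x = reflection a x.
Proof. by rewrite /reflection dotNl scalerN scaleNr opprK. Qed.

Lemma reflection_id a x : dot a x = 0 -> reflection a x = x.
Proof. by move=> ax; rewrite /reflection ax scale0r subr0. Qed.

Lemma reflectionK a : dot a a = 2 -> involutive (reflection a).
Proof.
move=> a2 x; rewrite /reflection !dotE a2 -[RHS]addr0 -!addrA; congr (_ + _).
by rewrite -opprD -scalerDl (_ : _ + _ = 0) ?scale0r ?oppr0//; ring.
Qed.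

Lemma dot_reflection a x y : dot a a = 2 ->
  dot (reflection a x) (reflection a y) = dot x y.
Proof. by move=> a2; rewrite /reflection !dotE a2 (dotC x a); ring. Qed.

Lemma dot_reflectionl a x y : dot (reflection a x) y = dot x (reflection a y).
Proof. by rewrite /reflection !dotE (dotC x a); ring. Qed.

Lemma reflection_self a : dot a a = 2 -> reflection a a = - a.
Proof. by move=> a2; rewrite /reflection a2 scaler_nat mulr2n opprD addNKr. Qed.

Lemma reflection_conj a b x : dot a a = 2 ->
  reflection (reflection a b) x = reflection a (reflection b (reflection a x)).
Proof.
move=> a2; have -> y : reflection b y = y - dot b y *: b by [].
rewrite -scaleNr reflectionD reflectionZ reflectionK// scaleNr.
by rewrite -dot_reflectionl.
Qed.

End dot_theory.

Section root_sums.
Variables (R : realType) (n : nat) (Phi : {fset 'rV[R]_n}).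
Hypothesis rs : root_system Phi.
Implicit Types (a b x y : 'rV[R]_n).

Definition regular x := forall a, a \in Phi -> dot a x != 0.

Lemma root_norm a : a \in Phi -> dot a a = 2.
Proof. by case: rs => _ + _ _; apply. Qed.

Lemma root_reflection a b : a \in Phi -> b \in Phi -> reflection a b \in Phi.
Proof. by case: rs => _ _ _ H aP bP; rewrite -(H a aP); exact: in_imfset. Qed.

Lemma root_opp a : a \in Phi -> - a \in Phi.
Proof.
by move=> aP; rewrite -(reflection_self (root_norm aP)) root_reflection.
Qed.

Lemma regular_reflection a x : a \in Phi -> regular x -> regular (reflection a x).
Proof. by move=> aP rx b bP; rewrite -dot_reflectionl rx// root_reflection. Qed.

Lemma regular_scale c x : c != 0 -> regular x -> regular (c *: x).
Proof. by move=> c0 rx b bP; rewrite dotZr mulf_neq0// rx. Qed.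

Lemma reindex_reflection (T : Type) (idx : T) (op : Monoid.com_law idx)
    a (g : 'rV[R]_n -> T) : a \in Phi ->
  \big[op/idx]_(b <- Phi) g (reflection a b) = \big[op/idx]_(b <- Phi) g b.
Proof.
move=> aP; have aK := reflectionK (root_norm aP).
have {2}-> : Phi = [fset reflection a b | b in Phi]%fset by case: rs => _ _ _ ->.
by rewrite [RHS]big_imfset//= => u v _ _; exact: (inv_inj aK).
Qed.

Lemma reindex_opp (T : Type) (idx : T) (op : Monoid.com_law idx)
    (g : 'rV[R]_n -> T) :
  \big[op/idx]_(b <- Phi) g (- b) = \big[op/idx]_(b <- Phi) g b.
Proof.
have PhiN : Phi = [fset - b | b in Phi]%fset.
  apply/fsetP => b; apply/idP/imfsetP => [bP|[c /= cP ->]]; last exact: root_opp.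
  by exists (- b) => /=; rewrite ?opprK// root_opp.
by rewrite {2}PhiN [RHS]big_imfset//= => u v _ _; exact: oppr_inj.
Qed.

Lemma sum_reflection a (g : 'rV[R]_n -> R) : a \in Phi ->
  \sum_(b <- Phi) g (reflection a b) = \sum_(b <- Phi) g b.
Proof. exact: reindex_reflection. Qed.

(** Strict Cauchy-Schwarz, from |b - a|^2 > 0 and |b + a|^2 > 0. It keeps the denominator of [pot]
    below away from zero. *)
Lemma root_dot_sqr_lt a b : a \in Phi -> b \in Phi -> b != a -> b != - a ->
  dot a b ^+ 2 < 4.
Proof.
move=> aP bP ba bNa; have a2 := root_norm aP; have b2 := root_norm bP.
have : 0 < dot (b - a) (b - a) by rewrite lt_def dot_eq0 subr_eq0 ba dot_ge0.
have : 0 < dot (b + a) (b + a) by rewrite lt_def dot_eq0 addr_eq0 bNa dot_ge0.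
by rewrite !dotE a2 b2 (dotC b a) => *; nra.
Qed.

(* The pairs with a fixed product of reflections are permuted by
   (a, b) |-> (reflection a b, a), along which the summand is the increment of
   [pot]; for a, b at an angle A in a plane and x at angle B to b there, this is
   tan (A + B) - tan B = sin A / (cos (A + B) cos B). *)
Lemma sum_root_pairs_eq0 (phi : 'rV[R]_n -> 'rV[R]_n -> R) x : regular x ->
  (forall a b, a \in Phi -> b \in Phi -> phi (reflection a b) a = phi a b) ->
  \sum_(a <- Phi) \sum_(b <- Phi | (b != a) && (b != - a))
     phi a b * (dot a b / (dot a x * dot b x)) = 0.
Proof.
move=> rx phiE.
pose pot a b := - (dot a b * (dot a x / dot b x - dot a b / 2)) /
  (dot a x ^+ 2 + dot b x ^+ 2 - dot a b * dot a x * dot b x).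
have term a b : a \in Phi -> b \in Phi -> b != a -> b != - a ->
    phi a b * (dot a b / (dot a x * dot b x)) =
    phi (reflection a b) a * pot (reflection a b) a - phi a b * pot a b.
  move=> aP bP ba bNa; rewrite phiE// -mulrBr; congr (_ * _).
  have a2 := root_norm aP; have ax := rx a aP; have bx := rx b bP.
  rewrite /pot !dot_reflectionl /reflection !dotE a2 (dotC b a).
  have Q0 : 0 < dot a x ^+ 2 + dot b x ^+ 2 - dot a b * dot a x * dot b x.
    have := root_dot_sqr_lt aP bP ba bNa.
    have : 0 < dot b x ^+ 2 by rewrite exprn_even_gt0.
    move: (dot a x) (dot b x) (dot a b) => u v g vv gg.
    have -> : u ^+ 2 + v ^+ 2 - g * u * v = (u - g * v / 2) ^+ 2 +
      v ^+ 2 * (4 - g ^+ 2) / 4 by field.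
    by rewrite ltr_wpDl ?sqr_ge0// divr_gt0// mulr_gt0// subr_gt0.
  move: (lt0r_neq0 Q0) ax bx.
  move: (dot a x) (dot b x) (dot a b) => u v g Qn0 u0 v0.
  (* The denominator of [pot] is invariant under (a, b) |-> (reflection a b, a), so both values of
     [pot] share it. *)
  rewrite (_ : _ ^+ 2 + _ ^+ 2 - (g - _) * _ * _ =
    u ^+ 2 + v ^+ 2 - g * u * v); last by ring.
  by field; rewrite u0 v0 Qn0.
transitivity (\sum_(a <- Phi) \sum_(b <- Phi | (b != a) && (b != - a))
    phi (reflection a b) a * pot (reflection a b) a -
  \sum_(a <- Phi) \sum_(b <- Phi | (b != a) && (b != - a)) phi a b * pot a b).
  rewrite -sumrB; apply: eq_big_seq => a aP; rewrite -sumrB.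
  rewrite [LHS]big_seq_cond [RHS]big_seq_cond; apply: eq_bigr => b /and3P[bP ba bNa].
  exact: term.
apply/eqP; rewrite subr_eq0; apply/eqP.
transitivity (\sum_(a <- Phi) \sum_(b <- Phi | (b != a) && (b != - a))
    phi b a * pot b a).
  apply: eq_big_seq => a aP; rewrite [LHS]big_mkcond [RHS]big_mkcond/=.
  etransitivity; last exact: (sum_reflection (fun b =>
    if (b != a) && (b != - a) then phi b a * pot b a else 0) aP).
  apply: eq_bigr => b _ /=.
  have a2 := root_norm aP; have aK := reflectionK a2.
  rewrite (can2_eq aK aK) reflection_self// (can2_eq aK aK).
  rewrite (_ : reflection a (- a) = a) 1?andbC//.
  by rewrite -scaleN1r reflectionZ reflection_self// scaleN1r opprK.
under eq_bigr do rewrite big_mkcond/=.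
under [RHS]eq_bigr do rewrite big_mkcond/=.
rewrite exchange_big/=; apply: eq_bigr => a _; apply: eq_bigr => b _.
by rewrite eq_sym -[in RHS]eqr_oppLR [X in _ && ~~ X]eq_sym.
Qed.

Variable k : 'rV[R]_n -> R.
Hypothesis mk : multiplicity_function Phi k.

Lemma mult_reflection a b : a \in Phi -> b \in Phi -> k (reflection a b) = k b.
Proof.
move=> aP bP; case: mk => _ /(_ (reflection a \o id)) -> //.
exact: weyl_group_comp (weyl_group_id _).
Qed.

Lemma mult_opp a : a \in Phi -> k (- a) = k a.
Proof. by move=> aP; rewrite -(reflection_self (root_norm aP)) mult_reflection. Qed.

Lemma mult_ge0 a : a \in Phi -> 0 <= k a.
Proof. by case: mk => + _; apply. Qed.

(** The weight depends on a and b only through the product of their reflections and the unordered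
    values of k, both preserved by (a, b) |-> (reflection a b, a). For b = a or b = - a that product
    is the identity and the term is zero, so the diagonal may be included. *)
Lemma sum_root_rotations_eq0 (E : 'rV[R]_n -> R) x : regular x ->
  \sum_(a <- Phi) \sum_(b <- Phi) k a * k b *
    (E x - E (reflection a (reflection b x))) *
    (dot a b / (dot a x * dot b x)) = 0.
Proof.
move=> rx; rewrite -[RHS](@sum_root_pairs_eq0 (fun a b => k a * k b *
    (E x - E (reflection a (reflection b x)))) x)//; last first.
  move=> a b aP bP; rewrite mult_reflection// reflection_conj ?root_norm//.
  by rewrite reflectionK ?root_norm// (mulrC (k b)).
apply: eq_big_seq => a aP; rewrite [RHS]big_mkcond; apply: eq_big_seq => b bP /=.
case: eqVneq => [->|_] /=; first by rewrite reflectionK ?root_norm// subrr mulr0 mul0r.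
case: eqVneq => [->|_] //=.
by rewrite reflectionN reflectionK ?root_norm// subrr mulr0 mul0r.
Qed.

(** The weight k b alone is not preserved by the move on pairs, but k a + k b is; exchanging a and b
    shows that the two weights k a and k b give equal off-diagonal sums, so both vanish. The terms b
    = a and b = - a each contribute 2 k a / (a.x)^2. *)
Lemma sum_root_mult_pairs x : regular x ->
  \sum_(a <- Phi) \sum_(b <- Phi) k b * (dot a b / (dot a x * dot b x)) =
  \sum_(a <- Phi) 4 * k a / dot a x ^+ 2.
Proof.
move=> rx.
pose g a b := k b * (dot a b / (dot a x * dot b x)).
have sym : \sum_(a <- Phi) \sum_(b <- Phi | (b != a) && (b != - a)) g a b =
    \sum_(a <- Phi) \sum_(b <- Phi | (b != a) && (b != - a))
      k a * (dot a b / (dot a x * dot b x)).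
  under eq_bigr do rewrite big_mkcond/=.
  under [RHS]eq_bigr do rewrite big_mkcond/=.
  rewrite exchange_big/=; apply: eq_bigr => a _; apply: eq_bigr => b _.
  rewrite eq_sym -[in RHS]eqr_oppLR [X in _ && ~~ X]eq_sym /g.
  by rewrite (dotC b a) [dot a x * _]mulrC.
have off0 : \sum_(a <- Phi) \sum_(b <- Phi | (b != a) && (b != - a)) g a b = 0.
  have := @sum_root_pairs_eq0 (fun a b => k a + k b) x rx.
  under eq_bigr do under eq_bigr do rewrite mulrDl.
  under eq_bigr do rewrite big_split/=.
  rewrite big_split/= -sym => H; suff : 2 * \sum_(a <- Phi)
      \sum_(b <- Phi | (b != a) && (b != - a)) g a b = 0 by lra.
  by rewrite mulr_natl mulr2n H// => a b aP bP; rewrite mult_reflection// addrC.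
transitivity (\sum_(a <- Phi) 4 * k a / dot a x ^+ 2 +
    \sum_(a <- Phi) \sum_(b <- Phi | (b != a) && (b != - a)) g a b); last first.
  by rewrite off0 addr0.
rewrite -big_split/=; apply: eq_big_seq => a aP.
have aNP : - a \in (Phi `\ a)%fset.
  rewrite !inE root_opp// andbT; apply: contraTneq isT => aN.
  have := root_norm aP; rewrite -[X in dot X _]aN dotNl root_norm//; lra.
rewrite (big_fsetD1 a)//= (big_fsetD1 (- a))//= [in RHS]big_mkcond/=.
rewrite [in RHS](big_fsetD1 a)//= eqxx /= [in RHS](big_fsetD1 (- a))//=.
rewrite eqxx andbF/= !add0r addrA; congr (_ + _).
  rewrite mult_opp// !dotE root_norm//; have ax := rx a aP.
  by field.
rewrite big_seq [RHS]big_seq; apply: eq_bigr => b.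
by rewrite !inE => /and3P[-> ->].
Qed.

End root_sums.

(** * Real-analytic functions *)

Section analytic.
Variables (R : realType) (n : nat).
Implicit Types (x d xi : 'rV[R]_n) (f : 'rV[R]_n -> R).

Lemma ler_coord x i : `|x ord0 i| <= `|x|.
Proof.
by rewrite [leRHS]/Num.norm /= mx_normrE; apply/bigmax_geP; right => /=; exists (ord0, i).
Qed.

Lemma ler_rV_norm x (c : R) : 0 <= c -> (forall i, `|x ord0 i| <= c) -> `|x| <= c.
Proof.
move=> c0 xc; rewrite [leLHS]/Num.norm /= mx_normrE; apply/bigmax_leP; split => // -[i j] _ /=.
by rewrite ord1.
Qed.

Lemma norm_monomial_le d (r : R) (nu : {ffun 'I_n -> nat}) : `|d| <= r ->
  `|monomial d nu| <= r ^+ \sum_i nu i.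
Proof.
move=> dr; rewrite /monomial normr_prod expr_sum; apply: ler_prod => i _.
by rewrite normr_ge0 normrX lerXn2r// ?nnegrE ?normr_ge0//
  ?(le_trans (ler_coord d i))// (le_trans _ dr).
Qed.

Lemma monomial_const (r : R) (nu : {ffun 'I_n -> nat}) :
  monomial (const_mx r : 'rV[R]_n) nu = r ^+ \sum_i nu i.
Proof. by rewrite /monomial expr_sum; apply: eq_bigr => i _; rewrite mxE. Qed.

Lemma monomial_scale (c : R) d (nu : {ffun 'I_n -> nat}) :
  monomial (c *: d) nu = c ^+ (\sum_i nu i) * monomial d nu.
Proof.
by rewrite /monomial expr_sum -big_split; apply: eq_bigr => i _; rewrite mxE exprMn.
Qed.

Lemma multi_sumB (u v : {ffun 'I_n -> nat} -> R) N :
  multi_sum (fun nu => u nu - v nu) N = multi_sum u N - multi_sum v N.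
Proof. by rewrite /multi_sum sumrB. Qed.

Lemma multi_sumZ (c : R) (u : {ffun 'I_n -> nat} -> R) N :
  multi_sum (fun nu => c * u nu) N = c * multi_sum u N.
Proof. by rewrite /multi_sum mulr_sumr. Qed.

Lemma norm_multi_sum_le (u v : {ffun 'I_n -> nat} -> R) N :
  (forall nu, `|u nu| <= v nu) -> `|multi_sum u N| <= multi_sum v N.
Proof.
by move=> uv; apply: le_trans (ler_norm_sum _ _ _) _; apply: ler_sum.
Qed.

(** Absolute convergence at the constant vector r gives one bound on the sums of |c nu| r^|nu|. It
    dominates the expansion at every d with |d| <= r in the max norm, uniformly in the partial
    sum. *)
Lemma real_analytic_expansion f x : real_analytic f ->
  exists c : {ffun 'I_n -> nat} -> R, exists r M : R, [/\ 0 < r,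
    forall d, `|d| <= r ->
      multi_sum (fun nu => c nu * monomial d nu) @ \oo --> f (x + d) &
    forall N, multi_sum (fun nu => `|c nu| * r ^+ \sum_i nu i) N <= M].
Proof.
move=> /(_ x)[c [r r0 H]]; exists c, (r / 2).
have r20 : 0 < r / 2 by rewrite divr_gt0.
have r2r : r / 2 < r by rewrite ltr_pdivrMr// ltr_pMr// ltr1n.
have near_lt d : `|d| <= r / 2 -> `|x + d - x| < r.
  by move=> dr; rewrite addrAC subrr add0r (le_lt_trans dr).
have /near_lt/H[cv _] : `|const_mx (r / 2) : 'rV[R]_n| <= r / 2.
  by apply: ler_rV_norm => [|i]; rewrite ?mxE ?(ger0_norm (ltW r20))// ltW.
have /pinfty_ex_gt0[M _ HM] := cvg_seq_bounded cv.
exists M; split => // [d /near_lt/H[_]|N].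
  by rewrite [x + d - x]addrAC subrr add0r.
apply: le_trans (HM N I); apply: le_trans (ler_norm _).
rewrite le_eqVlt; apply/orP; left; apply/eqP; apply: eq_bigr => nu _.
by rewrite addrAC subrr add0r monomial_const normrM [in RHS]normrX (ger0_norm (ltW r20)).
Qed.

Lemma norm_expansion_le (f1 f2 : {ffun 'I_n -> nat} -> R) (l e M : R)
    (v : {ffun 'I_n -> nat} -> R) :
  0 <= e -> (forall N, multi_sum v N <= M) ->
  (forall nu, `|f1 nu - f2 nu| <= e * v nu) ->
  forall N, `|multi_sum f1 N - multi_sum f2 N| <= e * M.
Proof.
move=> e0 vM fv N; rewrite -multi_sumB.
apply: le_trans (norm_multi_sum_le _ fv) _.
by rewrite multi_sumZ ler_wpM2l.
Qed.

(** Each non-constant term at d is smaller by a factor |d| / r than the bound for that term at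
    radius r. *)
Lemma real_analytic_lipschitz_at f x : real_analytic f ->
  exists r M : R, 0 < r /\
    forall d, `|d| <= r -> `|f (x + d) - f x| <= M * `|d|.
Proof.
move=> /(@real_analytic_expansion _ x)[c [r [M [r0 Hf HM]]]].
exists r, (M / r); split => // d dr.
have f0 : multi_sum (fun nu => c nu * monomial 0 nu) @ \oo --> f x.
  by rewrite -[x in f x]addr0; apply: Hf; rewrite normr0 ltW.
have dist : `|multi_sum (fun nu => c nu * monomial d nu) N -
     multi_sum (fun nu => c nu * monomial 0 nu) N| @[N --> \oo] --> `|f (x + d) - f x|.
  by apply: cvg_norm; apply: cvgB => //; exact: Hf.
rewrite -(cvg_lim (@Rhausdorff R) dist) mulrAC -mulrA mulrC.
apply: limr_le; first by apply/cvg_ex; exists `|f (x + d) - f x|.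
apply: nearW => N; apply: norm_expansion_le HM _ N => //.
  by rewrite divr_ge0// ltW.
move=> nu; rewrite -mulrBr normrM mulrCA ler_wpM2l//.
have dr1 : 0 <= `|d| / r <= 1 by rewrite divr_ge0 ?(ltW r0)//= ler_pdivrMr// mul1r.
have -> : (0 : 'rV[R]_n) = 0 *: d by rewrite scale0r.
rewrite monomial_scale; case: (posnP (\sum_i nu i)%N) => [->|nu0].
  by rewrite !expr0 mul1r subrr normr0 mulr1; case/andP: dr1.
rewrite [0 ^+ _]expr0n gtn_eqF// mul0r subr0.
apply: le_trans (norm_monomial_le nu (lexx _)) _.
rewrite -[X in X ^+ _ <= _](divfK (lt0r_neq0 r0)) exprMn ler_wpM2r//.
  by rewrite exprn_ge0// ltW.
by rewrite -[X in _ <= X]expr1; apply: ler_wiXn2l => //; case/andP: dr1.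
Qed.

Lemma real_analytic_continuous f : real_analytic f -> continuous f.
Proof.
move=> af x; have [r [M [r0 H]]] := real_analytic_lipschitz_at x af.
apply/(@cvgrPdist_le _ _ _ (nbhs x) (nbhs_filter x)) => e e0.
have M1 : 0 < `|M| + 1 by rewrite ltr_wpDl.
apply/nbhs_ballP; exists (Num.min r (e / (`|M| + 1))) => /=.
  by rewrite lt_min r0 divr_gt0.
move=> y; rewrite -ball_normE /= distrC lt_min => /andP[yr ye].
rewrite distrC (_ : y = x + (y - x)); last by rewrite addrC subrK.
apply: le_trans (H _ (ltW yr)) _.
apply: (@le_trans _ _ ((`|M| + 1) * `|y - x|)).
  by rewrite ler_wpM2r// (le_trans (ler_norm _))// lerDl.
by rewrite mulrC -ler_pdivlMr// ltW.
Qed.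

(* The difference quotients are within O(s) of the first order coefficient of the
   partial sums, uniformly in the partial sum, hence Cauchy as s tends to 0. *)
Lemma real_analytic_derivable f x xi : real_analytic f -> derivable f x xi.
Proof.
move=> /(@real_analytic_expansion _ x)[c [r [M [r0 Hf HM]]]].
pose C := M * ((`|xi| + 1) / r) ^+ 2.
pose q s := s^-1 * (f (s *: xi + x) - f x).
have xi1 : 0 < `|xi| + 1 by rewrite ltr_wpDl.
pose s0 := r / (`|xi| + 1).
have s00 : 0 < s0 by rewrite divr_gt0.
have qq s s' : s != 0 -> s' != 0 -> `|s| <= s0 -> `|s'| <= s0 ->
    `|q s - q s'| <= C * (`|s| + `|s'|).
  move=> sn0 sn0' ss0 ss0'.
  pose qN s N : R := s^-1 * (multi_sum (fun nu => c nu * monomial (s *: xi) nu) N -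
    multi_sum (fun nu => c nu * monomial 0 nu) N).
  have sr t : `|t| <= s0 -> `|t *: xi| <= r.
    move=> ts; rewrite normrZ (@le_trans _ _ (s0 * (`|xi| + 1)))//.
      by apply: ler_pM => //; rewrite lerDl.
    by rewrite /s0 divfK// lt0r_neq0.
  have qNq t : `|t| <= s0 -> qN t @ \oo --> q t.
    move=> ts; apply: cvgM; first exact: cvg_cst.
    apply: cvgB; first by rewrite addrC; apply/Hf/sr.
    by rewrite -[x in f x]addr0; apply: Hf; rewrite normr0 ltW.
  pose aN N := multi_sum (fun nu =>
    c nu * (if (\sum_i nu i == 1)%N then monomial xi nu else 0)) N.
  have qNa t N : t != 0 -> `|t| <= s0 -> `|qN t N - aN N| <= C * `|t|.
    move=> tn0 ts.
    have -> : qN t N - aN N = t^-1 *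
       (multi_sum (fun nu => c nu * (monomial (t *: xi) nu - monomial 0 nu)) N -
        multi_sum (fun nu => t * (c nu * (if (\sum_i nu i == 1)%N then monomial xi nu else 0))) N).
      rewrite multi_sumZ mulrBr mulKf// /qN -multi_sumB.
      by congr (_ * _ - _); apply: eq_bigr => nu _; rewrite mulrBr.
    rewrite normrM normfV ler_pdivrMl ?normr_gt0//.
    pose e := (`|t| / s0) ^+ 2.
    rewrite (_ : _ * _ = e * M); last first.
      rewrite /e /C /s0; have := lt0r_neq0 r0; have := lt0r_neq0 xi1.
      by move: `|t| (`|xi| + 1) => u v v0 rn0; field; rewrite v0 rn0.
    apply: norm_expansion_le HM _ N; rewrite ?sqr_ge0// => nu.
    rewrite mulrCA -mulrBr normrM mulrCA ler_wpM2l//.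
    have t1 : 0 <= `|t| / s0 <= 1.
      by rewrite divr_ge0 ?(ltW s00)//= ler_pdivrMr// mul1r.
    have -> : (0 : 'rV[R]_n) = 0 *: xi by rewrite scale0r.
    rewrite !monomial_scale; case: (posnP (\sum_i nu i)%N) => [->|nu0].
      by rewrite !expr0 mulr0 subrr subr0 normr0 mulr1 sqr_ge0.
    rewrite [0 ^+ _]expr0n gtn_eqF// mul0r subr0.
    case: eqVneq => [->|nu1].
      by rewrite expr1 subrr normr0 mulr_ge0 ?sqr_ge0// ltW.
    rewrite mulr0 subr0 normrM normrX.
    have xir : `|monomial xi nu| <= (`|xi| + 1) ^+ (\sum_i nu i)%N.
      by apply: norm_monomial_le; rewrite lerDl.
    apply: le_trans (ler_wpM2l _ xir) _; first by rewrite exprn_ge0.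
    rewrite -exprMn (_ : `|t| * _ = `|t| / s0 * r); last first.
      by rewrite /s0 invf_div mulrA mulrAC -mulrA divff ?mulr1// lt0r_neq0.
    rewrite exprMn ler_wpM2r//; first by rewrite exprn_ge0// ltW.
    apply: ler_wiXn2l; [by case/andP: t1..|].
    by case: (\sum_i nu i)%N nu0 nu1 => [|[|]].
  have dist : `|qN s N - qN s' N| @[N --> \oo] --> `|q s - q s'|.
    by apply: cvg_norm; apply: cvgB; exact: qNq.
  rewrite -(cvg_lim (@Rhausdorff R) dist).
  apply: limr_le; first by apply/cvg_ex; exists `|q s - q s'|.
  apply: nearW => N; rewrite mulrDr.
  have -> : qN s N - qN s' N = (qN s N - aN N) - (qN s' N - aN N).
    by rewrite opprB addrA subrK.
  by apply: le_trans (ler_normB _ _) _; apply: lerD; exact: qNa.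
rewrite /derivable; apply/cauchy_cvgP/cauchy_exP => e e0.
have C1 : 0 < `|C| + 1 by rewrite ltr_wpDl.
pose s1 := Num.min s0 (e / (`|C| + 1) / 3).
have s10 : 0 < s1 by rewrite lt_min s00 !divr_gt0.
exists (q s1).
change (\forall s \near 0^', ball (q s1) e (q s)); near=> s; rewrite -ball_normE /=.
have sn0 : s != 0 by near: s; exact: nbhs_dnbhs_neq.
have ss1 : `|s| <= s1.
  near: s; apply: (@cvgr0_norm_le _ _ _ (0^'%classic) _ id) => //.
  exact: nbhs_dnbhs.
have s1s0 : s1 <= s0 by rewrite ge_min lexx.
apply: (@le_lt_trans _ _ (C * (`|s1| + `|s|))).
  by apply: qq => //; rewrite ?lt0r_neq0// ?(gtr0_norm s10)// (le_trans ss1).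
apply: (@le_lt_trans _ _ ((`|C| + 1) * (s1 + s1))).
  apply: (@le_trans _ _ ((`|C| + 1) * (`|s1| + `|s|))).
    by rewrite ler_wpM2r ?addr_ge0// (le_trans (ler_norm _))// lerDl.
  by rewrite ler_wpM2l ?(ltW C1)// gtr0_norm// lerD2l.
rewrite mulrC -ltr_pdivlMr//.
have : s1 <= e / (`|C| + 1) / 3 by rewrite ge_min lexx orbT.
have : 0 < e / (`|C| + 1) by rewrite divr_gt0.
move: (e / _) => z; lra.
Unshelve. all: by end_near. Qed.

End analytic.

Lemma cvg_mulc (R : realType) (T : Type) (F : set_system T) (FF : Filter F)
    (f : T -> R) (c l : R) : f @ F --> l -> c * f t @[t --> F] --> c * l.
Proof. by move=> fl; apply: (@cvgM _ _ F _ (cst c) f) => //; exact: cvg_cst. Qed.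

(** * Continuity, derivatives and the radial maximum principle *)

Section continuous_real_functions.
Variables (R : realType) (T : topologicalType).
Implicit Types f g : T -> R.

Lemma continuousD_fun f g : continuous f -> continuous g ->
  continuous (fun x => f x + g x).
Proof. by move=> cf cg x; apply: cvgD; [exact: cf|exact: cg]. Qed.

Lemma continuousB_fun f g : continuous f -> continuous g ->
  continuous (fun x => f x - g x).
Proof. by move=> cf cg x; apply: cvgB; [exact: cf|exact: cg]. Qed.

Lemma continuousM_fun f g : continuous f -> continuous g ->
  continuous (fun x => f x * g x).
Proof. by move=> cf cg x; apply: cvgM; [exact: cf|exact: cg]. Qed.

Lemma continuousN_fun f : continuous f -> continuous (fun x => - f x).
Proof. by move=> cf x; apply: cvgN; exact: cf. Qed.

Lemma continuous_mulc c f : continuous f -> continuous (fun x => c * f x).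
Proof. by move=> cf x; apply: cvg_mulc; exact: cf. Qed.

Lemma continuous_compose (U V : topologicalType) (f : T -> U) (g : U -> V) :
  continuous f -> continuous g -> continuous (fun x => g (f x)).
Proof. by move=> cf cg x; apply: continuous_comp; [exact: cf|exact: cg]. Qed.

Lemma continuous_prod (I : Type) (s : seq I) (F : I -> T -> R) :
  (forall i, continuous (F i)) -> continuous (fun x => \prod_(i <- s) F i x).
Proof. by move=> cF; apply: continuous_big => //; exact: mul_continuous. Qed.

End continuous_real_functions.

Section derive_real_functions.
Variables (R : realType) (s : R).
Implicit Types f g : R -> R.

Lemma is_deriveD_fun f g df dg : is_derive s 1 f df -> is_derive s 1 g dg ->
  is_derive s 1 (fun t => f t + g t) (df + dg).
Proof. exact: is_deriveD. Qed.

Lemma is_deriveB_fun f g df dg : is_derive s 1 f df -> is_derive s 1 g dg ->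
  is_derive s 1 (fun t => f t - g t) (df - dg).
Proof. exact: is_deriveB. Qed.

Lemma is_deriveN_fun f df : is_derive s 1 f df ->
  is_derive s 1 (fun t => - f t) (- df).
Proof. exact: is_deriveN. Qed.

Lemma is_deriveM_fun f g df dg : is_derive s 1 f df -> is_derive s 1 g dg ->
  is_derive s 1 (fun t => f t * g t) (df * g s + f s * dg).
Proof.
move=> Hf Hg; apply: (is_derive_eq (is_deriveM Hf Hg)).
by rewrite /GRing.scale /= addrC mulrC.
Qed.

Lemma is_derive_mulc c f df : is_derive s 1 f df ->
  is_derive s 1 (fun t => c * f t) (c * df).
Proof. exact: is_deriveZ. Qed.

Lemma is_derive_idR : is_derive s 1 (fun t : R => t) 1.
Proof. exact: is_derive_id. Qed.

Lemma is_derive_affine (a b : R) : is_derive s 1 (fun t => a + t * b) b.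
Proof.
apply: is_derive_eq (is_deriveD_fun (is_derive_cst a s 1)
  (is_deriveM_fun is_derive_idR (is_derive_cst b s 1))) _.
by rewrite add0r mul1r mulr0 addr0.
Qed.

Lemma is_derive_scale (b : R) : is_derive s 1 (fun t => t * b) b.
Proof.
rewrite (_ : (fun _ => _) = (fun t => 0 + t * b)); first exact: is_derive_affine.
by apply/funext => t; rewrite add0r.
Qed.

Lemma is_derive_comp_fun f g df dg : is_derive (g s) 1 f df -> is_derive s 1 g dg ->
  is_derive s 1 (fun t => f (g t)) (df * dg).
Proof. exact: is_derive1_comp. Qed.

Lemma is_derive_expR_fun f df : is_derive s 1 f df ->
  is_derive s 1 (fun t => expR (f t)) (df * expR (f s)).
Proof.
by move=> Hf; rewrite mulrC; apply: is_derive_comp_fun; exact: is_derive_expR.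
Qed.

Lemma is_derive_sum_fun (I : eqType) (r : seq I) (F : I -> R -> R) (dF : I -> R) :
  (forall i, i \in r -> is_derive s 1 (F i) (dF i)) ->
  is_derive s 1 (fun t => \sum_(i <- r) F i t) (\sum_(i <- r) dF i).
Proof.
elim: r => [_|i r IH HF].
  rewrite big_nil; rewrite (_ : (fun _ => _) = cst 0); first exact: is_derive_cst.
  by apply/funext => t; rewrite big_nil.
rewrite big_cons (_ : (fun _ => _) = (fun t => F i t + \sum_(j <- r) F j t)).
  apply: is_deriveD_fun; first by apply: HF; rewrite mem_head.
  by apply: IH => j jr; apply: HF; rewrite inE jr orbT.
by apply/funext => t; rewrite big_cons.
Qed.

Lemma is_derive_inv_fun f df : f s != 0 -> is_derive s 1 f df ->
  is_derive s 1 (fun t => (f t)^-1) (- df / f s ^+ 2).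
Proof.
move=> fs [dvf <-]; split; first exact: derivableV.
rewrite deriveV// /GRing.scale /=.
by rewrite !mulNr mulrC -exprVn.
Qed.

End derive_real_functions.

Section continuity.
Variables (R : realType) (n : nat).
Implicit Types (x y : 'rV[R]_n).

Lemma cvg_dot (T : Type) (F : set_system T) (FF : Filter F) (f g : T -> 'rV[R]_n) x y :
  f @ F --> x -> g @ F --> y -> dot (f t) (g t) @[t --> F] --> dot x y.
Proof.
move=> fx gy; apply: cvg_big => [|i _]; first exact: add_continuous.
by apply: cvgM; [apply: (cvg_comp f (fun z : 'rV[R]_n => z ord0 i) fx)|
  apply: (cvg_comp g (fun z : 'rV[R]_n => z ord0 i) gy)]; exact: coord_continuous.
Qed.

Lemma continuous_dotl y : continuous (dot y).
Proof. by move=> x; apply: (@cvg_dot _ (nbhs x) _ (cst y) id); [exact: cvg_cst|exact: cvg_id]. Qed.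

Lemma continuous_dot_self : continuous (fun x => dot x x).
Proof. by move=> x; apply: (@cvg_dot _ (nbhs x) _ id id); exact: cvg_id. Qed.

(** The library norm of a row vector is the max norm, which reflections do not preserve; the
    Euclidean norm is invariant. Bounding a scalar product by [eucl] times [l1norm] is a crude
    Cauchy-Schwarz inequality that suffices for all estimates here. *)
Definition eucl x : R := Num.sqrt (dot x x).
Definition l1norm x : R := \sum_(i < n) `|x ord0 i|.

Lemma eucl_ge0 x : 0 <= eucl x. Proof. exact: sqrtr_ge0. Qed.

Lemma l1norm_ge0 x : 0 <= l1norm x. Proof. exact: sumr_ge0. Qed.

Lemma sqr_eucl x : eucl x ^+ 2 = dot x x.
Proof. by rewrite sqr_sqrtr// dot_ge0. Qed.

Lemma euclZ c x : eucl (c *: x) = `|c| * eucl x.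
Proof. by rewrite /eucl !dotE mulrA -expr2 sqrtrM ?sqr_ge0// sqrtr_sqr. Qed.

Lemma eucl0 : eucl 0 = 0. Proof. by rewrite /eucl dot0l sqrtr0. Qed.

Lemma eucl_reflection a x : dot a a = 2 -> eucl (reflection a x) = eucl x.
Proof. by move=> a2; rewrite /eucl dot_reflection. Qed.

Lemma eucl_gt0 x : x != 0 -> 0 < eucl x.
Proof. by move=> x0; rewrite sqrtr_gt0 lt_def dot_ge0 dot_eq0 x0. Qed.

Lemma coord_le_eucl x i : `|x ord0 i| <= eucl x.
Proof.
rewrite -sqrtr_sqr ler_wsqrtr// /dot (bigD1 i)//= -expr2 lerDl.
by apply: sumr_ge0 => j _; rewrite -expr2 sqr_ge0.
Qed.

Lemma norm_le_eucl x : `|x| <= eucl x.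
Proof. by apply: ler_rV_norm => [|i]; [exact: eucl_ge0|exact: coord_le_eucl]. Qed.

Lemma norm_dot_le x y : `|dot x y| <= eucl x * l1norm y.
Proof.
apply: le_trans (ler_norm_sum _ _ _) _; rewrite /l1norm mulr_sumr.
by apply: ler_sum => i _; rewrite normrM ler_wpM2r// coord_le_eucl.
Qed.

Lemma l1norm_le_norm x : l1norm x <= n%:R * `|x|.
Proof.
apply: le_trans (ler_sum _ _) _ => [i _|]; first exact: ler_coord.
by rewrite sumr_const card_ord mulr_natl.
Qed.

Lemma eucl_le_norm x : eucl x <= (n%:R + 1) * `|x|.
Proof.
rewrite -[leRHS]ger0_norm ?mulr_ge0 ?addr_ge0// -sqrtr_sqr ler_wsqrtr//.
rewrite exprMn (@le_trans _ _ (n%:R * `|x| ^+ 2))//; last first.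
  rewrite ler_wpM2r ?sqr_ge0//; have : 0 <= n%:R :> R by [].
  by move: (n%:R : R) => m; nra.
rewrite /dot mulr_natl -[X in _ *+ X]card_ord -sumr_const; apply: ler_sum => i _.
by rewrite -expr2 -real_normK ?num_real// lerXn2r ?nnegrE// ler_coord.
Qed.

Lemma continuous_eucl : continuous eucl.
Proof.
move=> x; rewrite /eucl; apply: (cvg_comp (fun x : 'rV[R]_n => dot x x) Num.sqrt).
  exact: continuous_dot_self.
exact: sqrt_continuous.
Qed.

Lemma compact_eucl_ball (r : R) : compact [set x | eucl x <= r].
Proof.
apply: bounded_closed_compact.
  exists r; split; first exact: num_real.
  by move=> M rM x /= xr; rewrite (le_trans (norm_le_eucl x))// (le_trans xr)// ltW.
rewrite (_ : [set x | _] = eucl @^-1` [set z | z <= r])//.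
by apply: preimage_closed; [move=> x _; exact: continuous_eucl|exact: closed_le].
Qed.

Lemma is_derive_line (f : 'rV[R]_n -> R) x v (s : R) : derivable f (x + s *: v) v ->
  is_derive s 1 (fun t : R => f (x + t *: v)) ('D_v f (x + s *: v)).
Proof.
move=> df.
have E : (fun h : R => h^-1 *: (f (x + (h *: (1 : R) + s) *: v) - f (x + s *: v))) =
    (fun h : R => h^-1 *: (f (h *: v + (x + s *: v)) - f (x + s *: v))).
  apply/funext => h; rewrite [h *: 1]mulr1.
  by rewrite (_ : x + (h + s) *: v = h *: v + (x + s *: v)) // scalerDl addrCA.
by split; rewrite /derivable /derive /= E.
Qed.

End continuity.

Lemma derive_ge0_left_max (R : realType) (phi : R -> R) (c d r : R) :
  0 < r -> is_derive c 1 phi d -> (forall s, c - r < s < c -> phi s <= phi c) -> 0 <= d.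
Proof.
move=> r0 dphi Hmax; rewrite leNgt; apply/negP => d0.
have := @ex_derive _ _ _ _ _ _ _ dphi; rewrite /derivable => /cvg_ex[l cl].
have ld : l = d by rewrite -(@derive_val _ _ _ _ _ _ _ dphi); apply/esym/cvg_lim.
rewrite ld in cl.
have : nbhs (0 : R) (fun h => h != 0 -> h^-1 *: ((phi \o shift c) h%:A - phi c) < 0).
  exact: (cvgr_lt d cl 0 d0).
move=> /nbhs_ballP[e /= e0 He].
pose h := - (Num.min (e / 2) (r / 2)).
have h0 : h < 0 by rewrite oppr_lt0 lt_min !divr_gt0.
have eh : `|h| < e.
  by rewrite ltr0_norm// opprK gt_min; apply/orP; left; lra.
have rh : - r < h by rewrite ltrN2 gt_min; apply/orP; right; lra.
have /(_ _ _)/= := He h; rewrite -ball_normE /= sub0r normrN => /(_ eh (ltr0_neq0 h0)).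
rewrite [h *: 1]mulr1 [_ *: _]/(_ * _) => {}He.
have : phi (h + c) <= phi c by apply: Hmax; apply/andP; split; lra.
rewrite -subr_le0 => q0; have := mulr_le0 (_ : h^-1 <= 0) q0.
by rewrite invr_le0 ltW// leNgt He => /(_ isT).
Qed.

Section radial_maximum_principle.
Variables (R : realType) (n : nat) (Rp : {fset 'rV[R]_n}).
Hypothesis Rp_norm : forall a, a \in Rp -> dot a a = 2.

(* At an interior maximum of [g x * expR (- A * eucl x) - (del + eta) * eucl x]
   over a ball the reflections do not increase g, and the derivative along the
   ray is nonnegative. *)
Lemma radial_maximum_principle (g : 'rV[R]_n -> R) (A del c : R) :
  continuous g -> (forall x, derivable g x x) ->
  0 <= A -> 0 <= del -> 0 <= c -> g 0 <= c ->
  (forall x, 0 < g x -> (forall a, a \in Rp -> g (reflection a x) <= g x) ->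
    'D_x g x <= eucl x * (A * g x + del * expR (A * eucl x))) ->
  forall x, g x <= (c + del * eucl x) * expR (A * eucl x).
Proof.
move=> cg dg A0 del0 c0 g0 Hg x1; rewrite leNgt; apply/negP => gx1.
pose gap := g x1 * expR (- (A * eucl x1)) - del * eucl x1 - c.
have gap0 : 0 < gap.
  by rewrite /gap expRN -addrA -opprD subr_gt0 ltr_pdivlMr ?expR_gt0// addrC.
(* The extra slope eta makes the inequality at the maximum strict, and it is small enough to leave
   the value at x1 above c. *)
pose eta := gap / (2 * (eucl x1 + 1)).
have e1 : 0 < 2 * (eucl x1 + 1) by have := eucl_ge0 x1; lra.
have eta0 : 0 < eta by rewrite divr_gt0.
pose phi x := g x * expR (- (A * eucl x)) - (del + eta) * eucl x.
have phix1 : c < phi x1.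
  have : eta * eucl x1 < gap.
    rewrite /eta mulrAC ltr_pdivrMr// ltr_pM2l//.
    by have := eucl_ge0 x1; move: (eucl x1) => z; lra.
  by rewrite /phi /gap; lra.
have cphi : continuous phi.
  apply: continuousB_fun; last exact/continuous_mulc/continuous_eucl.
  apply: continuousM_fun => //; apply: continuous_compose; last exact: continuous_expR.
  exact/continuousN_fun/continuous_mulc/continuous_eucl.
have [||xs] := @compact_EVT_max _ _ phi _ _ (@compact_eucl_ball _ n (eucl x1)).
- by exists x1 => /=.
- exact: continuous_subspaceT.
rewrite inE /= => xsx1 Hmax.
have phixs : c < phi xs by rewrite (lt_le_trans phix1)// Hmax// inE /=.
have xs0 : xs != 0.
  apply: contraTneq phixs => ->; rewrite /phi eucl0 !mulr0 oppr0 expR0 mulr1 addr0.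
  by rewrite -leNgt.
have N0 := eucl_gt0 xs0.
have E0 := expR_gt0 (- (A * eucl xs)).
have gxs0 : 0 < g xs.
  rewrite -(pmulr_lgt0 _ E0); apply: (le_lt_trans c0).
  apply: (lt_le_trans phixs); rewrite /phi gerDl oppr_le0 mulr_ge0 ?ltW//.
  exact: ltr_wpDl.
have gr a : a \in Rp -> g (reflection a xs) <= g xs.
  move=> aR; have a2 := Rp_norm aR.
  have := Hmax (reflection a xs); rewrite inE /= eucl_reflection// => /(_ xsx1).
  by rewrite /phi eucl_reflection// lerD2r ler_pM2r.
have {}Hg := Hg xs gxs0 gr.
pose psi (s : R) := g (0 + s *: xs) * expR (- (A * (s * eucl xs))) -
  (del + eta) * (s * eucl xs).
have dpsi : is_derive (1 : R) 1 psi ('D_xs g xs * expR (- (A * eucl xs)) -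
    A * eucl xs * g xs * expR (- (A * eucl xs)) - (del + eta) * eucl xs).
  have h1 : is_derive (1 : R) 1 (fun s : R => g (0 + s *: xs)) ('D_xs g xs).
    have := @is_derive_line _ _ g 0 xs 1; rewrite add0r scale1r; apply.
    exact: dg.
  have h2 := is_derive_mulc (del + eta) (is_derive_scale 1 (eucl xs)).
  have h3 := is_derive_expR_fun (is_deriveN_fun (is_derive_mulc A (is_derive_scale 1 (eucl xs)))).
  apply: is_derive_eq (is_deriveB_fun (is_deriveM_fun h1 h3) h2) _.
  by rewrite add0r scale1r !mul1r; ring.
have : 0 <= 'D_xs g xs * expR (- (A * eucl xs)) -
    A * eucl xs * g xs * expR (- (A * eucl xs)) - (del + eta) * eucl xs.
  apply: (derive_ge0_left_max ltr01 dpsi) => s /andP[]; rewrite subrr => s0 s1.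
  have -> : psi s = phi (s *: xs).
    by rewrite /psi /phi add0r euclZ gtr0_norm.
  have -> : psi 1 = phi xs by rewrite /psi /phi add0r scale1r mul1r.
  apply: Hmax; rewrite inE /= euclZ gtr0_norm// (le_trans _ xsx1)//.
  by rewrite ler_piMl ?eucl_ge0// ltW.
have : 'D_xs g xs * expR (- (A * eucl xs)) <=
    eucl xs * A * g xs * expR (- (A * eucl xs)) + eucl xs * del.
  apply: (le_trans (ler_wpM2r (ltW E0) Hg)).
  rewrite mulrDr mulrDl !mulrA lerD2l -[leLHS]mulrA.
  by rewrite -expRD subrr expR0 mulr1.
have : 0 < eta * eucl xs by rewrite mulr_gt0.
lra.
Qed.

End radial_maximum_principle.

(** * The Dunkl kernel *)

Section dunkl_kernel_theory.
Variables (R : realType) (n : nat) (Phi Rp : {fset 'rV[R]_n}) (k : 'rV[R]_n -> R).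
Hypotheses (rs : root_system Phi) (ps : positive_subsystem Phi Rp)
  (mk : multiplicity_function Phi k).
Implicit Types (a x y xi : 'rV[R]_n).

Lemma positive_root a : a \in Rp -> a \in Phi.
Proof. by case: ps => b _ ->; rewrite !inE => /andP[]. Qed.

(** The Dunkl operators sum over Rp, but only Phi is stable under reflections; passing to Phi lets
    sums be reindexed by them. *)
Lemma sum_even_roots (g : 'rV[R]_n -> R) :
  (forall a, a \in Phi -> g (- a) = g a) ->
  \sum_(a <- Phi) g a = 2 * \sum_(a <- Rp) g a.
Proof.
case: ps => b b0 RpE gN.
have -> : \sum_(a <- Rp) g a = \sum_(a <- Phi | 0 < dot a b) g a.
  by rewrite RpE big_fset.
rewrite (bigID (fun a => 0 < dot a b))/= mulrDl mul1r; congr (_ + _).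
rewrite big_mkcond/= -(reindex_opp rs) /= [RHS]big_mkcond/=.
apply: eq_big_seq => a aP; rewrite dotNl oppr_gt0 -leNgt gN//.
by rewrite le_eqVlt eq_sym (negPf (b0 a aP)).
Qed.

Variable D : 'rV[R]_n -> 'rV[R]_n -> R.
Hypothesis hD : is_dunkl_kernel Rp k D.

Lemma dunkl_kernel_continuous y : continuous (D^~ y).
Proof. by case: (hD y) => /real_analytic_continuous. Qed.

Lemma dunkl_kernel_derivable y x xi : derivable (D^~ y) x xi.
Proof. by case: (hD y) => /real_analytic_derivable. Qed.

Lemma dunkl_kernel0 y : D 0 y = 1.
Proof. by case: (hD y). Qed.

(** In the direction xi = x the denominators a.x cancel, so the equation has no singularity on the
    hyperplanes. This is why the kernel is estimated along rays. *)
Lemma dunkl_kernel_radial y x : 'D_x (D^~ y) x =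
  dot x y * D x y - \sum_(a <- Rp) k a * (D x y - D (reflection a x) y).
Proof.
have [_ _ /(_ x x)] := hD y; rewrite /dunkl_operator => <-.
rewrite -addrA -sumrB big1_seq ?addr0// => a /andP[_ aR].
rewrite /reflection_quotient; case: eqVneq => [ax|ax].
  by rewrite ax mulr0 mul0r reflection_id// subrr mulr0 subrr.
by rewrite -mulrA (mulrC (dot a x)) divfK// subrr.
Qed.

Lemma dunkl_kernel_gradient y x xi : regular Phi x -> 'D_xi (D^~ y) x =
  dot xi y * D x y - 2^-1 * \sum_(a <- Phi)
    k a * dot a xi * ((D x y - D (reflection a x) y) / dot a x).
Proof.
move=> rx; rewrite sum_even_roots => [|a aP]; last first.
  by rewrite (mult_opp rs mk)// reflectionN !dotNl invrN !mulrN mulNr opprK.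
have [_ _ /(_ xi x)] := hD y; rewrite /dunkl_operator => <-.
rewrite mulKf ?pnatr_eq0// -addrA -sumrB big1_seq ?addr0// => a /andP[_ aR].
by rewrite /reflection_quotient (negPf (rx _ (positive_root aR))) subrr.
Qed.

Let Rp_norm a : a \in Rp -> dot a a = 2.
Proof. by move=> /positive_root/(root_norm rs). Qed.

(** With k >= 0 the nonlocal term of the radial equation has the favourable sign wherever
    reflections do not increase g. *)
Lemma mult_diff_sum_ge0 (g : 'rV[R]_n -> R) x :
  (forall a, a \in Rp -> g (reflection a x) <= g x) ->
  0 <= \sum_(a <- Rp) k a * (g x - g (reflection a x)).
Proof.
move=> gr; rewrite big_seq sumr_ge0// => a aR.
by rewrite mulr_ge0 ?subr_ge0 ?gr// (mult_ge0 mk)// positive_root.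
Qed.

Lemma mulr_dot_le x y (g : R) : 0 <= g -> dot x y * g <= eucl x * (l1norm y * g).
Proof.
by move=> g0; rewrite mulrA ler_wpM2r// (le_trans (ler_norm _))// norm_dot_le.
Qed.

Lemma dunkl_kernel_ge0 x y : 0 <= D x y.
Proof.
rewrite -oppr_le0.
have -> : 0 = (0 + 0 * eucl x) * expR (l1norm y * eucl x) by rewrite mul0r add0r mul0r.
apply: (@radial_maximum_principle _ _ _ Rp_norm (fun x => - D x y)) => //.
- exact/continuousN_fun/dunkl_kernel_continuous.
- by move=> z; apply: derivableN; exact: dunkl_kernel_derivable.
- exact: l1norm_ge0.
- by rewrite dunkl_kernel0 oppr_le0.
move=> z gz gr; rewrite mul0r addr0.
rewrite [X in X <= _](_ : _ = - 'D_z (D^~ y) z); last first.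
  by rewrite deriveN//; exact: dunkl_kernel_derivable.
rewrite dunkl_kernel_radial opprB.
apply: le_trans (mulr_dot_le _ _ (ltW gz)).
rewrite mulrN gerDr -oppr_ge0 -sumrN; have := mult_diff_sum_ge0 (g := fun x => - D x y) gr.
by congr (_ <= _); apply: eq_bigr => a _; ring.
Qed.

Lemma dunkl_kernel_le x y : D x y <= expR (l1norm y * eucl x).
Proof.
have -> : expR (l1norm y * eucl x) = (1 + 0 * eucl x) * expR (l1norm y * eucl x).
  by rewrite mul0r addr0 mul1r.
apply: (@radial_maximum_principle _ _ _ Rp_norm (fun x => D x y)) => //.
- exact: dunkl_kernel_continuous.
- by move=> z; exact: dunkl_kernel_derivable.
- exact: l1norm_ge0.
- by rewrite dunkl_kernel0.
move=> z gz gr; rewrite mul0r addr0 dunkl_kernel_radial.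
apply: le_trans (mulr_dot_le _ _ (ltW gz)).
by rewrite gerDl oppr_le0; exact: (mult_diff_sum_ge0 (g := fun x => D x y) gr).
Qed.

(** The difference solves the radial equation of y with the source x.(y - y') D(x, y'), which
    becomes [del] in the maximum principle. The rate includes [l1norm y'] so that the exponential
    bound on D(x, y') is absorbed. *)
Let lip_aux x y y' : D x y - D x y' <=
  l1norm (y - y') * eucl x * expR ((l1norm y + l1norm y') * eucl x).
Proof.
rewrite -[l1norm _ * eucl x]add0r.
apply: (@radial_maximum_principle _ _ _ Rp_norm (fun x => D x y - D x y')) => //.
- by apply: continuousB_fun; exact: dunkl_kernel_continuous.
- by move=> z; apply: derivableB; exact: dunkl_kernel_derivable.
- by rewrite addr_ge0// l1norm_ge0.
- exact: l1norm_ge0.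
- by rewrite !dunkl_kernel0 subrr.
move=> z gz gr.
rewrite [X in X <= _](_ : _ = 'D_z (D^~ y) z - 'D_z (D^~ y') z); last first.
  by rewrite deriveB//; exact: dunkl_kernel_derivable.
rewrite !dunkl_kernel_radial.
have := mult_diff_sum_ge0 (g := fun x => D x y - D x y') gr.
have -> : \sum_(a <- Rp) k a * (D z y - D z y' -
      (D (reflection a z) y - D (reflection a z) y')) =
    \sum_(a <- Rp) k a * (D z y - D (reflection a z) y) -
    \sum_(a <- Rp) k a * (D z y' - D (reflection a z) y').
  by rewrite -sumrB; apply: eq_bigr => a _; ring.
have h1 := mulr_dot_le z y (ltW gz).
have h2 := mulr_dot_le z (y - y') (dunkl_kernel_ge0 z y').
have h3 : D z y' <= expR ((l1norm y + l1norm y') * eucl z).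
  apply: le_trans (dunkl_kernel_le _ _) _.
  by rewrite ler_expR ler_wpM2r ?eucl_ge0// lerDr l1norm_ge0.
have h4 : eucl z * (l1norm (y - y') * D z y') <=
    eucl z * (l1norm (y - y') * expR ((l1norm y + l1norm y') * eucl z)).
  by rewrite ler_wpM2l ?eucl_ge0// ler_wpM2l ?l1norm_ge0.
have h5 : 0 <= eucl z * (l1norm y' * (D z y - D z y')).
  by rewrite !mulr_ge0 ?eucl_ge0 ?l1norm_ge0 ?ltW.
rewrite dotBr in h2; rewrite mulrDr mulrDl mulrDr; lra.
Qed.

Lemma dunkl_kernel_lipschitz x y y' : `|D x y - D x y'| <=
  l1norm (y - y') * eucl x * expR ((l1norm y + l1norm y') * eucl x).
Proof.
rewrite ler_norml lip_aux andbT lerNl opprB.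
apply: le_trans (lip_aux _ _ _) _.
rewrite [l1norm y' + _]addrC (_ : l1norm (y' - y) = l1norm (y - y'))//.
by apply: eq_bigr => i _; rewrite !mxE distrC.
Qed.

Lemma derive_scale_arg (f : 'rV[R]_n -> R) c x : derivable f (c *: x) (c *: x) ->
  derivable (fun z => f (c *: z)) x x /\
  'D_x (fun z => f (c *: z)) x = 'D_(c *: x) f (c *: x).
Proof.
have E : (fun h : R => h^-1 *: (f (c *: (h *: x + x)) - f (c *: x))) =
    (fun h : R => h^-1 *: (f (h *: (c *: x) + c *: x) - f (c *: x))).
  by apply/funext => h; rewrite (scalerDr c (h *: x) x) !scalerA (mulrC c h).
by rewrite /derivable /derive /= E => df; split.
Qed.

(** Both sides solve the same radial equation and equal 1 at the origin; the maximum principle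
    applied to both differences makes them equal. In the densities this moves the two factors
    t^(-1/2) onto x, leaving y unscaled. *)
Lemma dunkl_kernel_scale c x y : D (c *: x) y = D x (c *: y).
Proof.
have dc z : derivable (fun z => D (c *: z) y) z z.
  by case: (@derive_scale_arg (D^~ y) c z (@dunkl_kernel_derivable _ _ _)).
have Dc z : 'D_z (fun z => D (c *: z) y) z = 'D_(c *: z) (D^~ y) (c *: z).
  by case: (@derive_scale_arg (D^~ y) c z (@dunkl_kernel_derivable _ _ _)).
have cc : continuous (fun z : 'rV[R]_n => D (c *: z) y).
  apply: (continuous_compose (f := fun z : 'rV[R]_n => c *: z) (g := D^~ y));
    last exact: dunkl_kernel_continuous.
  exact: scaler_continuous.
have bound0 (z : 'rV[R]_n) : (0 + 0 * eucl z) * expR (l1norm (c *: y) * eucl z) = 0.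
  by rewrite mul0r add0r mul0r.
have rad z : 'D_z (fun z => D (c *: z) y) z - 'D_z (D^~ (c *: y)) z =
    dot z (c *: y) * (D (c *: z) y - D z (c *: y)) -
    \sum_(a <- Rp) k a * (D (c *: z) y - D z (c *: y) -
      (D (c *: reflection a z) y - D (reflection a z) (c *: y))).
  rewrite Dc !dunkl_kernel_radial.
  have -> : \sum_(a <- Rp) k a * (D (c *: z) y - D z (c *: y) -
      (D (c *: reflection a z) y - D (reflection a z) (c *: y))) =
      \sum_(a <- Rp) k a * (D (c *: z) y - D (reflection a (c *: z)) y) -
      \sum_(a <- Rp) k a * (D z (c *: y) - D (reflection a z) (c *: y)).
    by rewrite -sumrB; apply: eq_bigr => a _; rewrite reflectionZ; ring.
  by rewrite dotZl dotZr; ring.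
apply/eqP; rewrite eq_le; apply/andP; split; rewrite -subr_le0 -(bound0 x).
- apply: (@radial_maximum_principle _ _ _ Rp_norm
    (fun x => D (c *: x) y - D x (c *: y))) => //.
  + by apply: continuousB_fun => //; exact: dunkl_kernel_continuous.
  + by move=> z; apply: derivableB => //; exact: dunkl_kernel_derivable.
  + exact: l1norm_ge0.
  + by rewrite scaler0 !dunkl_kernel0 subrr.
  move=> z gz gr; rewrite mul0r addr0 deriveB//; last exact: dunkl_kernel_derivable.
  rewrite rad; apply: le_trans (mulr_dot_le _ _ (ltW gz)).
  rewrite gerDl oppr_le0.
  exact: (mult_diff_sum_ge0 (g := fun x => D (c *: x) y - D x (c *: y)) gr).
- apply: (@radial_maximum_principle _ _ _ Rp_norm
    (fun x => D x (c *: y) - D (c *: x) y)) => //.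
  + by apply: continuousB_fun => //; exact: dunkl_kernel_continuous.
  + by move=> z; apply: derivableB => //; exact: dunkl_kernel_derivable.
  + exact: l1norm_ge0.
  + by rewrite scaler0 !dunkl_kernel0 subrr.
  move=> z gz gr; rewrite mul0r addr0 deriveB//; last exact: dunkl_kernel_derivable.
  rewrite -opprB rad; apply: le_trans (mulr_dot_le _ _ (ltW gz)).
  have -> : \sum_(a <- Rp) k a * (D (c *: z) y - D z (c *: y) -
      (D (c *: reflection a z) y - D (reflection a z) (c *: y))) =
      - \sum_(a <- Rp) k a * (D z (c *: y) - D (c *: z) y -
      (D (reflection a z) (c *: y) - D (c *: reflection a z) y)).
    by rewrite -sumrN; apply: eq_bigr => a _; ring.
  have := mult_diff_sum_ge0 (g := fun x => D x (c *: y) - D (c *: x) y) gr.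
  by move: (\sum_(a <- Rp) _) => S S0; lra.
Qed.

End dunkl_kernel_theory.

(** * Second derivatives and the Laplacian of the Dunkl kernel *)

Section dunkl_kernel_second_order.
Variables (R : realType) (n : nat) (Phi Rp : {fset 'rV[R]_n}) (k : 'rV[R]_n -> R).
Hypotheses (rs : root_system Phi) (ps : positive_subsystem Phi Rp)
  (mk : multiplicity_function Phi k).
Variable D : 'rV[R]_n -> 'rV[R]_n -> R.
Hypothesis hD : is_dunkl_kernel Rp k D.
Implicit Types (a x y e : 'rV[R]_n).

Definition root_quotient a x y : R := (D x y - D (reflection a x) y) / dot a x.

(** Off the hyperplanes the Dunkl equations determine the gradient of D(., y) by values of D alone.
    Differentiating this expression along e gives [dunkl_hess], with the gradients at x and at the
    reflected points. *)
Definition dunkl_grad x y : 'rV[R]_n :=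
  D x y *: y - \sum_(a <- Phi) (2^-1 * k a * root_quotient a x y) *: a.

Definition dunkl_hess e x y : R :=
  dot e y * dot e (dunkl_grad x y) - 2^-1 * \sum_(a <- Phi) k a * dot a e *
   ((dot e (dunkl_grad x y) - dot (reflection a e) (dunkl_grad (reflection a x) y)
     - dot a e * root_quotient a x y) / dot a x).

Lemma dot_dunkl_grad e x y : dot e (dunkl_grad x y) =
  dot e y * D x y - 2^-1 * \sum_(a <- Phi) k a * dot a e * root_quotient a x y.
Proof.
rewrite /dunkl_grad dotBr dotZr dot_sumr mulrC [in RHS]mulr_sumr; congr (_ - _).
by apply: eq_bigr => a _; rewrite dotZr (dotC e); ring.
Qed.

Lemma is_derive_dunkl_kernel x e y (s : R) : regular Phi (x + s *: e) ->
  is_derive s 1 (fun t : R => D (x + t *: e) y) (dot e (dunkl_grad (x + s *: e) y)).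
Proof.
move=> rx; rewrite dot_dunkl_grad -(dunkl_kernel_gradient rs ps mk hD)//.
by apply: (@is_derive_line _ _ (D^~ y)); exact: (dunkl_kernel_derivable hD).
Qed.

Lemma is_derive_dunkl_kernel_reflection a x e y (s : R) : a \in Phi ->
  regular Phi (x + s *: e) ->
  is_derive s 1 (fun t : R => D (reflection a (x + t *: e)) y)
    (dot (reflection a e) (dunkl_grad (reflection a (x + s *: e)) y)).
Proof.
move=> aP rx.
have E t : reflection a (x + t *: e) = reflection a x + t *: reflection a e.
  by rewrite reflectionD reflectionZ.
rewrite (_ : (fun _ => _) = (fun t : R => D (reflection a x + t *: reflection a e) y)).
  by rewrite E; apply: is_derive_dunkl_kernel; rewrite -E; exact: regular_reflection.
by apply/funext => t; rewrite E.
Qed.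

Lemma is_derive_dunkl_grad x e y (s : R) : regular Phi (x + s *: e) ->
  is_derive s 1 (fun t : R => dot e (dunkl_grad (x + t *: e) y))
    (dunkl_hess e (x + s *: e) y).
Proof.
move=> rx; rewrite (_ : (fun _ => _) = (fun t : R => dot e y * D (x + t *: e) y -
    2^-1 * \sum_(a <- Phi) (k a * dot a e) * (root_quotient a (x + t *: e) y))).
  2: by apply/funext => t; rewrite dot_dunkl_grad.
apply: is_deriveB_fun; first exact/is_derive_mulc/is_derive_dunkl_kernel.
apply/is_derive_mulc/is_derive_sum_fun => a aP; apply: is_derive_mulc.
have ax := rx a aP.
have dax : is_derive s 1 (fun t : R => dot a (x + t *: e)) (dot a e).
  rewrite (_ : (fun _ => _) = (fun t => dot a x + t * dot a e)).
    exact: is_derive_affine.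
  by apply/funext => t; rewrite dotDr dotZr.
have := is_deriveM_fun (is_deriveB_fun (is_derive_dunkl_kernel y rx)
  (is_derive_dunkl_kernel_reflection y aP rx)) (is_derive_inv_fun ax dax).
move=> h; apply: (is_derive_eq h).
by rewrite /root_quotient; field.
Qed.

Let double_swap x y : regular Phi x ->
  \sum_(a <- Phi) \sum_(b <- Phi) k a * k b *
    (D (reflection a x) y - D (reflection b x) y) *
    (dot a b / (dot a x * dot b x)) = 0.
Proof.
move=> rx; under eq_bigr do under eq_bigr do rewrite mulrBr mulrBl.
under eq_bigr do rewrite sumrB.
rewrite sumrB [X in _ - X]exchange_big/=; apply/eqP; rewrite subr_eq0; apply/eqP.
by apply: eq_bigr => a _; apply: eq_bigr => b _; rewrite (dotC a) (mulrC (dot a x)) (mulrC (k a)).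
Qed.

Let root_quotient_reflection a x y : a \in Phi -> regular Phi x ->
  \sum_(b <- Phi) k b * dot a b * root_quotient b (reflection a x) y =
  - \sum_(b <- Phi) k b * dot a b * ((D (reflection a x) y -
      D (reflection a (reflection b x)) y) / dot b x).
Proof.
move=> aP rx; rewrite -(sum_reflection rs _ aP) -sumrN; apply: eq_big_seq => b bP.
have a2 := root_norm rs aP.
rewrite (mult_reflection mk)// -dot_reflectionl reflection_self// dotNl.
rewrite /root_quotient reflection_conj// reflectionK// dot_reflectionl reflectionK//.
by rewrite mulrN mulNr.
Qed.

(** The equation (sum of T_i^2) D = |y|^2 D for the Dunkl Laplacian, solved for the ordinary
    Laplacian. The trace of [dunkl_hess] still contains gradients at reflected points, and the work
    is to eliminate them. *)
Lemma sum_dunkl_hess x y : regular Phi x ->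
  \sum_(i < n) dunkl_hess (delta_mx ord0 i) x y =
  dot y y * D x y - \sum_(a <- Phi) k a *
    ((dot a (dunkl_grad x y) - root_quotient a x y) / dot a x).
Proof.
move=> rx; rewrite /dunkl_hess.
pose g := dunkl_grad x y; pose g' a := dunkl_grad (reflection a x) y.
have -> : \sum_(i < n) (dot (delta_mx ord0 i) y * dot (delta_mx ord0 i) g -
    2^-1 * \sum_(a <- Phi) k a * dot a (delta_mx ord0 i) *
    ((dot (delta_mx ord0 i) g - dot (reflection a (delta_mx ord0 i)) (g' a)
     - dot a (delta_mx ord0 i) * root_quotient a x y) / dot a x)) =
    dot y g - 2^-1 * \sum_(a <- Phi) k a *
    ((dot a g + dot a (g' a) - 2 * root_quotient a x y) / dot a x).
  rewrite sumrB; congr (_ - _).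
    rewrite -(dot_sum_delta y g); apply: eq_bigr => i _.
    by rewrite dotC (dotC _ g).
  rewrite -mulr_sumr exchange_big/=; congr (_ * _); apply: eq_big_seq => a aP.
  have a2 := root_norm rs aP.
  transitivity (\sum_(i < n) (k a / dot a x * (dot a (delta_mx ord0 i) * dot g (delta_mx ord0 i)) -
    k a / dot a x * (dot a (delta_mx ord0 i) * dot (reflection a (g' a)) (delta_mx ord0 i)) -
    k a / dot a x * root_quotient a x y * (dot a (delta_mx ord0 i) * dot a (delta_mx ord0 i)))).
    apply: eq_bigr => i _; rewrite (dotC _ g) dot_reflectionl [dot (delta_mx _ _) _]dotC.
    by ring.
  rewrite !sumrB -!mulr_sumr !dot_sum_delta -dot_reflectionl reflection_self// dotNl a2.
  by ring.
(* Inserting the gradient formula at x and at [reflection a x] leaves two double sums over roots.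
   The one in D(reflection a x) - D(reflection b x) is antisymmetric in (a, b); the one in D(x) -
   D(reflection a (reflection b x)) is the sum over rotations. *)
have key : \sum_(a <- Phi) k a * ((dot a g - dot a (g' a)) / dot a x) =
    \sum_(a <- Phi) k a * dot a y * root_quotient a x y.
  apply/eqP; rewrite -subr_eq0 -sumrB; apply/eqP.
  transitivity (- 2^-1 * \sum_(a <- Phi) \sum_(b <- Phi)
    (k a * k b * (D (reflection a x) y - D (reflection b x) y) *
      (dot a b / (dot a x * dot b x)) +
     k a * k b * (D x y - D (reflection a (reflection b x)) y) *
      (dot a b / (dot a x * dot b x)))); last first.
    under eq_bigr do rewrite big_split/=.
    have /= rot := sum_root_rotations_eq0 rs mk (D^~ y) rx.
    by rewrite big_split/= double_swap// rot addr0 mulr0.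
  rewrite mulr_sumr; apply: eq_big_seq => a aP.
  rewrite !dot_dunkl_grad.
  under [X in _ * _ - 2^-1 * X]eq_bigr do rewrite (dotC _ a).
  under [X in (_ - (_ - 2^-1 * X))]eq_bigr do rewrite (dotC _ a).
  rewrite root_quotient_reflection//.
  have ax := rx a aP.
  transitivity (- 2^-1 * (k a / dot a x) * (\sum_(b <- Phi) k b * dot a b * root_quotient b x y +
    \sum_(b <- Phi) k b * dot a b * ((D (reflection a x) y -
      D (reflection a (reflection b x)) y) / dot b x))).
    rewrite [X in _ - k a * dot a y * X]/root_quotient.
    move: (\sum_(b <- Phi) k b * dot a b * root_quotient b x y) => S1.
    move: (\sum_(b <- Phi) _) => S2.
    by field.
  rewrite -big_split/= -mulrA !mulr_sumr; apply: eq_big_seq => b bP.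
  by have bx := rx b bP; rewrite /root_quotient; field; rewrite ax bx.
rewrite dot_dunkl_grad -key -/g.
have ring_split : \sum_(a <- Phi) k a *
     ((dot a g + dot a (g' a) - 2 * root_quotient a x y) / dot a x) =
   2 * \sum_(a <- Phi) k a * ((dot a g - root_quotient a x y) / dot a x) -
   \sum_(a <- Phi) k a * ((dot a g - dot a (g' a)) / dot a x).
  by rewrite mulr_sumr -sumrB; apply: eq_bigr => a _; ring.
by rewrite ring_split; field.
Qed.

End dunkl_kernel_second_order.

(** * Finite differences *)

Section finite_differences.
Variable R : realType.
Implicit Types (phi : R -> R) (e r M : R).

Lemma is_derive_approx phi d (c : R) : is_derive c 1 phi d -> forall eta, 0 < eta ->
  exists2 del, 0 < del & forall h, `|h| < del ->
    `|phi (c + h) - phi c - h * d| <= eta * `|h|.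
Proof.
move=> dphi eta eta0.
have := @ex_derive _ _ _ _ _ _ _ dphi; rewrite /derivable => /cvg_ex[l cl].
have ld : l = d by rewrite -(@derive_val _ _ _ _ _ _ _ dphi); apply/esym/cvg_lim.
rewrite ld in cl.
have : nbhs (0 : R) (fun h => h != 0 ->
    `|d - h^-1 *: ((phi \o shift c) h%:A - phi c)| <= eta).
  by have /cvgrPdist_le/(_ _ eta0) := cl.
move=> /nbhs_ballP[del /= del0 He]; exists del => // h hdel.
have [->|h0] := eqVneq h 0; first by rewrite addr0 subrr sub0r mul0r oppr0 normr0 mulr0.
have /(_ _ h0) := He h; rewrite -ball_normE /= sub0r normrN => /(_ hdel).
rewrite [h *: 1]mulr1 [_ *: _]/(_ * _) => H.
rewrite -[X in `|X|](_ : h * ((phi (h + c) - phi c) / h - d) = _).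
  by rewrite normrM mulrC ler_wpM2r// distrC [_ / h]mulrC.
by rewrite (addrC c); field.
Qed.

Lemma first_difference_bound phi phi1 r M e :
  (forall s : R, 0 <= s <= r -> is_derive s 1 phi (phi1 s)) ->
  (forall s : R, 0 <= s <= r -> `|phi1 s| <= M) -> 0 < e <= r ->
  `|(phi e - phi 0) / e| <= M.
Proof.
move=> dphi HM /andP[e0 er].
have [||c cP ->] := MVT e0 (f := phi) (df := phi1).
- by move=> c; rewrite in_itv /= => /andP[c0 ce]; apply: dphi; rewrite (ltW c0) (le_trans (ltW ce)).
- apply: derivable_within_continuous => c; rewrite in_itv /= => /andP[c0 ce].
  by apply: (@ex_derive _ _ _ _ _ _ _ (dphi c _)); rewrite c0 (le_trans ce).
rewrite in_itv /= in cP; case/andP: cP => c0 ce.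
by rewrite subr0 mulfK ?lt0r_neq0// HM// (ltW c0) (le_trans (ltW ce)).
Qed.

Lemma first_difference_cvg phi d (e_ : nat -> R) : is_derive (0 : R) 1 phi d ->
  (forall m, 0 < e_ m) -> e_ @ \oo --> 0 ->
  (phi (e_ m) - phi 0) / e_ m @[m --> \oo] --> d.
Proof.
move=> dphi e0 ecv; apply/cvgrPdist_le => eta eta0.
have [del del0 H] := is_derive_approx dphi eta0.
have : \forall m \near \oo, `|0 - e_ m| < del by move/cvgrPdist_lt : ecv; apply.
apply: filterS => m; rewrite sub0r normrN => /H; rewrite add0r => Hm.
have em := e0 m; rewrite distrC -(ler_pM2r em) -[X in _ * X <= _](gtr0_norm em) -normrM.
rewrite mulrBl divfK ?lt0r_neq0// (mulrC d) (le_trans Hm)//.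
by rewrite gtr0_norm.
Qed.

Section second.
Variables (phi phi1 phi2 : R -> R) (r : R).
Hypothesis dphi : forall s : R, `|s| <= r -> is_derive s 1 phi (phi1 s).
Hypothesis dphi1 : forall s : R, `|s| <= r -> is_derive s 1 phi1 (phi2 s).

(** The mean value theorem for phi t + phi (- t) - c t^2. The choice c = 0 yields the uniform bound,
    and c = [phi2 0] the limit. *)
Lemma second_difference_MVT c e : 0 < e <= r -> exists2 xi, 0 < xi < e &
  phi e + phi (- e) - 2 * phi 0 - c * e ^+ 2 = (phi1 xi - phi1 (- xi) - 2 * c * xi) * e.
Proof.
move=> /andP[e0 er].
pose psi t := phi t + phi (- t) - c * (t * t).
have dpsi s : 0 <= s <= r -> is_derive s 1 psi (phi1 s - phi1 (- s) - 2 * c * s).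
  move=> /andP[s0 sr].
  have h1 : is_derive s 1 phi (phi1 s) by apply: dphi; rewrite ger0_norm.
  have h2 : is_derive (- s) 1 phi (phi1 (- s)) by apply: dphi; rewrite normrN ger0_norm.
  have h3 := is_derive_comp_fun h2 (is_deriveN_fun (is_derive_idR s)).
  have h4 := is_derive_mulc c (is_deriveM_fun (is_derive_idR s) (is_derive_idR s)).
  apply: (is_derive_eq (is_deriveB_fun (is_deriveD_fun h1 h3) h4)).
  by ring.
have [||xi xiP] := MVT e0 (f := psi) (df := fun s => phi1 s - phi1 (- s) - 2 * c * s).
- by move=> t; rewrite in_itv /= => /andP[t0 te]; apply: dpsi; rewrite (ltW t0) (le_trans (ltW te)).
- apply: derivable_within_continuous => t; rewrite in_itv /= => /andP[t0 te].
  by apply: (@ex_derive _ _ _ _ _ _ _ (dpsi t _)); rewrite t0 (le_trans te).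
rewrite in_itv /= in xiP; rewrite subr0 => H; exists xi => //.
by rewrite -H /psi oppr0; ring.
Qed.

Lemma second_difference_bound M e : (forall s : R, `|s| <= r -> `|phi2 s| <= M) ->
  0 < e <= r -> `|(phi e + phi (- e) - 2 * phi 0) / e ^+ 2| <= 2 * M.
Proof.
move=> HM /andP[e0 er].
have [|xi /andP[xi0 xie]] := @second_difference_MVT 0 e; first by rewrite e0.
rewrite mul0r subr0 mulr0 mul0r subr0 => ->.
have Nxi : - xi < xi by lra.
have xir : xi <= r by rewrite (le_trans (ltW xie)).
have inr t : - xi <= t <= xi -> `|t| <= r by rewrite -ler_norml => /le_trans; apply.
have [||t tP ->] := MVT Nxi (f := phi1) (df := phi2).
- by move=> t; rewrite in_itv /= => /andP[t0 te]; apply: dphi1; rewrite inr// !ltW.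
- apply: derivable_within_continuous => t; rewrite in_itv /= => tP.
  by apply: (@ex_derive _ _ _ _ _ _ _ (dphi1 (inr _ tP))).
rewrite in_itv /= in tP; case/andP: tP => t0 te.
have /HM Mt : `|t| <= r by rewrite inr// !ltW.
rewrite opprK -mulr2n expr2 invfM mulrA mulfK ?lt0r_neq0// normrM normrV ?unitfE ?lt0r_neq0//.
rewrite (gtr0_norm e0) ler_pdivrMr// normrM (mulrC 2) -mulrA.
apply: ler_pM => //; rewrite ger0_norm; last by rewrite mulrn_wge0// ltW.
by rewrite mulr2n; lra.
Qed.

Lemma second_difference_cvg (e_ : nat -> R) : 0 < r ->
  (forall m, 0 < e_ m <= r) -> e_ @ \oo --> 0 ->
  (phi (e_ m) + phi (- e_ m) - 2 * phi 0) / e_ m ^+ 2 @[m --> \oo] --> phi2 0.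
Proof.
move=> r0 e0 ecv; apply/cvgrPdist_le => eta eta0.
have d0 : is_derive (0 : R) 1 phi1 (phi2 0) by apply: dphi1; rewrite normr0 ltW.
have eta2 : 0 < eta / 2 by rewrite divr_gt0.
have [del del0 H] := is_derive_approx d0 eta2.
have : \forall m \near \oo, `|0 - e_ m| < del by move/cvgrPdist_lt : ecv; apply.
apply: filterS => m; rewrite sub0r normrN => em.
have /andP[em0 _] := e0 m; rewrite (gtr0_norm em0) in em.
have [xi /andP[xi0 xie] Hxi] := second_difference_MVT (phi2 0) (e0 m).
have e2 : 0 < e_ m ^+ 2 by rewrite exprn_gt0.
rewrite distrC -(ler_pM2r e2) -[X in _ * X <= _](gtr0_norm e2) -normrM.
rewrite mulrBl divfK ?lt0r_neq0// Hxi normrM (gtr0_norm em0).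
rewrite expr2 mulrA ler_pM2r// (@le_trans _ _ (eta * xi))//; last first.
  by rewrite ler_pM2l// ltW.
have := H xi; rewrite (gtr0_norm xi0) add0r => /(_ (lt_trans xie em)) H1.
have := H (- xi); rewrite normrN (gtr0_norm xi0) add0r => /(_ (lt_trans xie em)) H2.
have -> : phi1 xi - phi1 (- xi) - 2 * phi2 0 * xi =
   (phi1 xi - phi1 0 - xi * phi2 0) - (phi1 (- xi) - phi1 0 - - xi * phi2 0) by ring.
by apply: le_trans (ler_normB _ _) _; lra.
Qed.

End second.

End finite_differences.

(** * The heat equation for the transition densities *)

Section heat_kernel.
Variables (R : realType) (n : nat) (Phi Rp : {fset 'rV[R]_n}) (k : 'rV[R]_n -> R).
Hypotheses (rs : root_system Phi) (ps : positive_subsystem Phi Rp)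
  (mk : multiplicity_function Phi k).
Variable D : 'rV[R]_n -> 'rV[R]_n -> R.
Hypothesis hD : is_dunkl_kernel Rp k D.
Implicit Types (a x y e : 'rV[R]_n) (t s : R).

Local Notation N := (dunkl_gamma Rp k + n%:R / 2).
Local Notation grad := (dunkl_grad Phi k D).
Local Notation hess := (dunkl_hess Phi k D).

Lemma sum_mult : \sum_(a <- Phi) k a / 2 = dunkl_gamma Rp k.
Proof.
rewrite (sum_even_roots rs ps) => [|a aP]; last by rewrite (mult_opp rs mk).
by rewrite /dunkl_gamma mulr_sumr; apply: eq_bigr => a _; field.
Qed.

(* For t > 0, [heat_gauss t x y] is t^-(gamma + n/2) exp (- (|x|^2 + |y|^2) / 2t). *)
Definition heat_gauss t x y : R :=
  expR (- (N * ln t) - (dot x x + dot y y) * (2 * t)^-1).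

Definition heat t x y : R := heat_gauss t x y * D (t^-1 *: x) y.

Lemma dunkl_density_heat t x y : 0 < t ->
  dunkl_density Rp k D t x y =
  (dunkl_constant Rp k)^-1 * heat t x y * dunkl_weight Rp k y.
Proof.
move=> t0; rewrite /dunkl_density /heat /heat_gauss expRD.
have st0 : 0 < Num.sqrt t by rewrite sqrtr_gt0.
have -> : (dunkl_constant Rp k * t `^ N)^-1 =
    (dunkl_constant Rp k)^-1 * expR (- (N * ln t)).
  by rewrite invfM /powR gt_eqF// expRN.
have <- : D (t^-1 *: x) y = D ((Num.sqrt t)^-1 *: x) ((Num.sqrt t)^-1 *: y).
  rewrite -(dunkl_kernel_scale rs ps mk hD) scalerA -invfM -expr2 sqr_sqrtr//.
  exact: ltW.
by rewrite !mulrA.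
Qed.

Lemma heat_ge0 t x y : 0 <= heat t x y.
Proof. by rewrite mulr_ge0 ?expR_ge0// (dunkl_kernel_ge0 rs ps mk hD). Qed.

Definition heat_dx t e x y : R := heat_gauss t x y *
  (dot (t^-1 *: e) (grad (t^-1 *: x) y) - dot x e / t * D (t^-1 *: x) y).

Definition heat_dxx t e x y : R := heat_gauss t x y *
  (hess (t^-1 *: e) (t^-1 *: x) y
   - 2 * (dot x e / t) * dot (t^-1 *: e) (grad (t^-1 *: x) y)
   + ((dot x e / t) ^+ 2 - dot e e / t) * D (t^-1 *: x) y).

Definition heat_dt t x y : R := heat_gauss t x y *
  (- (N / t) * D (t^-1 *: x) y
   + (dot x x + dot y y) / (2 * t ^+ 2) * D (t^-1 *: x) y
   - (t ^+ 2)^-1 * dot x (grad (t^-1 *: x) y)).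

Lemma is_derive_heat_gauss t x e y s : 0 < t ->
  is_derive s 1 (fun u : R => heat_gauss t (x + u *: e) y)
    (- (dot (x + s *: e) e / t) * heat_gauss t (x + s *: e) y).
Proof.
move=> t0; rewrite /heat_gauss; apply: is_derive_expR_fun.
rewrite (_ : (fun _ => _) = (fun u : R => (- (N * ln t) -
   (dot x x + dot y y) * (2 * t)^-1) + (- ((2 * t)^-1)) * (u * (2 * dot x e + u * dot e e)))).
  have h1 := is_derive_affine s (2 * dot x e) (dot e e).
  have h2 := is_derive_mulc (- ((2 * t)^-1)) (is_deriveM_fun (is_derive_idR s) h1).
  apply: (is_derive_eq (is_deriveD_fun (is_derive_cst (- (N * ln t) -
   (dot x x + dot y y) * (2 * t)^-1) s 1) h2)).
  by rewrite !dotE; have := lt0r_neq0 t0; move=> tn0; field.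
by apply/funext => u; rewrite !dotE (dotC e x); have := lt0r_neq0 t0; move=> tn0; field.
Qed.

Let scale_line t x e u : t^-1 *: (x + u *: e) = t^-1 *: x + u *: (t^-1 *: e).
Proof. by rewrite scalerDr !scalerA mulrC. Qed.

Let regular_scaleV t x : 0 < t -> regular Phi x -> regular Phi (t^-1 *: x).
Proof. by move=> t0; apply: regular_scale; rewrite invr_eq0 lt0r_neq0. Qed.

Lemma is_derive_heat_dx t x e y s : 0 < t -> regular Phi (x + s *: e) ->
  is_derive s 1 (fun u : R => heat t (x + u *: e) y) (heat_dx t e (x + s *: e) y).
Proof.
move=> t0 rx; have hg := is_derive_heat_gauss x e y s t0.
have hk : is_derive s 1 (fun u : R => D (t^-1 *: (x + u *: e)) y)
    (dot (t^-1 *: e) (grad (t^-1 *: (x + s *: e)) y)).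
  rewrite (_ : (fun _ => _) = (fun u : R => D (t^-1 *: x + u *: (t^-1 *: e)) y)).
    rewrite scale_line; apply: (is_derive_dunkl_kernel rs ps mk hD).
    by rewrite -scale_line; exact: regular_scaleV.
  by apply/funext => u; rewrite scale_line.
apply: (is_derive_eq (is_deriveM_fun hg hk)).
by rewrite /heat_dx; ring.
Qed.

Lemma is_derive_heat_dxx t x e y s : 0 < t -> regular Phi (x + s *: e) ->
  is_derive s 1 (fun u : R => heat_dx t e (x + u *: e) y) (heat_dxx t e (x + s *: e) y).
Proof.
move=> t0 rx; have hg := is_derive_heat_gauss x e y s t0.
have hk : is_derive s 1 (fun u : R => D (t^-1 *: (x + u *: e)) y)
    (dot (t^-1 *: e) (grad (t^-1 *: (x + s *: e)) y)).
  rewrite (_ : (fun _ => _) = (fun u : R => D (t^-1 *: x + u *: (t^-1 *: e)) y)).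
    rewrite scale_line; apply: (is_derive_dunkl_kernel rs ps mk hD).
    by rewrite -scale_line; exact: regular_scaleV.
  by apply/funext => u; rewrite scale_line.
have hh : is_derive s 1 (fun u : R => dot (t^-1 *: e) (grad (t^-1 *: (x + u *: e)) y))
    (hess (t^-1 *: e) (t^-1 *: (x + s *: e)) y).
  rewrite (_ : (fun _ => _) =
    (fun u : R => dot (t^-1 *: e) (grad (t^-1 *: x + u *: (t^-1 *: e)) y))).
    rewrite scale_line; apply: (is_derive_dunkl_grad rs ps mk hD).
    by rewrite -scale_line; exact: regular_scaleV.
  by apply/funext => u; rewrite scale_line.
have hl : is_derive s 1 (fun u : R => dot (x + u *: e) e / t) (dot e e / t).
  rewrite (_ : (fun _ => _) = (fun u => dot x e / t + u * (dot e e / t))).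
    exact: is_derive_affine.
  by apply/funext => u; rewrite !dotE; ring.
apply: (is_derive_eq (is_deriveM_fun hg (is_deriveB_fun hh (is_deriveM_fun hl hk)))).
by rewrite /heat_dxx; ring.
Qed.

Lemma is_derive_heat_dt t x y : 0 < t -> regular Phi x ->
  is_derive t 1 (fun u : R => heat u x y) (heat_dt t x y).
Proof.
move=> t0 rx; have tn0 := lt0r_neq0 t0.
have h2t : is_derive t 1 (fun u : R => 2 * u) (2 * 1) := is_derive_mulc 2 (is_derive_idR t).
have h2tn : 2 * t != 0 by rewrite mulf_neq0.
have hg : is_derive t 1 (fun u : R => heat_gauss u x y)
    ((- (N / t) + (dot x x + dot y y) / (2 * t ^+ 2)) * heat_gauss t x y).
  apply: is_derive_expR_fun.
  have h1 := is_deriveN_fun (is_derive_mulc N (is_derive1_ln t0)).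
  have h2 := is_derive_mulc (dot x x + dot y y) (is_derive_inv_fun h2tn h2t).
  apply: (is_derive_eq (is_deriveB_fun h1 h2)).
  by field.
have hk : is_derive t 1 (fun u : R => D (u^-1 *: x) y)
    (dot x (grad (t^-1 *: x) y) * (- 1 / t ^+ 2)).
  have h3 := is_derive_inv_fun tn0 (is_derive_idR t).
  apply: (is_derive_comp_fun (f := fun r => D (r *: x) y)) h3.
  rewrite (_ : (fun _ => _) = (fun r : R => D (0 + r *: x) y)).
    rewrite -[t^-1 *: x]add0r; apply: (is_derive_dunkl_kernel rs ps mk hD).
    by rewrite add0r; exact: regular_scaleV.
  by apply/funext => u; rewrite add0r.
apply: (is_derive_eq (is_deriveM_fun hg hk)).
by rewrite /heat_dt; field.
Qed.

Lemma dunkl_hess_scale c e x y : hess (c *: e) x y = c ^+ 2 * hess e x y.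
Proof.
rewrite /dunkl_hess !dotZl mulrBr; congr (_ - _); first by ring.
rewrite [RHS]mulrCA; congr (_ * _); rewrite [RHS]mulr_sumr; apply: eq_bigr => a _.
by rewrite reflectionZ !dotZl dotZr; ring.
Qed.

(** The factor 1/2 compensates for summing over Phi: this is the drift of the generator. As a single
    vector, it makes the whole first-order part one directional derivative. *)
Definition drift x : 'rV[R]_n := \sum_(a <- Phi) (k a / 2 / dot a x) *: a.

Lemma dot_drift x z : dot z (drift x) = \sum_(a <- Phi) k a / 2 / dot a x * dot a z.
Proof. by rewrite dot_sumr; apply: eq_bigr => a _; rewrite dotZr (dotC z). Qed.

(** The backward equation for X. The Gaussian is W-invariant in x, so the reflection term acts on D
    only; the |y|^2 terms of the Laplacian and of the time derivative cancel, and the exponent gamma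
    + n/2 is what Laplacian and drift extract from the Gaussian. *)
Lemma heat_equation t x y : 0 < t -> regular Phi x ->
  2^-1 * \sum_(i < n) heat_dxx t (delta_mx ord0 i) x y + heat_dx t (drift x) x y
  - heat_dt t x y + \sum_(a <- Phi) k a / 2 / dot a x ^+ 2 *
    (heat t (reflection a x) y - heat t x y) = 0.
Proof.
move=> t0 rx; have tn0 := lt0r_neq0 t0.
pose z := t^-1 *: x; have rz : regular Phi z by exact: regular_scaleV.
pose g := heat_gauss t x y.
have hxx : \sum_(i < n) heat_dxx t (delta_mx ord0 i) x y = g *
  ((t^-1) ^+ 2 * (dot y y * D z y - \sum_(a <- Phi) k a *
    ((dot a (grad z y) - root_quotient D a z y) / dot a z))
   - 2 * t^-1 ^+ 2 * dot x (grad z y) + (dot x x / t ^+ 2 - n%:R / t) * D z y).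
  rewrite -(sum_dunkl_hess rs mk)// /heat_dxx -mulr_sumr; congr (_ * _).
  rewrite big_split sumrB/=; congr (_ - _ + _).
  - by rewrite mulr_sumr; apply: eq_bigr => i _; rewrite dunkl_hess_scale.
  - rewrite -(dot_sum_delta x) mulr_sumr; apply: eq_bigr => i _.
    by rewrite dotZl (dotC (delta_mx _ _)); ring.
  - rewrite -mulr_suml; congr (_ * _); rewrite sumrB; congr (_ - _).
      rewrite -(dot_sum_delta x x) mulr_suml; apply: eq_bigr => i _.
      by rewrite -expr2 expr_div_n.
    under eq_bigr do rewrite dot_delta mxE !eqxx /= mul1r.
    by rewrite sumr_const card_ord mulr_natl.
have hx : heat_dx t (drift x) x y = g *
    (t^-1 * (\sum_(a <- Phi) k a / 2 / dot a x * dot a (grad z y))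
    - dunkl_gamma Rp k / t * D z y).
  rewrite /heat_dx dotZl (dotC (drift x)) !dot_drift -sum_mult.
  congr (_ * (_ - _ / _ * _)); apply: eq_big_seq => a aP.
  by rewrite divfK// rx.
have hr : \sum_(a <- Phi) k a / 2 / dot a x ^+ 2 * (heat t (reflection a x) y - heat t x y) =
    g * \sum_(a <- Phi) k a / 2 / dot a x ^+ 2 * (D (reflection a z) y - D z y).
  rewrite mulr_sumr; apply: eq_big_seq => a aP.
  rewrite /heat /heat_gauss (dot_reflection _ _ (root_norm rs aP)) -/(heat_gauss t x y) -/g.
  by rewrite -reflectionZ -/z; ring.
rewrite hxx hx hr /heat_dt -/g -/z -mulrA mulrCA -!mulrDr -mulrBr -mulrDr.
apply/eqP; rewrite mulf_eq0; apply/orP; right; apply/eqP.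
have -> : \sum_(a <- Phi) k a * ((dot a (grad z y) - root_quotient D a z y) / dot a z) =
   2 * t * (\sum_(a <- Phi) k a / 2 / dot a x * dot a (grad z y)) +
   2 * t ^+ 2 * \sum_(a <- Phi) k a / 2 / dot a x ^+ 2 * (D (reflection a z) y - D z y).
  rewrite !mulr_sumr -big_split/=; apply: eq_big_seq => a aP.
  have ax := rx a aP; rewrite /root_quotient /z dotZr -/z.
  by field; rewrite ax tn0.
by field.
Qed.

End heat_kernel.

(** * Uniform bounds for the heat kernel and its derivatives *)

Section heat_bounds.
Variables (R : realType) (n : nat) (Phi Rp : {fset 'rV[R]_n}) (k : 'rV[R]_n -> R).
Hypotheses (rs : root_system Phi) (ps : positive_subsystem Phi Rp)
  (mk : multiplicity_function Phi k).
Variable D : 'rV[R]_n -> 'rV[R]_n -> R.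
Hypothesis hD : is_dunkl_kernel Rp k D.
Implicit Types (a x y e : 'rV[R]_n) (t s : R).

Local Notation N := (dunkl_gamma Rp k + n%:R / 2).
Local Notation grad := (dunkl_grad Phi k D).
Local Notation hess := (dunkl_hess Phi k D).

(* [kap] is only used for the bounds on derivatives; with [kap = 0] the region
   is not constrained to stay away from the hyperplanes. *)
Variables (t1 t2 B rho kap : R).
Hypotheses (t10 : 0 < t1) (rho0 : 0 <= rho).

Definition heat_region t x y : Prop :=
  [/\ t1 <= t <= t2, eucl x <= B, eucl y <= rho & forall a, a \in Phi -> kap <= `|dot a x|].

Definition bounded_heat_region (F : R -> 'rV[R]_n -> 'rV[R]_n -> R) : Prop :=
  exists M, forall t x y, heat_region t x y -> `|F t x y| <= M.

Local Notation bnd := bounded_heat_region.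

Lemma bnd_cst c : bnd (fun _ _ _ => c).
Proof. by exists `|c|. Qed.

Lemma bndD F G : bnd F -> bnd G -> bnd (fun t x y => F t x y + G t x y).
Proof.
move=> [M HM] [M' HM']; exists (M + M') => t x y S.
by rewrite (le_trans (ler_normD _ _))// lerD ?HM ?HM'.
Qed.

Lemma bndN F : bnd F -> bnd (fun t x y => - F t x y).
Proof. by move=> [M HM]; exists M => t x y S; rewrite normrN HM. Qed.

Lemma bndB F G : bnd F -> bnd G -> bnd (fun t x y => F t x y - G t x y).
Proof. by move=> bF bG; apply: bndD => //; exact: bndN. Qed.

Lemma bndM F G : bnd F -> bnd G -> bnd (fun t x y => F t x y * G t x y).
Proof.
move=> [M HM] [M' HM']; exists (M * M') => t x y S.
by rewrite normrM ler_pM ?HM ?HM'.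
Qed.

Lemma bndX F m : bnd F -> bnd (fun t x y => F t x y ^+ m).
Proof.
move=> [M HM]; exists (M ^+ m) => t x y S.
by rewrite normrX lerXn2r ?nnegrE ?HM// (le_trans _ (HM _ _ _ S)).
Qed.

Lemma bnd_sum (r : seq 'rV[R]_n) F : (forall a, a \in r -> bnd (F a)) ->
  bnd (fun t x y => \sum_(a <- r) F a t x y).
Proof.
elim: r => [_|a r IH bF].
  by exists 0 => t x y _; rewrite big_nil normr0.
have [M HM] : bnd (fun t x y => F a t x y + \sum_(b <- r) F b t x y).
  apply: bndD; first by apply: bF; rewrite mem_head.
  by apply: IH => b br; apply: bF; rewrite inE br orbT.
by exists M => t x y S; rewrite big_cons HM.
Qed.

Lemma heat_region_reflection a t x y : a \in Phi ->
  heat_region t x y -> heat_region t (reflection a x) y.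
Proof.
move=> aP [? ? ? H]; split => //; first by rewrite eucl_reflection// (root_norm rs).
by move=> b bP; rewrite -dot_reflectionl H// (root_reflection rs).
Qed.

Lemma bnd_reflection a F : a \in Phi -> bnd F -> bnd (fun t x y => F t (reflection a x) y).
Proof.
by move=> aP [M HM]; exists M => t x y S; rewrite HM//; exact: heat_region_reflection.
Qed.

Lemma bnd_dot_x e : bnd (fun t x y => dot x e).
Proof.
exists (B * l1norm e) => t x y [_ xB _ _]; rewrite (le_trans (norm_dot_le _ _))//.
by rewrite ler_wpM2r ?l1norm_ge0.
Qed.

Lemma bnd_dot_y e : bnd (fun t x y => dot e y).
Proof.
exists (rho * l1norm e) => t x y [_ _ yr _].
by rewrite dotC (le_trans (norm_dot_le _ _))// ler_wpM2r ?l1norm_ge0.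
Qed.

Lemma bnd_sqr_x : bnd (fun t x y => dot x x).
Proof.
exists (B ^+ 2) => t x y [_ xB _ _]; rewrite ger0_norm ?dot_ge0// -sqr_eucl.
by rewrite lerXn2r ?nnegrE ?eucl_ge0// (le_trans (eucl_ge0 x)).
Qed.

Lemma bnd_sqr_y : bnd (fun t x y => dot y y).
Proof.
exists (rho ^+ 2) => t x y [_ _ yr _]; rewrite ger0_norm ?dot_ge0// -sqr_eucl.
by rewrite lerXn2r ?nnegrE ?eucl_ge0// (le_trans (eucl_ge0 y)).
Qed.

Lemma bnd_tV : bnd (fun t x y => t^-1).
Proof.
exists t1^-1 => t x y [/andP[tt1 _] _ _ _]; have t0 := lt_le_trans t10 tt1.
by rewrite ger0_norm ?invr_ge0 ?(ltW t0)// lef_pV2.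
Qed.

Lemma bnd_lnt : bnd (fun t x y => ln t).
Proof.
exists (`|ln t1| + `|ln t2|) => t x y [/andP[tt1 tt2] _ _ _].
have t0 := lt_le_trans t10 tt1; have t20 := lt_le_trans t0 tt2.
have h1 : ln t1 <= ln t by rewrite ler_ln.
have h2 : ln t <= ln t2 by rewrite ler_ln.
rewrite ler_norml; apply/andP; split.
  by have := lerNnormlW (lexx `|ln t1|); have := normr_ge0 (ln t2); lra.
by have := ler_norm (ln t2); have := normr_ge0 (ln t1); lra.
Qed.

Lemma bnd_expR F : bnd F -> bnd (fun t x y => expR (F t x y)).
Proof.
move=> [M HM]; exists (expR M) => t x y S.
by rewrite ger0_norm ?expR_ge0// ler_expR (le_trans (ler_norm _))// HM.
Qed.

Lemma bnd_heat_gauss : bnd (heat_gauss Rp k).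
Proof.
apply: bnd_expR; apply: bndB; first by apply/bndN/bndM/bnd_lnt/bnd_cst.
apply: bndM; first exact: bndD bnd_sqr_x bnd_sqr_y.
have [M HM] := bndM (bnd_cst 2^-1) bnd_tV.
by exists M => t x y S; rewrite invfM; exact: HM S.
Qed.

Lemma bnd_kernel : bnd (fun t x y => D (t^-1 *: x) y).
Proof.
exists (expR (n%:R * rho * (t1^-1 * B))) => t x y [/andP[tt1 _] xB yr _].
have t0 := lt_le_trans t10 tt1.
rewrite ger0_norm ?(dunkl_kernel_ge0 rs ps mk hD)//.
apply: le_trans (dunkl_kernel_le rs ps mk hD _ _) _; rewrite ler_expR.
apply: ler_pM; rewrite ?l1norm_ge0 ?eucl_ge0//.
  by rewrite (le_trans (l1norm_le_norm _))// ler_wpM2l// (le_trans (norm_le_eucl _)).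
rewrite euclZ ler_pM ?eucl_ge0//.
by rewrite ger0_norm ?invr_ge0 ?(ltW t0)// lef_pV2.
Qed.

Lemma bnd_heat : bnd (heat Rp k D).
Proof. exact: bndM bnd_heat_gauss bnd_kernel. Qed.

Hypothesis kap0 : 0 < kap.

Lemma bnd_dot_rootV a : a \in Phi -> bnd (fun t x y => (dot a (t^-1 *: x))^-1).
Proof.
move=> aP; exists (t2 / kap) => t x y [/andP[tt1 tt2] _ _ /(_ a aP) ax].
have t0 := lt_le_trans t10 tt1.
rewrite dotZr invfM invrK normrM normfV ger0_norm ?(ltW t0)//.
by rewrite ler_pM ?(ltW t0)// lef_pV2 ?posrE// (lt_le_trans kap0).
Qed.

Lemma bnd_root_quotient a : a \in Phi ->
  bnd (fun t x y => root_quotient D a (t^-1 *: x) y).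
Proof.
move=> aP; apply: bndM (bnd_dot_rootV aP); apply: bndB; first exact: bnd_kernel.
have [M HM] := bnd_reflection aP bnd_kernel.
by exists M => t x y S; rewrite reflectionZ; exact: HM S.
Qed.

Lemma bnd_grad e : bnd (fun t x y => dot e (grad (t^-1 *: x) y)).
Proof.
have [M HM] : bnd (fun t x y => dot e y * D (t^-1 *: x) y - 2^-1 *
    \sum_(a <- Phi) k a * dot a e * root_quotient D a (t^-1 *: x) y).
  apply: bndB; first exact: bndM (bnd_dot_y e) bnd_kernel.
  apply: bndM (bnd_cst _) _; apply: bnd_sum => a aP.
  exact: bndM (bnd_cst _) (bnd_root_quotient aP).
by exists M => t x y S; rewrite dot_dunkl_grad HM.
Qed.

Lemma bnd_hess e : bnd (fun t x y => hess e (t^-1 *: x) y).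
Proof.
apply: bndB; first exact: bndM (bnd_dot_y e) (bnd_grad e).
apply: bndM (bnd_cst _) _; apply: bnd_sum => a aP.
apply: bndM (bnd_cst _) _; apply: bndM (bnd_dot_rootV aP).
apply: bndB; last exact: bndM (bnd_cst _) (bnd_root_quotient aP).
apply: bndB; first exact: bnd_grad.
have [M HM] := bnd_reflection aP (bnd_grad (reflection a e)).
by exists M => t x y S; rewrite reflectionZ; exact: HM S.
Qed.

Lemma bnd_heat_dx e : bnd (fun t => heat_dx Phi Rp k D t e).
Proof.
apply: bndM bnd_heat_gauss _; apply: bndB.
  have [M HM] := bndM bnd_tV (bnd_grad e).
  by exists M => t x y S; rewrite dotZl; exact: HM S.
by apply: bndM bnd_kernel; exact: bndM (bnd_dot_x e) bnd_tV.
Qed.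

Lemma bnd_heat_dxx e : bnd (fun t => heat_dxx Phi Rp k D t e).
Proof.
apply: bndM bnd_heat_gauss _.
have bxt := bndM (bnd_dot_x e) bnd_tV.
apply: bndD; last first.
  apply: bndM bnd_kernel; apply: bndB; first exact: bndX.
  exact: bndM (bnd_cst _) bnd_tV.
apply: bndB.
  have [M HM] := bndM (bndX 2 bnd_tV) (bnd_hess e).
  by exists M => t x y S; rewrite dunkl_hess_scale; exact: HM S.
have [M HM] := bndM (bndM (bnd_cst 2) bxt) (bndM bnd_tV (bnd_grad e)).
by exists M => t x y S; rewrite dotZl; exact: HM S.
Qed.

Lemma bnd_heat_dt : bnd (heat_dt Phi Rp k D).
Proof.
apply: bndM bnd_heat_gauss _; apply: bndB.
  apply: bndD.
    by apply: bndM bnd_kernel; apply/bndN; exact: bndM (bnd_cst _) bnd_tV.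
  apply: bndM bnd_kernel; apply: bndM; first exact: bndD bnd_sqr_x bnd_sqr_y.
  have [M HM] := bndM (bnd_cst 2^-1) (bndX 2 bnd_tV).
  by exists M => t x y S; rewrite invfM -exprVn; exact: HM S.
have [M HM] : bnd (fun t x y => t^-1 ^+ 2 * (dot x y * D (t^-1 *: x) y - 2^-1 *
    \sum_(a <- Phi) k a * dot x a * root_quotient D a (t^-1 *: x) y)).
  apply: bndM (bndX 2 bnd_tV) _; apply: bndB.
    apply: bndM bnd_kernel; exists (B * (n%:R * rho)) => t x y [_ xB yr _].
    rewrite (le_trans (norm_dot_le _ _))// ler_pM ?eucl_ge0 ?l1norm_ge0//.
    by rewrite (le_trans (l1norm_le_norm _))// ler_wpM2l// (le_trans (norm_le_eucl _)).
  apply: bndM (bnd_cst _) _; apply: bnd_sum => a aP.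
  apply: bndM (bnd_root_quotient aP); exact: bndM (bnd_cst _) (bnd_dot_x a).
exists M => t x y S; rewrite -exprVn dot_dunkl_grad.
by under eq_bigr do rewrite (dotC _ x); exact: HM.
Qed.

End heat_bounds.

(** * Continuity of the heat kernel in y and in (t, x) *)

Section heat_continuity.
Variables (R : realType) (n : nat) (Phi Rp : {fset 'rV[R]_n}) (k : 'rV[R]_n -> R).
Hypotheses (rs : root_system Phi) (ps : positive_subsystem Phi Rp)
  (mk : multiplicity_function Phi k).
Variable D : 'rV[R]_n -> 'rV[R]_n -> R.
Hypothesis hD : is_dunkl_kernel Rp k D.
Implicit Types (a x y e : 'rV[R]_n) (t s : R).

Lemma l1normD x y : l1norm (x + y) <= l1norm x + l1norm y.
Proof.
by rewrite /l1norm -big_split; apply: ler_sum => i _; rewrite mxE ler_normD.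
Qed.

Lemma dunkl_kernel_continuous_right x : continuous (D x).
Proof.
move=> y; apply/(@cvgrPdist_le _ _ _ (nbhs y) (nbhs_filter y)) => e e0.
pose C := (n%:R + 1) * ((eucl x + 1) * expR ((l1norm y + (l1norm y + n%:R)) * eucl x)).
have C0 : 0 < C by rewrite !mulr_gt0 ?expR_gt0 ?ltr_wpDl ?eucl_ge0.
apply/nbhs_ballP; exists (Num.min 1 (e / C)) => /=; first by rewrite lt_min ltr01 divr_gt0.
move=> y'; rewrite -ball_normE /= lt_min => /andP[y1 ye].
apply: le_trans (dunkl_kernel_lipschitz rs ps mk hD x y y') _.
have yy' : l1norm y' <= l1norm y + n%:R.
  rewrite -[y'](subrK y) addrC (le_trans (l1normD _ _))// lerD2l.
  by rewrite (le_trans (l1norm_le_norm _))// ler_piMr// distrC ltW.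
apply: (@le_trans _ _ (C * `|y - y'|)); last by rewrite mulrC -ler_pdivlMr// ltW.
rewrite [C * _]mulrC mulrA -mulrA ler_pM ?l1norm_ge0 ?mulr_ge0 ?expR_ge0 ?eucl_ge0//.
  by rewrite (le_trans (l1norm_le_norm _))// [leRHS]mulrC ler_wpM2r// lerDl.
apply: ler_pM; rewrite ?eucl_ge0 ?expR_ge0 ?lerDl//.
by rewrite ler_expR ler_wpM2r ?eucl_ge0// lerD2l.
Qed.

Lemma heat_continuous_right t x : continuous (heat Rp k D t x).
Proof.
apply: continuousM_fun; last exact: dunkl_kernel_continuous_right.
apply: (continuous_compose (g := expR)); last exact: continuous_expR.
apply: continuousB_fun; first exact: cst_continuous.
apply: continuousM_fun; last exact: cst_continuous.
apply: continuousD_fun; first exact: cst_continuous.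
exact: continuous_dot_self.
Qed.

Lemma cvg_heat (T : Type) (F : set_system T) (FF : Filter F) (t_ : T -> R)
    (x_ : T -> 'rV[R]_n) t x y : 0 < t -> t_ @ F --> t -> x_ @ F --> x ->
  heat Rp k D (t_ i) (x_ i) y @[i --> F] --> heat Rp k D t x y.
Proof.
move=> t0 tc xc.
have tVc : (t_ i)^-1 @[i --> F] --> t^-1 by apply: cvgV => //; rewrite lt0r_neq0.
apply: cvgM; last first.
  apply: (cvg_comp (fun i => (t_ i)^-1 *: x_ i) (D^~ y)); last exact: dunkl_kernel_continuous.
  exact: cvgZ.
apply: (cvg_comp (fun i => - ((dunkl_gamma Rp k + n%:R / 2) * ln (t_ i)) -
    (dot (x_ i) (x_ i) + dot y y) / (2 * t_ i)) expR); last exact: continuous_expR.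
apply: cvgB.
  apply: cvgN; apply: cvg_mulc.
  exact: (cvg_comp t_ (@ln R) tc (continuous_ln t0)).
apply: cvgM; last by apply: cvgV; [rewrite mulf_neq0// lt0r_neq0|exact: cvg_mulc].
by apply: cvgD; [exact: cvg_dot|exact: cvg_cst].
Qed.

End heat_continuity.

(** * Borel sets and integrals on row vectors *)

Section rV_borel.
Variables (R : realType) (n : nat).
Implicit Types (x y : 'rV[R]_n) (f : 'rV[R]_n -> R).

Lemma measurable_dot_self (q : 'rV[R]_n) :
  measurable_fun setT (fun x : 'rV[R]_n => dot (x - q) (x - q)).
Proof.
apply: measurable_sum => i; apply: measurable_funM.
all: under eq_fun do rewrite mxE; apply: measurable_funD; first exact: measurable_rV_coord.
all: exact: measurable_cst.
Qed.

Lemma measurable_dot_ball (q : 'rV[R]_n) (c : R) :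
  measurable [set x : 'rV[R]_n | dot (x - q) (x - q) < c].
Proof.
have := measurable_dot_self q => /(_ measurableT [set` `]-oo, c[] (measurable_itv _)).
by rewrite setTI; congr measurable; apply/seteqP; split => x /=; rewrite in_itv.
Qed.

Lemma measurable_eucl_ball (rho : R) : measurable [set x : 'rV[R]_n | eucl x <= rho].
Proof.
have [rho0|rho0] := leP 0 rho; last first.
  rewrite (_ : [set _ | _] = set0); first exact: measurable0.
  apply/seteqP; split => // x /= xr.
  by have := le_lt_trans xr rho0; rewrite ltNge eucl_ge0.
have := measurable_dot_self 0 => /(_ measurableT [set` `]-oo, rho ^+ 2]] (measurable_itv _)).
rewrite setTI; congr measurable; apply/seteqP; split => x /=; rewrite in_itv /= subr0 -sqr_eucl.
  by rewrite ler_pXn2r ?nnegrE// eucl_ge0.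
by rewrite ler_pXn2r ?nnegrE// eucl_ge0.
Qed.

Lemma rat_approx x (e : R) : 0 < e ->
  exists q : 'rV[rat]_n, `|x - map_mx ratr q| <= e.
Proof.
move=> e0; have ex i : exists q : rat, `|x ord0 i - ratr q| <= e.
  have : x ord0 i - e < x ord0 i + e by lra.
  move=> /rat_in_itvoo[q]; rewrite in_itv /= => /andP[q1 q2].
  by exists q; rewrite ler_norml; apply/andP; split; lra.
have [q Hq] := choice ex; exists (\row_i q i); apply: ler_rV_norm; first exact: ltW.
by move=> i; rewrite !mxE.
Qed.

(** The sigma-algebra is generated by coordinates, so an open set is written as a countable union of
    Euclidean balls with rational centres, which are measurable as sublevel sets of polynomials. *)
Lemma open_measurable_rV (U : set 'rV[R]_n) : open U -> measurable U.
Proof.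
move=> oU.
pose B (p : 'rV[rat]_n * nat) : set 'rV[R]_n := 
  [set x | dot (x - map_mx ratr p.1) (x - map_mx ratr p.1) < p.2.+1%:R^-1 ^+ 2].
pose F p := if pselect (B p `<=` U) then B p else set0.
have -> : U = \bigcup_p F p.
  apply/seteqP; split => [x Ux|x [p _]]; last first.
    by rewrite /F; case: pselect => // H /H.
  move: (oU) => /(_ x Ux)/nbhs_ballP[e /= e0 xe].
  have [m me] : exists m, m.+1%:R^-1 < e / 2.
    have e20 : 0 < e / 2 by rewrite divr_gt0.
    by have [m _ /(_ m (leqnn m)) me] := near_infty_natSinv_lt (PosNum e20); exists m.
  have m0 : (0 : R) < m.+1%:R^-1 by rewrite invr_gt0.
  have C0 : (0 : R) < n%:R + 1 by rewrite ltr_wpDl.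
  (* The factor n + 1 pays for passing from the max norm to [eucl]; x then lies strictly inside the
     ball of radius 1 / (m + 1) about q, whose diameter is below e. *)
  have [q Hq] := @rat_approx x (m.+1%:R^-1 / (2 * (n%:R + 1)))
    (divr_gt0 m0 (mulr_gt0 (ltr0Sn R 1) C0)).
  exists (q, m) => //; rewrite /F.
  have xB : B (q, m) x.
    rewrite /B /= -sqr_eucl ltr_pXn2r ?nnegrE ?eucl_ge0 ?(ltW m0)//.
    apply: (le_lt_trans (eucl_le_norm _)).
    rewrite (@le_lt_trans _ _ (m.+1%:R^-1 / 2))//; last by rewrite ltr_pdivrMr// ltr_pMr// ltr1n.
    apply: (le_trans (ler_wpM2l (ltW C0) Hq)).
    rewrite le_eqVlt; apply/orP; left; apply/eqP; field.
    by rewrite (lt0r_neq0 C0) /= addrC natr1 pnatr_eq0.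
  case: pselect => // H; exfalso; apply: H => z.
  rewrite /B /= -sqr_eucl ltr_pXn2r ?nnegrE ?eucl_ge0 ?(ltW m0)// => zq.
  apply: xe; rewrite -ball_normE /=.
  rewrite (_ : x - z = (x - map_mx ratr q) - (z - map_mx ratr q)); last first.
    by rewrite opprB addrA subrK.
  apply: (le_lt_trans (ler_normB _ _)).
  move: xB; rewrite /B /= -sqr_eucl ltr_pXn2r ?nnegrE ?eucl_ge0 ?(ltW m0)// => xq.
  have := norm_le_eucl (x - map_mx ratr q); have := norm_le_eucl (z - map_mx ratr q).
  by move: me xq zq; move: (m.+1%:R^-1 : R) => u; lra.
apply: countable_bigcupT_measurable; first exact: countableP.
move=> p; rewrite /F; case: pselect => ?; last exact: measurable0.
exact: measurable_dot_ball.
Qed.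

Lemma continuous_measurable_rV f : continuous f -> measurable_fun setT f.
Proof.
move=> /continuousP cf; apply: (measurability _ (RGenOpens.measurableE R)).
move=> _ [_ [a [b ->]] <-]; rewrite setTI; apply: open_measurable_rV.
exact/cf/interval_open.
Qed.

End rV_borel.

Definition rV_box (R : realType) (n : nat) (rho : R) : set 'rV[R]_n :=
  [set x | forall i, `|x ord0 i| <= rho].

Lemma measurable_rV_box (R : realType) (n : nat) (rho : R) :
  measurable (@rV_box R n rho).
Proof.
rewrite (_ : @rV_box R n rho = \big[setI/setT]_(i < n)
    ((fun x : 'rV[R]_n => x ord0 i) @^-1` [set` `[- rho, rho]])).
  apply: bigsetI_measurable => i _; rewrite -[X in measurable X]setTI.
  exact: (measurable_rV_coord i measurableT (measurable_itv _)).
rewrite -bigcap_seq; apply/seteqP; split => x /= H i.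
  by move=> _ /=; rewrite in_itv /= -ler_norml.
by have := H i; rewrite /= in_itv /= -ler_norml; apply; rewrite mem_index_enum.
Qed.

(** A box, unlike a ball, is a product along the recursion that defines [lebesgue_rV], so induction
    on n applies. *)
Lemma lebesgue_rV_box_fin (R : realType) (n : nat) (rho : R) :
  (lebesgue_rV R n (@rV_box R n rho) < +oo)%E.
Proof.
elim: n => [|n IH].
  by rewrite /= diracE; case: (_ \in _); rewrite ltry.
rewrite /= /lebesgue_rV_cons /pushforward.
apply: (@le_lt_trans _ _ ((@lebesgue_measure R \x lebesgue_rV R n)%E
    ([set` `[- rho, rho]] `*` @rV_box R n rho))).
  apply: le_measure; rewrite ?inE.
  - have := @measurable_rV_cons R n measurableT _ (@measurable_rV_box R n.+1 rho).
    by rewrite setTI.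
  - by apply: measurableX => //; exact: measurable_rV_box.
  - move=> p /= H; split => [|i] /=.
      by have := H ord0; rewrite rV_consE0 in_itv /= -ler_norml.
    by have := H (lift ord0 i); rewrite rV_consES.
rewrite product_measure1E//; last exact: measurable_rV_box.
rewrite lte_mul_pinfty ?measure_ge0//.
rewrite ge0_fin_numE ?measure_ge0//.
apply: (@le_lt_trans _ _ (@lebesgue_measure R `[- rho, rho]%classic)) => //.
by rewrite lebesgue_measure_itv/=; case: ifP; rewrite ltry.
Qed.

(** * Dominated convergence for integrands supported in a ball *)

Section compact_integrals.
Variables (R : realType) (n : nat).
Implicit Types (x y : 'rV[R]_n) (f g : 'rV[R]_n -> R).
Local Notation mu := (lebesgue_rV R n).
Local Notation EB rho := ([set x : 'rV[R]_n | eucl x <= rho]).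

Lemma lebesgue_rV_eucl_ball_fin rho : (mu (EB rho) < +oo)%E.
Proof.
have mbox := @measurable_rV_box R n rho.
apply: le_lt_trans (@lebesgue_rV_box_fin R n rho); apply: le_measure; rewrite ?inE//.
  exact: measurable_eucl_ball.
by move=> x /= xr i; rewrite (le_trans (coord_le_eucl x i)).
Qed.

Definition ball_dominated (rho M : R) g : Prop :=
  forall y, `|g y| <= M * \1_(EB rho) y.

Lemma integrable_dominator rho M :
  mu.-integrable setT (fun y => (M * \1_(EB rho) y)%:E).
Proof.
rewrite (_ : (fun _ => _) = (fun y => (M%:E * (\1_(EB rho) y)%:E)%E))//.
apply: integrableZl => //; apply/integrableP; split.
  by apply/measurable_EFinP; apply: measurable_indic; exact: measurable_eucl_ball.
rewrite (eq_integral (fun y => (\1_(EB rho) y)%:E)).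
  by rewrite integral_indic// ?setIT ?lebesgue_rV_eucl_ball_fin//; exact: measurable_eucl_ball.
by move=> y _; rewrite gee0_abs// lee_fin.
Qed.

Lemma ball_dominated_integrable rho M g : measurable_fun setT g ->
  ball_dominated rho M g -> mu.-integrable setT (EFin \o g).
Proof.
move=> mg bg; apply: le_integrable (integrable_dominator rho M) => //.
  exact/measurable_EFinP.
by move=> y _ /=; rewrite lee_fin (le_trans (bg y))// ler_norm.
Qed.

Lemma compact_dominated_cvg rho M (g_ : nat -> 'rV[R]_n -> R) g :
  (forall m, measurable_fun setT (g_ m)) ->
  (forall m, ball_dominated rho M (g_ m)) ->
  (forall y, g_ m y @[m --> \oo] --> g y) ->
  \int[mu]_y g_ m y @[m --> \oo] --> \int[mu]_y g y.
Proof.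
move=> mg bg cg.
have := @dominated_cvg _ _ _ mu setT measurableT (fun m => EFin \o g_ m) (EFin \o g)
  (fun y => (M * \1_(EB rho) y)%:E).
move=> /(_ _ _ _ (integrable_dominator rho M))H.
have bgl : ball_dominated rho M g.
  move=> y; have cgn : `|g_ m y| @[m --> \oo] --> `|g y| by apply: cvg_norm; exact: cg.
  rewrite -(cvg_lim (@Rhausdorff R) cgn); apply: limr_le; first by apply/cvg_ex; exists `|g y|.
  by apply: nearW => m; exact: bg.
have mgl : measurable_fun setT g.
  by apply: (measurable_fun_cvg (h := fun m => g_ m)) => // y _; exact: cg.
apply: fine_cvg; rewrite fineK; last first.
  by apply: integrable_fin_num => //; exact: ball_dominated_integrable mgl bgl.
apply: H => //.
- by move=> m; apply/measurable_EFinP.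
- by move=> y _; apply: cvg_EFin; [exact: nearW|exact: cg].
- by move=> m y _ /=; rewrite lee_fin; exact: bg.
Qed.

End compact_integrals.

(** * The barrier function *)

Section barrier.
Variables (R : realType) (n : nat) (Phi Rp : {fset 'rV[R]_n}) (k : 'rV[R]_n -> R).
Hypotheses (rs : root_system Phi) (ps : positive_subsystem Phi Rp)
  (mk : multiplicity_function Phi k).
Implicit Types (a x y e : 'rV[R]_n) (t s : R).

Local Notation m1 := (#|`Phi|%:R + 1).

Definition barrier x : R := expR (- (m1 * dot x x)) * \prod_(a <- Phi) `|dot a x|.

(** This is -ln of [barrier] at regular points. Taking the logarithm of (a.x)^2 avoids
    differentiating an absolute value. *)
Definition log_barrier x : R :=
  m1 * dot x x - 2^-1 * \sum_(a <- Phi) ln (dot a x ^+ 2).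

Lemma barrier_ge0 x : 0 <= barrier x.
Proof. by rewrite mulr_ge0 ?expR_ge0// prodr_ge0. Qed.

Lemma barrier_gt0 x : regular Phi x -> 0 < barrier x.
Proof.
move=> rx; rewrite mulr_gt0 ?expR_gt0// big_seq prodr_gt0// => a aP.
by rewrite normr_gt0 rx.
Qed.

Lemma barrier_gt0_regular x : 0 < barrier x -> regular Phi x.
Proof.
move=> bx a aP; apply: contraTneq bx => ax.
by rewrite /barrier (big_fsetD1 a)//= ax normr0 mul0r mulr0 ltxx.
Qed.

Lemma barrier_continuous : continuous barrier.
Proof.
apply: continuousM_fun.
  apply: (continuous_compose (g := expR)); last exact: continuous_expR.
  exact/continuousN_fun/continuous_mulc/continuous_dot_self.
apply: continuous_prod => a.
apply: (continuous_compose (g := fun z : R => `|z|)); first exact: continuous_dotl.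
exact: norm_continuous.
Qed.

Lemma barrier_reflection a x : a \in Phi -> barrier (reflection a x) = barrier x.
Proof.
move=> aP; rewrite /barrier (dot_reflection _ _ (root_norm rs aP)); congr (_ * _).
rewrite -[RHS](reindex_reflection rs _ _ aP)/=.
by apply: eq_bigr => b _; rewrite dot_reflectionl.
Qed.

Lemma barrier_weyl w x : weyl_group Phi w -> barrier (w x) = barrier x.
Proof. by elim=> // a v aP _ IH; rewrite /= barrier_reflection. Qed.

Lemma norm_dot_root_le a x : a \in Phi -> `|dot a x| <= expR (dot x x).
Proof.
move=> aP; have a2 := root_norm rs aP.
apply: (@le_trans _ _ (1 + dot x x)); last exact: expR_ge1Dx.
have h1 := dot_ge0 (a - x); have h2 := dot_ge0 (a + x); have h3 := dot_ge0 x.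
rewrite !dotE a2 (dotC x a) in h1 h2.
by rewrite ler_norml; apply/andP; split; lra.
Qed.

Lemma prod_le_exp (I : eqType) (r : seq I) (F : I -> R) (E : R) :
  (forall i, i \in r -> 0 <= F i <= E) -> \prod_(i <- r) F i <= E ^+ size r.
Proof.
elim: r => [_|i r IH H]; first by rewrite big_nil expr0.
have Hr j : j \in r -> 0 <= F j <= E by move=> jr; apply: H; rewrite inE jr orbT.
have /andP[F0 FE] := H i (mem_head _ _).
rewrite big_cons exprS ler_pM ?IH// big_seq prodr_ge0// => j /Hr.
by case/andP.
Qed.

(** Each root costs at most one factor exp |x|^2, and the exponent |Phi| + 1 leaves one Gaussian
    over. Hence [barrier] is at most 1 and decays at infinity, which confines the maximum principle
    to a ball. *)
Lemma barrier_le x : barrier x <= expR (- dot x x).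
Proof.
have H : \prod_(a <- Phi) `|dot a x| <= expR (#|`Phi|%:R * dot x x).
  rewrite expRM_natl; apply: prod_le_exp => a aP.
  by rewrite normr_ge0 norm_dot_root_le.
apply: (le_trans (ler_wpM2l (expR_ge0 _) H)); rewrite -expRD ler_expR.
by rewrite le_eqVlt; apply/orP; left; apply/eqP; ring.
Qed.

Lemma ln_prod_seq (I : eqType) (r : seq I) (F : I -> R) :
  (forall i, i \in r -> 0 < F i) -> ln (\prod_(i <- r) F i) = \sum_(i <- r) ln (F i).
Proof.
elim: r => [_|i r IH H]; first by rewrite !big_nil ln1.
have Hr j : j \in r -> 0 < F j by move=> jr; apply: H; rewrite inE jr orbT.
rewrite !big_cons lnM ?IH// ?posrE ?H ?mem_head//.
by rewrite big_seq prodr_gt0.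
Qed.

Lemma ln_barrier x : regular Phi x -> ln (barrier x) = - log_barrier x.
Proof.
move=> rx; have pos a : a \in Phi -> 0 < `|dot a x| by move=> aP; rewrite normr_gt0 rx.
rewrite /barrier lnM ?posrE ?expR_gt0//; last by rewrite big_seq prodr_gt0.
rewrite expRK ln_prod_seq// /log_barrier opprB addrC; congr (_ - _).
rewrite mulr_sumr; apply: eq_big_seq => a aP.
by rewrite -real_normK ?num_real// lnXn ?pos// -[ln _ *+ 2]mulr_natl mulKf// pnatr_eq0.
Qed.

Definition log_barrier_dx e x : R :=
  2 * m1 * dot x e - \sum_(a <- Phi) dot a e / dot a x.

Definition log_barrier_dxx e x : R :=
  2 * m1 * dot e e + \sum_(a <- Phi) (dot a e / dot a x) ^+ 2.

Let is_derive_dot_line a x e s :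
  is_derive s 1 (fun u : R => dot a (x + u *: e)) (dot a e).
Proof.
rewrite (_ : (fun _ => _) = (fun t => dot a x + t * dot a e)).
  exact: is_derive_affine.
by apply/funext => t; rewrite dotDr dotZr.
Qed.

Lemma is_derive_log_barrier x e s : regular Phi (x + s *: e) ->
  is_derive s 1 (fun u : R => log_barrier (x + u *: e)) (log_barrier_dx e (x + s *: e)).
Proof.
move=> rx; rewrite /log_barrier.
have h1 : is_derive s 1 (fun u : R => dot (x + u *: e) (x + u *: e))
    (2 * dot (x + s *: e) e).
  rewrite (_ : (fun _ => _) = (fun u => dot x x + u * (2 * dot x e + u * dot e e))).
    have h := is_deriveM_fun (is_derive_idR s) (is_derive_affine s (2 * dot x e) (dot e e)).
    apply: (is_derive_eq (is_deriveD_fun (is_derive_cst (dot x x) s 1) h)).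
    by rewrite !dotE; ring.
  by apply/funext => u; rewrite !dotE (dotC e x); ring.
have h2 : is_derive s 1 (fun u : R => \sum_(a <- Phi) ln (dot a (x + u *: e) ^+ 2))
    (\sum_(a <- Phi) 2 * (dot a e / dot a (x + s *: e))).
  apply: is_derive_sum_fun => a aP; have ax := rx a aP.
  have d1 := is_derive_dot_line a x e s.
  have pos : 0 < dot a (x + s *: e) * dot a (x + s *: e).
    by rewrite -expr2 exprn_even_gt0.
  have d2 := is_derive_comp_fun (s := s)
    (g := fun u => dot a (x + u *: e) * dot a (x + u *: e))
    (is_derive1_ln pos) (is_deriveM_fun d1 d1).
  rewrite (_ : (fun _ => _) = (fun u => ln (dot a (x + u *: e) * dot a (x + u *: e)))).
    by apply: (is_derive_eq d2); move: ax; move: (dot a (x + _)) => v v0; field.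
  by apply/funext => u; rewrite expr2.
apply: (is_derive_eq (is_deriveB_fun (is_derive_mulc m1 h1) (is_derive_mulc 2^-1 h2))).
by rewrite /log_barrier_dx -mulr_sumr; field.
Qed.

Lemma is_derive_log_barrier_dx x e s : regular Phi (x + s *: e) ->
  is_derive s 1 (fun u : R => log_barrier_dx e (x + u *: e)) (log_barrier_dxx e (x + s *: e)).
Proof.
move=> rx; rewrite /log_barrier_dx.
have h1 : is_derive s 1 (fun u : R => dot (x + u *: e) e) (dot e e).
  rewrite (_ : (fun _ => _) = (fun u : R => dot e (x + u *: e))).
    exact: is_derive_dot_line.
  by apply/funext => u; rewrite dotC.
have h2 : is_derive s 1 (fun u : R => \sum_(a <- Phi) dot a e / dot a (x + u *: e))
    (\sum_(a <- Phi) - (dot a e / dot a (x + s *: e)) ^+ 2).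
  apply: is_derive_sum_fun => a aP; have ax := rx a aP.
  have d1 := is_derive_mulc (dot a e) (is_derive_inv_fun ax (is_derive_dot_line a x e s)).
  by apply: (is_derive_eq d1); move: ax; move: (dot a (x + _)) => v v0; field.
apply: (is_derive_eq (is_deriveB_fun (is_derive_mulc (2 * m1) h1) h2)).
by rewrite /log_barrier_dxx sumrN opprK.
Qed.

(** Half the Laplacian gives |a|^2 / 2 = 1 for each (a.x)^-2. In the drift only the pairs b = a and
    b = - a survive, giving -2 k a. The quadratic part gives the constant. *)
Lemma log_barrier_generator x : regular Phi x ->
  2^-1 * \sum_(i < n) log_barrier_dxx (delta_mx ord0 i) x +
    log_barrier_dx (drift Phi k x) x =
  m1 * (n%:R + 2 * dunkl_gamma Rp k) + \sum_(a <- Phi) (1 - 2 * k a) / dot a x ^+ 2.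
Proof.
move=> rx.
have -> : \sum_(i < n) log_barrier_dxx (delta_mx ord0 i) x =
    2 * m1 * n%:R + \sum_(a <- Phi) 2 / dot a x ^+ 2.
  rewrite big_split/=; congr (_ + _).
    under eq_bigr do rewrite dot_delta mxE !eqxx /= mulr1.
    by rewrite sumr_const card_ord mulr_natr.
  rewrite exchange_big/=; apply: eq_big_seq => a aP.
  rewrite -(root_norm rs aP) -[in dot a a](dot_sum_delta a a) mulr_suml.
  by apply: eq_bigr => i _; rewrite expr_div_n expr2.
have -> : log_barrier_dx (drift Phi k x) x =
    2 * m1 * dunkl_gamma Rp k - \sum_(a <- Phi) 2 * k a / dot a x ^+ 2.
  rewrite /log_barrier_dx dot_drift -(sum_mult rs ps mk); congr (_ * _ - _).
    by apply: eq_big_seq => a aP; rewrite divfK// rx.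
  transitivity (2^-1 * \sum_(a <- Phi) 4 * k a / dot a x ^+ 2); last first.
    rewrite mulr_sumr; apply: eq_big_seq => a aP; have ax := rx a aP.
    by field.
  rewrite -(sum_root_mult_pairs rs mk rx) mulr_sumr; apply: eq_big_seq => a aP.
  rewrite dot_drift mulr_suml mulr_sumr; apply: eq_big_seq => b bP.
  have ax := rx a aP; have bx := rx b bP; rewrite (dotC b a).
  by field; rewrite ax bx.
have -> : \sum_(a <- Phi) (1 - 2 * k a) / dot a x ^+ 2 =
   2^-1 * (\sum_(a <- Phi) 2 / dot a x ^+ 2) - \sum_(a <- Phi) 2 * k a / dot a x ^+ 2.
  rewrite mulr_sumr -sumrB; apply: eq_big_seq => a aP; have ax := rx a aP.
  by field.
by field.
Qed.

Lemma log_barrier_generator_le x : regular Phi x ->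
  (forall a, a \in Phi -> 1 / 2 <= k a) ->
  2^-1 * \sum_(i < n) log_barrier_dxx (delta_mx ord0 i) x +
    log_barrier_dx (drift Phi k x) x <= m1 * (n%:R + 2 * dunkl_gamma Rp k).
Proof.
move=> rx k12; rewrite log_barrier_generator// gerDl big_seq sumr_le0// => a aP.
rewrite mulr_le0_ge0 ?invr_ge0 ?sqr_ge0//.
by have := k12 a aP; lra.
Qed.

End barrier.

(** * The maximum principle for the semigroup *)

(** Dominated convergence speaks of sequences; they may be confined to a ball because the dominating
    bounds are local in (t, x). *)
Lemma sequential_continuity (R : realType) (T : pseudoMetricType R) (f : T -> R) (x : T) (r : R) :
  0 < r ->
  (forall z_ : nat -> T, (forall m, ball x r (z_ m)) -> z_ @ \oo --> x ->
    f (z_ m) @[m --> \oo] --> f x) ->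
  f z @[z --> x] --> f x.
Proof.
move=> r0 H; apply/cvgrPdist_lt => e e0; apply: contrapT => Hn.
have ex m : exists z, ball x (Num.min r m.+1%:R^-1) z /\ e <= `|f x - f z|.
  apply: contrapT => /forallNP Hz; apply: Hn; apply/nbhs_ballP.
  exists (Num.min r m.+1%:R^-1) => /=; first by rewrite lt_min r0 invr_gt0 ltr0Sn.
  by move=> z xz /=; rewrite ltNge; apply/negP => ez; exact: (Hz z).
have [z_ Hz] := choice ex.
have zx : z_ @ \oo --> x.
  apply/cvg_ballP => d d0; have [m _ Hm] := near_infty_natSinv_lt (PosNum d0).
  exists m => // i /= mi; have [+ _] := Hz i; apply: le_ball.
  by rewrite ge_min (ltW (Hm i mi)) orbT.
have /H/(_ zx)/cvgrPdist_lt/(_ e e0)[m _ /(_ m (leqnn m))/=] : forall m, ball x r (z_ m).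
  by move=> m; have [+ _] := Hz m; apply: le_ball; rewrite ge_min lexx.
by have [_] := Hz m; rewrite leNgt => /negP.
Qed.

Lemma eucl_add_le (R : realType) (n : nat) (u v : 'rV[R]_n) :
  eucl (u + v) <= eucl u + (n%:R + 1) * `|v|.
Proof.
have := eucl_le_norm v; set c := _ * `|v| => vc.
have c0 : 0 <= c by rewrite mulr_ge0// addr_ge0.
rewrite -(ler_pXn2r (ltn0Sn 1)) ?nnegrE ?addr_ge0 ?eucl_ge0//.
rewrite sqrrD !sqr_eucl !dotE (dotC v u).
have h1 : dot v v <= c ^+ 2 by rewrite -sqr_eucl lerXn2r ?nnegrE ?eucl_ge0.
have h2 : dot u v <= eucl u * c.
  apply: le_trans (ler_norm _) _; apply: le_trans (norm_dot_le _ _) _.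
  rewrite ler_wpM2l ?eucl_ge0// (le_trans (l1norm_le_norm _))//.
  by rewrite ler_wpM2r// lerDl.
by rewrite mulr2n; lra.
Qed.

(** * Integrals against the heat kernel and the discrete backward operator *)

Section heat_integral.
Variables (R : realType) (n : nat) (Phi Rp : {fset 'rV[R]_n}) (k : 'rV[R]_n -> R).
Hypotheses (rs : root_system Phi) (ps : positive_subsystem Phi Rp)
  (mk : multiplicity_function Phi k).
Variable D : 'rV[R]_n -> 'rV[R]_n -> R.
Hypothesis hD : is_dunkl_kernel Rp k D.
Implicit Types (a x y e : 'rV[R]_n) (t s : R).

Local Notation mu := (lebesgue_rV R n).
Local Notation heat := (heat Rp k D).

Variables (rho MF : R) (F : 'rV[R]_n -> R).
Hypotheses (rho0 : 0 <= rho) (mF : measurable_fun setT F) (bF : ball_dominated rho MF F).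

Let F0 y : rho < eucl y -> F y = 0.
Proof.
move=> yr; have := bF y; rewrite indicE memNset ?mulr0 ?normr_le0 /= => [/eqP//|].
by move=> /=; apply/negP; rewrite -ltNge.
Qed.

Let absF y : `|F y| <= `|MF|.
Proof.
apply: (le_trans (bF y)); apply: (le_trans (ler_norm _)); rewrite normrM ler_piMr//.
by rewrite indicE; case: (_ \in _); rewrite ?normr1 ?normr0.
Qed.

Definition admissible (phi : 'rV[R]_n -> R) : Prop :=
  measurable_fun setT phi /\ exists M, forall y, eucl y <= rho -> `|phi y| <= M.

Let ball_dominated_mul (phi : 'rV[R]_n -> R) M :
  (forall y, eucl y <= rho -> `|phi y| <= M) ->
  ball_dominated rho (M * `|MF|) (fun y => phi y * F y).
Proof.
move=> HM y; have [yr|yr] := leP (eucl y) rho.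
  by rewrite indicE mem_set//= mulr1 normrM ler_pM// HM.
by rewrite F0// mulr0 normr0 indicE memNset ?mulr0//= => /(lt_le_trans yr); rewrite ltxx.
Qed.

Lemma admissible_integrable phi : admissible phi ->
  mu.-integrable setT (EFin \o (fun y => phi y * F y)).
Proof.
move=> [mphi [M HM]]; apply: (@ball_dominated_integrable _ _ rho (M * `|MF|)).
  exact: measurable_funM.
exact: ball_dominated_mul.
Qed.

Definition weighted_integral (phi : 'rV[R]_n -> R) : R := \int[mu]_y (phi y * F y).
Local Notation I := weighted_integral.

Lemma admissibleD phi psi : admissible phi -> admissible psi ->
  admissible (fun y => phi y + psi y).
Proof.
move=> [m1 [M1 H1]] [m2 [M2 H2]]; split; first exact: measurable_funD.
by exists (M1 + M2) => y yr; rewrite (le_trans (ler_normD _ _))// lerD ?H1 ?H2.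
Qed.

Lemma admissibleZ c phi : admissible phi -> admissible (fun y => c * phi y).
Proof.
move=> [m1 [M1 H1]]; split; first by apply: measurable_funM => //; exact: measurable_cst.
by exists (`|c| * M1) => y yr; rewrite normrM ler_wpM2l// H1.
Qed.

Lemma weighted_integralD phi psi : admissible phi -> admissible psi ->
  I (fun y => phi y + psi y) = I phi + I psi.
Proof.
move=> ap aq; rewrite /weighted_integral -RintegralD//; try exact: admissible_integrable.
by apply: eq_Rintegral => y _; rewrite mulrDl.
Qed.

Lemma weighted_integralZ c phi : admissible phi -> I (fun y => c * phi y) = c * I phi.
Proof.
move=> ap; rewrite /weighted_integral -RintegralZl//; last exact: admissible_integrable.
by apply: eq_Rintegral => y _; rewrite mulrA.
Qed.

Lemma admissible_cst0 : admissible (fun=> 0).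
Proof. by split; [exact: measurable_cst|exists 0 => y _; rewrite normr0]. Qed.

Lemma weighted_integral0 : I (fun=> 0) = 0.
Proof.
rewrite /weighted_integral; under eq_Rintegral do rewrite mul0r.
by rewrite Rintegral_cst// mul0r.
Qed.

Lemma admissibleB phi psi : admissible phi -> admissible psi ->
  admissible (fun y => phi y - psi y).
Proof.
move=> ap /(admissibleZ (-1)) aq.
rewrite (_ : (fun _ => _) = (fun y => phi y + -1 * psi y)); first exact: admissibleD.
by apply/funext => y; rewrite mulN1r.
Qed.

Lemma weighted_integralB phi psi : admissible phi -> admissible psi ->
  I (fun y => phi y - psi y) = I phi - I psi.
Proof.
move=> ap aq; have aq' := admissibleZ (-1) aq.
rewrite -mulN1r -weighted_integralZ// -weighted_integralD//; congr I.
by apply/funext => y; rewrite mulN1r.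
Qed.

Lemma weighted_integral_sum (J : Type) (r : seq J) (phi : J -> 'rV[R]_n -> R) :
  (forall j, admissible (phi j)) ->
  admissible (fun y => \sum_(j <- r) phi j y) /\
  I (fun y => \sum_(j <- r) phi j y) = \sum_(j <- r) I (phi j).
Proof.
move=> aphi; elim: r => [|j r [IH1 IH2]].
  rewrite big_nil (_ : (fun _ => _) = fun=> 0).
    by split; [exact: admissible_cst0|exact: weighted_integral0].
  by apply/funext => y; rewrite big_nil.
rewrite big_cons (_ : (fun _ => _) = (fun y => phi j y + \sum_(i <- r) phi i y)).
  by split; [exact: admissibleD|rewrite weighted_integralD// IH2].
by apply/funext => y; rewrite big_cons.
Qed.

Lemma weighted_integral_cvg (phi_ : nat -> 'rV[R]_n -> R) phi M :
  (forall m, measurable_fun setT (phi_ m)) ->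
  (forall m y, eucl y <= rho -> `|phi_ m y| <= M) ->
  (forall y, eucl y <= rho -> phi_ m y @[m --> \oo] --> phi y) ->
  I (phi_ m) @[m --> \oo] --> I phi.
Proof.
move=> mphi HM cphi; apply: (@compact_dominated_cvg _ _ rho (M * `|MF|)).
- by move=> m; exact: measurable_funM.
- by move=> m; apply: ball_dominated_mul => y; exact: HM.
move=> y; have [yr|yr] := leP (eucl y) rho.
  by apply: cvgM; [exact: cphi|exact: cvg_cst].
by rewrite F0// mulr0; under eq_fun do rewrite mulr0; exact: cvg_cst.
Qed.

Lemma measurable_heat t x : measurable_fun setT (heat t x).
Proof. by apply: continuous_measurable_rV; exact: (heat_continuous_right rs ps mk hD). Qed.

Lemma heat_bound_local t1 t2 B : 0 < t1 -> exists M, forall t x y,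
  t1 <= t <= t2 -> eucl x <= B -> eucl y <= rho -> `|heat t x y| <= M.
Proof.
move=> t10; have [M HM] := @bnd_heat _ _ _ _ _ rs ps mk _ hD t1 t2 B rho 0 t10 rho0.
by exists M => t x y tt xB yr; apply: HM.
Qed.

Lemma admissible_heat t x : 0 < t -> admissible (heat t x).
Proof.
move=> t0; split; first exact: measurable_heat.
have [M HM] := @heat_bound_local t t (eucl x) t0.
by exists M => y yr; apply: HM => //; rewrite lexx.
Qed.

Definition heat_integral t x : R := I (heat t x).

Lemma heat_integral_continuous t x : 0 < t ->
  (fun z : R * 'rV[R]_n => heat_integral z.1 z.2) z @[z --> (t, x)] --> heat_integral t x.
Proof.
move=> t0; pose r := Num.min (t / 2) 1.
have r0 : 0 < r by rewrite lt_min ltr01 divr_gt0.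
apply: (@sequential_continuity _ _ (fun z : R * 'rV[R]_n => heat_integral z.1 z.2) (t, x) r r0).
move=> z_ zb zc.
have t20 : 0 < t / 2 by rewrite divr_gt0.
have [M HM] := @heat_bound_local (t / 2) (t + t / 2) (eucl x + (n%:R + 1)) t20.
have zt m : t / 2 <= (z_ m).1 <= t + t / 2.
  have [/= + _] := zb m; rewrite -ball_normE /= lt_min => /andP[+ _].
  by rewrite ltr_norml => /andP[? ?]; apply/andP; split; lra.
apply: (@weighted_integral_cvg (fun m => heat (z_ m).1 (z_ m).2) _ M).
- by move=> m; exact: measurable_heat.
- move=> m y yr; apply: HM => //.
  have [_ /=] := zb m; rewrite -ball_normE /= lt_min distrC => /andP[_ z1].
  rewrite -[(z_ m).2](subrK x) addrC.
  apply: (le_trans (eucl_add_le _ _)); rewrite lerD2l ler_piMr ?addr_ge0//.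
  exact: ltW.
move=> y yr; apply: (cvg_heat hD) => //.
- exact: (cvg_comp z_ fst zc cvg_fst).
- exact: (cvg_comp z_ snd zc cvg_snd).
Qed.

(* The discrete analogue at (t, x), at time scale e ^ 2, of the backward operator
   1/2 Laplacian + drift - time derivative + reflection part. Applying it to an
   integral of heat kernels spares differentiating under the integral sign: its
   limit only takes dominated convergence. *)
Definition backward_difference (e t : R) (x : 'rV[R]_n) (g : R -> 'rV[R]_n -> R) : R :=
  2^-1 * \sum_(i <- enum 'I_n) ((g t (x + e *: delta_mx ord0 i) +
      g t (x + (- e) *: delta_mx ord0 i) - 2 * g t x) / e ^+ 2)
  + (g t (x + e ^+ 2 *: drift Phi k x) - g t x) / e ^+ 2
  + (g (t - e ^+ 2) x - g t x) / e ^+ 2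
  + \sum_(a <- Phi) k a / 2 / dot a x ^+ 2 * (g t (reflection a x) - g t x).

Lemma backward_difference_integral (e t : R) (x : 'rV[R]_n) : 0 < t -> e ^+ 2 < t ->
  admissible (fun y => backward_difference e t x (fun t x => heat t x y)) /\
  I (fun y => backward_difference e t x (fun t x => heat t x y)) =
  backward_difference e t x heat_integral.
Proof.
move=> t0 et; have ah x' := admissible_heat x' t0.
have ah' : admissible (heat (t - e ^+ 2) x) by apply: admissible_heat; rewrite subr_gt0.
rewrite /backward_difference.
have divE c z : z / c = c^-1 * z :> R by rewrite mulrC.
pose phi i y := (e ^+ 2)^-1 * (heat t (x + e *: delta_mx ord0 i) y +
      heat t (x + (- e) *: delta_mx ord0 i) y - 2 * heat t x y).
pose psi a y := k a / 2 / dot a x ^+ 2 * (heat t (reflection a x) y - heat t x y).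
pose p1 y := (e ^+ 2)^-1 * (heat t (x + e ^+ 2 *: drift Phi k x) y - heat t x y).
pose p2 y := (e ^+ 2)^-1 * (heat (t - e ^+ 2) x y - heat t x y).
have aphi i : admissible (phi i).
  by apply/admissibleZ/admissibleB; [exact: admissibleD|exact: admissibleZ].
have apsi a : admissible (psi a) by exact/admissibleZ/admissibleB.
have ap1 : admissible p1 by exact/admissibleZ/admissibleB.
have ap2 : admissible p2 by exact/admissibleZ/admissibleB.
have [asphi Isphi] := weighted_integral_sum (enum 'I_n) aphi.
have [aspsi Ispsi] := weighted_integral_sum (enum_fset Phi) apsi.
have aZ := admissibleZ 2^-1 asphi.
rewrite (_ : (fun _ => _) = (fun y => 2^-1 * (\sum_(i <- enum 'I_n) phi i y) + p1 y + p2 y +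
    \sum_(a <- Phi) psi a y)); last first.
  apply/funext => y; rewrite /p1 /p2 -!divE; congr (_ * _ + _ + _ + _).
  by apply: eq_bigr => i _; rewrite divE.
split; first exact: (admissibleD (admissibleD (admissibleD aZ ap1) ap2) aspsi).
rewrite (weighted_integralD (admissibleD (admissibleD aZ ap1) ap2) aspsi).
rewrite (weighted_integralD (admissibleD aZ ap1) ap2).
rewrite (weighted_integralD aZ ap1) (weighted_integralZ _ asphi).
have I1 : I p1 = (e ^+ 2)^-1 * (heat_integral t (x + e ^+ 2 *: drift Phi k x) - heat_integral t x).
  by rewrite weighted_integralZ ?weighted_integralB//; exact: admissibleB.
have I2 : I p2 = (e ^+ 2)^-1 * (heat_integral (t - e ^+ 2) x - heat_integral t x).
  by rewrite weighted_integralZ ?weighted_integralB//; exact: admissibleB.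
rewrite I1 I2 Isphi Ispsi -!divE; congr (_ * _ + _ + _ + _).
  apply: eq_bigr => i _; rewrite /phi weighted_integralZ; last first.
    by apply/admissibleB; [exact: admissibleD|exact: admissibleZ].
  rewrite weighted_integralB ?weighted_integralD ?weighted_integralZ//; last 2 first.
  - exact: admissibleD.
  - exact: admissibleZ.
by apply: eq_bigr => a _; rewrite /psi weighted_integralZ ?weighted_integralB//; exact: admissibleB.
Qed.

End heat_integral.

(** * Limits of the backward differences at a regular point *)

Section backward_limit.
Variables (R : realType) (n : nat) (Phi Rp : {fset 'rV[R]_n}) (k : 'rV[R]_n -> R).
Hypotheses (rs : root_system Phi) (ps : positive_subsystem Phi Rp)
  (mk : multiplicity_function Phi k).
Variable D : 'rV[R]_n -> 'rV[R]_n -> R.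
Hypothesis hD : is_dunkl_kernel Rp k D.
Implicit Types (a x y v : 'rV[R]_n) (t s : R).

Local Notation heat := (heat Rp k D).
Local Notation b x := (drift Phi k x).

Lemma regular_ball x : regular Phi x -> exists r kap : R, [/\ 0 < r, 0 < kap &
  forall v, eucl v <= r -> forall a, a \in Phi -> kap <= `|dot a (x + v)|].
Proof.
move=> rx.
have [kap kap0 Hkap] : exists2 kap : R, 0 < kap &
    forall a, a \in Phi -> 2 * kap <= `|dot a x|.
  have Hs (s : seq 'rV[R]_n) : (forall a, a \in s -> 0 < `|dot a x|) ->
      exists2 kap : R, 0 < kap & forall a, a \in s -> 2 * kap <= `|dot a x|.
    elim: s => [_|a s IH Hs]; first by exists 1 => // a; rewrite in_nil.
    have [d ds|c c0 Hc] := IH; first by apply: Hs; rewrite inE ds orbT.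
    have a0 := Hs a (mem_head _ _).
    exists (Num.min c (`|dot a x| / 2)); first by rewrite lt_min c0 divr_gt0.
    move=> d; rewrite inE => /predU1P[->|ds].
      by rewrite mulrC -ler_pdivlMr// ge_min lexx orbT.
    by rewrite (le_trans _ (Hc d ds))// ler_pM2l// ge_min lexx.
  by apply: (Hs (enum_fset Phi)) => a aP; rewrite normr_gt0 rx.
pose A := \sum_(a <- Phi) l1norm a.
have A0 : 0 <= A by apply: sumr_ge0 => a _; exact: l1norm_ge0.
exists (kap / (A + 1)), kap; split => //; first by rewrite divr_gt0// ltr_wpDl.
move=> v vr a aP; rewrite dotDr.
have aA : l1norm a <= A.
  by rewrite /A (big_fsetD1 a)//= lerDl; apply: sumr_ge0 => d _; exact: l1norm_ge0.
have : `|dot a v| <= kap.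
  rewrite dotC (le_trans (norm_dot_le _ _))//.
  apply: (@le_trans _ _ (kap / (A + 1) * (A + 1))); last by rewrite divfK// lt0r_neq0// ltr_wpDl.
  by rewrite ler_pM ?eucl_ge0 ?l1norm_ge0// (le_trans aA)// lerDl.
have := Hkap a aP; have := lerB_normD (dot a x) (dot a v); lra.
Qed.

Lemma eucl_delta (i : 'I_n) : eucl (delta_mx ord0 i : 'rV[R]_n) = 1.
Proof. by rewrite /eucl dot_delta mxE !eqxx sqrtr1. Qed.

Variables (t0 : R) (x0 : 'rV[R]_n).
Hypotheses (t00 : 0 < t0) (rx0 : regular Phi x0).

(* [r] is a radius within which all the points entering the backward differences
   at (t0, x0) stay in a region where the derivatives are controlled. *)
Definition good_radius (r : R) : Prop :=
  exists kap : R, exists2 B : R, 0 < kap &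
  [/\ 0 < r, r <= 1, r <= t0 / 2 &
   forall s, `|s| <= r -> forall e, (e = b x0 \/ exists i, e = delta_mx ord0 i) ->
   (forall a, a \in Phi -> kap <= `|dot a (x0 + s *: e)|) /\ eucl (x0 + s *: e) <= B].

Lemma good_radius_exists : exists r, good_radius r.
Proof.
have [r1 [kap [r10 kap0 H]]] := regular_ball rx0.
pose Eb := eucl (b x0) + 1.
have Eb0 : 0 < Eb by rewrite ltr_wpDl// eucl_ge0.
(* [r1 / Eb] keeps displacements along the drift and along unit vectors within r1, t0 / 2 keeps the
   earlier times away from 0, and r <= 1 makes the squared step at most the step. *)
exists (Num.min (Num.min 1 (t0 / 2)) (r1 / Eb)).
exists kap, (eucl x0 + (n%:R + 1) * r1) => //; split.
- by rewrite !lt_min ltr01 !divr_gt0.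
- by rewrite !ge_min lexx.
- by rewrite !ge_min lexx orbT.
move=> s; rewrite !le_min => /andP[_ sr] e He.
have se : eucl (s *: e) <= r1.
  rewrite euclZ (@le_trans _ _ (r1 / Eb * Eb))//; last by rewrite divfK ?lt0r_neq0.
  rewrite ler_pM ?eucl_ge0// /Eb; case: He => [->|[i ->]]; first by rewrite lerDl.
  by rewrite eucl_delta lerDr eucl_ge0.
split; first exact: H.
apply: (le_trans (eucl_add_le _ _)); rewrite lerD2l ler_wpM2l ?addr_ge0//.
exact: (le_trans (norm_le_eucl _)).
Qed.

Variable r : R.
Hypothesis gr : good_radius r.

Definition step_size (m : nat) : R := r / m.+1%:R.
Local Notation eps := step_size.

Lemma good_regular s e : `|s| <= r -> (e = b x0 \/ exists i, e = delta_mx ord0 i) ->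
  regular Phi (x0 + s *: e).
Proof.
move=> sr He a aP; have [kap [B kap0 [_ _ _ H]]] := gr.
by rewrite -normr_gt0 (lt_le_trans kap0)//; have [+ _] := H s sr e He; apply.
Qed.

Let r0 : 0 < r. Proof. by have [kap [B _ []]] := gr. Qed.

Lemma step_size_bounds m : 0 < eps m <= r.
Proof.
rewrite divr_gt0//= ler_pdivrMr// ler_pMr//.
by rewrite ler1n.
Qed.

Lemma step_size_sqr m : 0 < eps m ^+ 2 <= r.
Proof.
have /andP[e0 er] := step_size_bounds m; rewrite exprn_gt0//=.
have [_ [_ _ [_ r1 _ _]]] := gr.
by rewrite (le_trans _ er)// expr2 ler_piMr ?(ltW e0)// (le_trans er).
Qed.

Lemma step_size_cvg : eps @ \oo --> 0.
Proof.
have : r * harmonic m @[m --> \oo] --> r * 0 by apply: cvg_mulc; exact: cvg_harmonic.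
by rewrite mulr0.
Qed.

Lemma step_size_sqr_cvg : eps m ^+ 2 @[m --> \oo] --> 0.
Proof.
have : eps m * eps m @[m --> \oo] --> (0 : R) * 0 by apply: cvgM; exact: step_size_cvg.
by rewrite mulr0; under eq_cvg do rewrite -expr2.
Qed.

Lemma step_size_sqr_lt m : eps m ^+ 2 <= t0 / 2.
Proof.
have [_ [_ _ [_ _ rt _]]] := gr.
by have /andP[_ /le_trans] := step_size_sqr m; apply.
Qed.

Lemma backward_difference_cvg (g : R -> 'rV[R]_n -> R) (gxx : 'I_n -> R) gb gt :
  (forall i, (g t0 (x0 + eps m *: delta_mx ord0 i) +
     g t0 (x0 + (- eps m) *: delta_mx ord0 i) - 2 * g t0 x0) / eps m ^+ 2
       @[m --> \oo] --> gxx i) ->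
  (g t0 (x0 + eps m ^+ 2 *: b x0) - g t0 x0) / eps m ^+ 2 @[m --> \oo] --> gb ->
  (g (t0 - eps m ^+ 2) x0 - g t0 x0) / eps m ^+ 2 @[m --> \oo] --> gt ->
  backward_difference Phi k (eps m) t0 x0 g @[m --> \oo] -->
   2^-1 * \sum_(i < n) gxx i + gb + gt +
   \sum_(a <- Phi) k a / 2 / dot a x0 ^+ 2 * (g t0 (reflection a x0) - g t0 x0).
Proof.
move=> hxx hb ht; apply: cvgD; last exact: cvg_cst.
apply: cvgD => //; apply: cvgD => //; apply: cvg_mulc.
rewrite -(big_enum _ _ _ (fun i => gxx i))/=.
by apply: cvg_big => [|i _]; [exact: add_continuous|exact: hxx].
Qed.

Lemma step_size_sqr_gt0 m : 0 < eps m ^+ 2.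
Proof. by case/andP: (step_size_sqr m). Qed.

Lemma is_derive_heat_backward (s : R) y : s < t0 ->
  is_derive s 1 (fun u : R => heat (t0 - u) x0 y) (- heat_dt Phi Rp k D (t0 - s) x0 y).
Proof.
move=> st.
have h1 : is_derive s 1 (fun u : R => t0 - u) (-1).
  apply: (is_derive_eq (is_deriveB_fun (is_derive_cst t0 s 1) (is_derive_idR s))).
  by rewrite sub0r.
have h2 : is_derive (t0 - s) 1 (fun u : R => heat u x0 y) (heat_dt Phi Rp k D (t0 - s) x0 y).
  by apply: (is_derive_heat_dt rs ps mk hD) => //; rewrite subr_gt0.
apply: (is_derive_eq (is_derive_comp_fun (s := s) (g := fun u => t0 - u) h2 h1)).
by rewrite mulrN1.
Qed.

Lemma backward_difference_heat y :
  backward_difference Phi k (eps m) t0 x0 (fun t x => heat t x y) @[m --> \oo] --> 0.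
Proof.
have [_ [_ _ [_ _ rt _]]] := gr.
have H := @backward_difference_cvg (fun t x => heat t x y)
  (fun i => heat_dxx Phi Rp k D t0 (delta_mx ord0 i) x0 y)
  (heat_dx Phi Rp k D t0 (b x0) x0 y) (- heat_dt Phi Rp k D t0 x0 y).
rewrite (heat_equation rs ps mk D y t00 rx0) in H; apply: H.
- move=> i; have inI : (delta_mx ord0 i : 'rV[R]_n) = b x0 \/
    exists j, (delta_mx ord0 i : 'rV[R]_n) = delta_mx ord0 j by right; exists i.
  have d1 (s : R) : `|s| <= r -> is_derive s 1 (fun u : R => heat t0 (x0 + u *: delta_mx ord0 i) y)
      (heat_dx Phi Rp k D t0 (delta_mx ord0 i) (x0 + s *: delta_mx ord0 i) y).
    move=> sr; have rx := good_regular sr inI.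
    exact: (@is_derive_heat_dx _ _ _ _ _ rs ps mk _ hD t0 x0 (delta_mx ord0 i) y s t00 rx).
  have d2 (s : R) : `|s| <= r -> is_derive s 1
      (fun u : R => heat_dx Phi Rp k D t0 (delta_mx ord0 i) (x0 + u *: delta_mx ord0 i) y)
      (heat_dxx Phi Rp k D t0 (delta_mx ord0 i) (x0 + s *: delta_mx ord0 i) y).
    move=> sr; have rx := good_regular sr inI.
    exact: (@is_derive_heat_dxx _ _ _ _ _ rs ps mk _ hD t0 x0 (delta_mx ord0 i) y s t00 rx).
  have E0 : x0 + 0 *: delta_mx ord0 i = x0 by rewrite scale0r addr0.
  have := second_difference_cvg d1 d2 r0 step_size_bounds step_size_cvg.
  by rewrite E0.
- have E0 : x0 + 0 *: b x0 = x0 by rewrite scale0r addr0.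
  have d1 : is_derive (0 : R) 1 (fun u : R => heat t0 (x0 + u *: b x0) y)
      (heat_dx Phi Rp k D t0 (b x0) x0 y).
    have := @is_derive_heat_dx _ _ _ _ _ rs ps mk _ hD t0 x0 (b x0) y 0 t00.
    by rewrite E0; apply.
  have := first_difference_cvg d1 step_size_sqr_gt0 step_size_sqr_cvg.
  by rewrite E0.
- have E0 : t0 - 0 = t0 by rewrite subr0.
  have := first_difference_cvg (@is_derive_heat_backward 0 y _) step_size_sqr_gt0 step_size_sqr_cvg.
  by rewrite E0; apply.
Qed.

(** The mean value theorem replaces divided differences by derivatives at intermediate points, which
    a good radius keeps in a region where they are bounded uniformly in y. This is the domination
    needed to pass to the limit under the integral. *)
Lemma backward_difference_heat_bound rho : 0 <= rho -> exists M, forall m y, eucl y <= rho ->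
  `|backward_difference Phi k (eps m) t0 x0 (fun t x => heat t x y)| <= M.
Proof.
move=> rho0; have [kap [B kap0 [_ _ rt Hgood]]] := gr.
have t20 : 0 < t0 / 2 by rewrite divr_gt0.
have t0P : t0 / 2 <= t0 <= t0 by apply/andP; split; lra.
have inreg (s : R) e y : `|s| <= r -> (e = b x0 \/ exists i, e = delta_mx ord0 i) ->
    eucl y <= rho -> heat_region Phi (t0 / 2) t0 B rho kap t0 (x0 + s *: e) y.
  by move=> sr He yr; have [H1 H2] := Hgood s sr e He; split.
have inreg0 y : eucl y <= rho -> heat_region Phi (t0 / 2) t0 B rho kap t0 x0 y.
  move=> yr; have := @inreg 0 (b x0) y; rewrite scale0r addr0; apply => //; last by left.
  by rewrite normr0 ltW.
have inregt (s : R) y : 0 <= s <= r -> eucl y <= rho ->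
    heat_region Phi (t0 / 2) t0 B rho kap (t0 - s) x0 y.
  move=> /andP[s0 sr] yr; have [_ ? ? ?] := inreg0 y yr; split => //.
  by apply/andP; split; lra.
have /choice[Mi HMi] : forall i : 'I_n, exists M, forall t x y,
    heat_region Phi (t0 / 2) t0 B rho kap t x y ->
    `|heat_dxx Phi Rp k D t (delta_mx ord0 i) x y| <= M.
  by move=> i; exact: (bnd_heat_dxx rs ps mk hD).
have [Mb HMb] := @bnd_heat_dx _ _ _ _ _ rs ps mk _ hD (t0 / 2) t0 B rho kap t20 rho0 kap0 (b x0).
have [Mt HMt] := @bnd_heat_dt _ _ _ _ _ rs ps mk _ hD (t0 / 2) t0 B rho kap t20 rho0 kap0.
have [M0 HM0] := @bnd_heat _ _ _ _ _ rs ps mk _ hD (t0 / 2) t0 B rho kap t20 rho0.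
exists (2^-1 * (\sum_(i <- enum 'I_n) 2 * Mi i) + Mb + Mt +
  \sum_(a <- Phi) `|k a / 2 / dot a x0 ^+ 2| * (M0 + M0)) => m y yr.
have /andP[e0 er] := step_size_bounds m.
have /andP[e20 e2r] := step_size_sqr m.
apply: (le_trans (ler_normD _ _)); apply: lerD; last first.
  apply: (le_trans (ler_norm_sum _ _ _)); rewrite big_seq [leRHS]big_seq; apply: ler_sum => a aP.
  rewrite normrM ler_wpM2l// (le_trans (ler_normB _ _))// lerD ?HM0//; last exact: inreg0.
  exact/(heat_region_reflection rs)/inreg0.
apply: (le_trans (ler_normD _ _)); apply: lerD; last first.
  have E0 : t0 - 0 = t0 by rewrite subr0.
  have d1 (s : R) : 0 <= s <= r -> is_derive s 1 (fun u : R => heat (t0 - u) x0 y)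
      (- heat_dt Phi Rp k D (t0 - s) x0 y).
    by move=> /andP[s0 sr]; apply: is_derive_heat_backward; lra.
  have bd (s : R) : 0 <= s <= r -> `|- heat_dt Phi Rp k D (t0 - s) x0 y| <= Mt.
    by move=> sr; rewrite normrN HMt//; exact: inregt.
  by have := first_difference_bound d1 bd (step_size_sqr m); rewrite E0.
apply: (le_trans (ler_normD _ _)); apply: lerD; last first.
  have E0 : x0 + 0 *: b x0 = x0 by rewrite scale0r addr0.
  have d1 (s : R) : 0 <= s <= r -> is_derive s 1 (fun u : R => heat t0 (x0 + u *: b x0) y)
      (heat_dx Phi Rp k D t0 (b x0) (x0 + s *: b x0) y).
    move=> /andP[s0 sr]; have rx : regular Phi (x0 + s *: b x0).
      by apply: good_regular; [rewrite ger0_norm|left].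
    exact: (@is_derive_heat_dx _ _ _ _ _ rs ps mk _ hD t0 x0 (b x0) y s t00 rx).
  have bd (s : R) : 0 <= s <= r -> `|heat_dx Phi Rp k D t0 (b x0) (x0 + s *: b x0) y| <= Mb.
    by move=> /andP[s0 sr]; apply: HMb; apply: inreg => //; [rewrite ger0_norm|left].
  by have := first_difference_bound d1 bd (step_size_sqr m); rewrite E0.
rewrite normrM ger0_norm// ler_wpM2l//.
apply: (le_trans (ler_norm_sum _ _ _)); apply: ler_sum => i _.
have inI : (delta_mx ord0 i : 'rV[R]_n) = b x0 \/
    exists j, (delta_mx ord0 i : 'rV[R]_n) = delta_mx ord0 j by right; exists i.
have d1 (s : R) : `|s| <= r -> is_derive s 1 (fun u : R => heat t0 (x0 + u *: delta_mx ord0 i) y)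
    (heat_dx Phi Rp k D t0 (delta_mx ord0 i) (x0 + s *: delta_mx ord0 i) y).
  move=> sr; have rx := good_regular sr inI.
    exact: (@is_derive_heat_dx _ _ _ _ _ rs ps mk _ hD t0 x0 (delta_mx ord0 i) y s t00 rx).
have d2 (s : R) : `|s| <= r -> is_derive s 1
    (fun u : R => heat_dx Phi Rp k D t0 (delta_mx ord0 i) (x0 + u *: delta_mx ord0 i) y)
    (heat_dxx Phi Rp k D t0 (delta_mx ord0 i) (x0 + s *: delta_mx ord0 i) y).
  move=> sr; have rx := good_regular sr inI.
    exact: (@is_derive_heat_dxx _ _ _ _ _ rs ps mk _ hD t0 x0 (delta_mx ord0 i) y s t00 rx).
have bd (s : R) : `|s| <= r -> `|heat_dxx Phi Rp k D t0 (delta_mx ord0 i)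
    (x0 + s *: delta_mx ord0 i) y| <= Mi i.
  by move=> sr; apply: HMi; exact: inreg.
have E0 : x0 + 0 *: delta_mx ord0 i = x0 by rewrite scale0r addr0.
by have := second_difference_bound d1 d2 bd (step_size_bounds m); rewrite E0.
Qed.

Lemma backward_difference_heat_integral rho MF (F : 'rV[R]_n -> R) : 0 <= rho ->
  measurable_fun setT F -> ball_dominated rho MF F ->
  backward_difference Phi k (eps m) t0 x0 (heat_integral Rp k D F) @[m --> \oo] --> 0.
Proof.
move=> rho0 mF bF.
have lt m : eps m ^+ 2 < t0.
  by rewrite (le_lt_trans (step_size_sqr_lt m))// ltr_pdivrMr// ltr_pMr// ltr1n.
have bdi m := backward_difference_integral rs ps mk hD rho0 mF bF x0 t00 (lt m).
suff : weighted_integral F (fun y => backward_difference Phi k (eps m) t0 x0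
    (fun t x => heat t x y)) @[m --> \oo] --> weighted_integral F (fun=> 0).
  by rewrite weighted_integral0; under eq_cvg do rewrite (proj2 (bdi _)).
have [M HM] := backward_difference_heat_bound rho0.
apply: (weighted_integral_cvg mF bF (M := M)).
- by move=> m; have [[]] := bdi m.
- by move=> m y; exact: HM.
- by move=> y _; exact: backward_difference_heat.
Qed.

(** The reflection part is zero by W-invariance, and c t contributes - c because the time difference
    looks backwards. *)
Lemma backward_difference_log_barrier (c : R) :
  backward_difference Phi k (eps m) t0 x0 (fun t x => log_barrier Phi x + c * t) @[m --> \oo] -->
  2^-1 * \sum_(i < n) log_barrier_dxx Phi (delta_mx ord0 i) x0 +
    log_barrier_dx Phi (b x0) x0 - c.
Proof.
have -> : 2^-1 * \sum_(i < n) log_barrier_dxx Phi (delta_mx ord0 i) x0 +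
    log_barrier_dx Phi (b x0) x0 - c =
    2^-1 * \sum_(i < n) log_barrier_dxx Phi (delta_mx ord0 i) x0 +
    log_barrier_dx Phi (b x0) x0 + (- c) + \sum_(a <- Phi) k a / 2 / dot a x0 ^+ 2 *
      ((log_barrier Phi (reflection a x0) + c * t0) - (log_barrier Phi x0 + c * t0)).
  rewrite [X in _ = _ + X]big1_seq ?addr0// => a /andP[_ aP].
  have rx' := regular_reflection rs aP rx0.
  rewrite -[log_barrier _ _]opprK -ln_barrier// barrier_reflection// ln_barrier// opprK.
  by rewrite subrr mulr0.
apply: (@backward_difference_cvg (fun t x => log_barrier Phi x + c * t)).
- move=> i; have inI : (delta_mx ord0 i : 'rV[R]_n) = b x0 \/
    exists j, (delta_mx ord0 i : 'rV[R]_n) = delta_mx ord0 j by right; exists i.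
  have d1 (s : R) : `|s| <= r -> is_derive s 1
      (fun u : R => log_barrier Phi (x0 + u *: delta_mx ord0 i))
      (log_barrier_dx Phi (delta_mx ord0 i) (x0 + s *: delta_mx ord0 i)).
    move=> sr; have rx := good_regular sr inI.
    exact: (@is_derive_log_barrier _ _ Phi x0 (delta_mx ord0 i) s rx).
  have d2 (s : R) : `|s| <= r -> is_derive s 1
      (fun u : R => log_barrier_dx Phi (delta_mx ord0 i) (x0 + u *: delta_mx ord0 i))
      (log_barrier_dxx Phi (delta_mx ord0 i) (x0 + s *: delta_mx ord0 i)).
    move=> sr; have rx := good_regular sr inI.
    exact: (@is_derive_log_barrier_dx _ _ Phi x0 (delta_mx ord0 i) s rx).
  have E0 : x0 + 0 *: delta_mx ord0 i = x0 by rewrite scale0r addr0.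
  have := second_difference_cvg d1 d2 r0 step_size_bounds step_size_cvg.
  rewrite E0 => lim; apply: cvg_trans lim; apply: near_eq_cvg; apply: nearW => m.
  by congr (_ / _); ring.
- have E0 : x0 + 0 *: b x0 = x0 by rewrite scale0r addr0.
  have d1 : is_derive (0 : R) 1 (fun u : R => log_barrier Phi (x0 + u *: b x0))
      (log_barrier_dx Phi (b x0) x0).
    have := @is_derive_log_barrier _ _ Phi x0 (b x0) 0.
    by rewrite E0; apply.
  have := first_difference_cvg d1 step_size_sqr_gt0 step_size_sqr_cvg.
  rewrite E0 => lim; apply: cvg_trans lim; apply: near_eq_cvg; apply: nearW => m.
  by congr (_ / _); ring.
- apply: cvg_near_cst; apply: nearW => m.
  have /andP[e0 _] := step_size_sqr m; have := lt0r_neq0 e0.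
  by move: (eps m ^+ 2) => u u0; field.
Qed.

End backward_limit.

Section backward_difference_order.
Variables (R : realType) (n : nat) (Phi : {fset 'rV[R]_n}) (k : 'rV[R]_n -> R).
Implicit Types (g : R -> 'rV[R]_n -> R).

Lemma backward_difference_lin (c e t : R) (x : 'rV[R]_n) g1 g2 :
  backward_difference Phi k e t x (fun t x => c * g1 t x - g2 t x) =
  c * backward_difference Phi k e t x g1 - backward_difference Phi k e t x g2.
Proof.
rewrite /backward_difference.
have -> : \sum_(a <- Phi) k a / 2 / dot a x ^+ 2 * (c * g1 t (reflection a x) -
    g2 t (reflection a x) - (c * g1 t x - g2 t x)) =
    c * (\sum_(a <- Phi) k a / 2 / dot a x ^+ 2 * (g1 t (reflection a x) - g1 t x)) -
    \sum_(a <- Phi) k a / 2 / dot a x ^+ 2 * (g2 t (reflection a x) - g2 t x).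
  by rewrite mulr_sumr -sumrB; apply: eq_bigr => a _; ring.
pose S g := \sum_(i <- enum 'I_n) ((g t (x + e *: delta_mx ord0 i) +
      g t (x + (- e) *: delta_mx ord0 i) - 2 * g t x) / e ^+ 2).
rewrite -/(S g1) -/(S g2) [X in _ * X + _ + _ + _](_ : _ = c * S g1 - S g2).
  by ring.
by rewrite /S mulr_sumr -sumrB; apply: eq_bigr => i _; ring.
Qed.

(** Only values at time t and earlier occur, so a maximum at the final time of an interval is
    covered as well. *)
Lemma backward_difference_le0 (e t : R) (x : 'rV[R]_n) g :
  (forall a, a \in Phi -> 0 <= k a) -> 0 < e ->
  (forall i : 'I_n, g t (x + e *: delta_mx ord0 i) <= g t x) ->
  (forall i : 'I_n, g t (x + (- e) *: delta_mx ord0 i) <= g t x) ->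
  g t (x + e ^+ 2 *: drift Phi k x) <= g t x -> g (t - e ^+ 2) x <= g t x ->
  (forall a, a \in Phi -> g t (reflection a x) <= g t x) ->
  backward_difference Phi k e t x g <= 0.
Proof.
move=> k0 e0 gp gm gb gt gr; have e2 : 0 < e ^+ 2 by rewrite exprn_gt0.
have le0 z : z <= 0 -> z / e ^+ 2 <= 0 by move=> z0; rewrite pmulr_lle0// invr_gt0.
have h1 : 2^-1 * \sum_(i <- enum 'I_n) ((g t (x + e *: delta_mx ord0 i) +
      g t (x + (- e) *: delta_mx ord0 i) - 2 * g t x) / e ^+ 2) <= 0.
  rewrite pmulr_rle0 ?invr_gt0// sumr_le0// => i _; apply: le0.
  by have := gp i; have := gm i; lra.
have h2 := le0 _ (eq_ind_r (fun b : bool => b) gb (subr_le0 _ _)).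
have h3 := le0 _ (eq_ind_r (fun b : bool => b) gt (subr_le0 _ _)).
have h4 : \sum_(a <- Phi) k a / 2 / dot a x ^+ 2 * (g t (reflection a x) - g t x) <= 0.
  rewrite big_seq sumr_le0// => a aP; rewrite mulr_ge0_le0 ?subr_le0 ?gr//.
  by rewrite !mulr_ge0 ?k0 ?invr_ge0 ?sqr_ge0.
by rewrite /backward_difference; lra.
Qed.

End backward_difference_order.

(** * The weight and the transition densities *)

Section weight.
Variables (R : realType) (n : nat) (Phi Rp : {fset 'rV[R]_n}) (k : 'rV[R]_n -> R).
Hypotheses (rs : root_system Phi) (ps : positive_subsystem Phi Rp)
  (mk : multiplicity_function Phi k).

Lemma dunkl_weight_ge0 y : 0 <= dunkl_weight Rp k y.
Proof. by apply: prodr_ge0 => a _; exact: powR_ge0. Qed.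

Lemma measurable_dunkl_weight : measurable_fun setT (dunkl_weight Rp k).
Proof.
apply: measurable_prod => a _.
apply: (measurableT_comp (f := fun z : R => z `^ (2 * k a))); first exact: measurable_powR.
apply: (measurableT_comp (@normr_measurable R setT)).
by apply: continuous_measurable_rV; exact: continuous_dotl.
Qed.

Lemma dunkl_weight_bound rho : exists M, forall y, eucl y <= rho -> dunkl_weight Rp k y <= M.
Proof.
exists (\prod_(a <- Rp) (rho * l1norm a) `^ (2 * k a)) => y yr.
rewrite /dunkl_weight big_seq [leRHS]big_seq; apply: ler_prod => a aR.
rewrite powR_ge0/=; apply: ge0_ler_powR.
- by rewrite mulr_ge0// (mult_ge0 mk)// (positive_root ps).
- by rewrite nnegrE.
- by rewrite nnegrE mulr_ge0 ?l1norm_ge0// (le_trans (eucl_ge0 y)).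
by rewrite dotC (le_trans (norm_dot_le _ _))// ler_wpM2r ?l1norm_ge0.
Qed.

Lemma dunkl_constant_ge0 : 0 <= dunkl_constant Rp k.
Proof. by apply: Rintegral_ge0 => x _; rewrite mulr_ge0 ?expR_ge0// dunkl_weight_ge0. Qed.

(** Everything in the density that does not involve t or x, moved into the test function; what
    remains is a pure heat kernel. *)
Definition weighted (phi : 'rV[R]_n -> R) y : R :=
  (dunkl_constant Rp k)^-1 * dunkl_weight Rp k y * phi y.

Lemma measurable_weighted phi : measurable_fun setT phi -> measurable_fun setT (weighted phi).
Proof.
move=> mphi; apply: measurable_funM => //; apply: measurable_funM.
  exact: measurable_cst.
exact: measurable_dunkl_weight.
Qed.

Lemma weighted_dominated phi rho : (forall y, 0 <= phi y <= 1) ->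
  (forall y, rho < eucl y -> phi y = 0) -> exists M, ball_dominated rho M (weighted phi).
Proof.
move=> phi01 phi0; have [M HM] := dunkl_weight_bound rho.
exists ((dunkl_constant Rp k)^-1 * M) => y.
have c0 : 0 <= (dunkl_constant Rp k)^-1 by rewrite invr_ge0 dunkl_constant_ge0.
have w0 := dunkl_weight_ge0 y; have /andP[p0 p1] := phi01 y.
have [yr|yr] := leP (eucl y) rho; last first.
  rewrite /weighted phi0// mulr0 normr0 indicE memNset ?mulr0//= => /(lt_le_trans yr).
  by rewrite ltxx.
rewrite indicE mem_set//= mulr1 ger0_norm ?mulr_ge0//.
by rewrite -[leRHS]mulr1 ler_pM ?mulr_ge0// ler_wpM2l ?HM.
Qed.

Variable D : 'rV[R]_n -> 'rV[R]_n -> R.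
Hypothesis hD : is_dunkl_kernel Rp k D.

Lemma dunkl_density_ge0 t x y : 0 < t -> 0 <= dunkl_density Rp k D t x y.
Proof.
move=> t0; rewrite (dunkl_density_heat rs ps mk hD)//.
apply: mulr_ge0; last exact: dunkl_weight_ge0.
by apply: mulr_ge0; [rewrite invr_ge0 dunkl_constant_ge0|exact: (heat_ge0 rs ps mk hD)].
Qed.

Lemma transition_operator_heat phi t x : 0 < t ->
  transition_operator (dunkl_density Rp k D) t phi x =
  heat_integral Rp k D (weighted phi) t x.
Proof.
move=> t0; apply: eq_Rintegral => y _.
by rewrite (dunkl_density_heat rs ps mk hD)// /weighted; ring.
Qed.

Lemma measurable_dunkl_density t x : 0 < t ->
  measurable_fun setT (dunkl_density Rp k D t x).
Proof.
move=> t0; rewrite (_ : dunkl_density _ _ _ _ _ = (fun y =>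
    (dunkl_constant Rp k)^-1 * heat Rp k D t x y * dunkl_weight Rp k y)); last first.
  by apply/funext => y; exact: (dunkl_density_heat rs ps mk hD).
apply: measurable_funM; last exact: measurable_dunkl_weight.
by apply: measurable_funM; [exact: measurable_cst|exact: (measurable_heat rs ps mk hD)].
Qed.

End weight.

(** * Comparison of the semigroup with the barrier *)

Section maximum_principle.
Variables (R : realType) (n : nat) (Phi Rp : {fset 'rV[R]_n}) (k : 'rV[R]_n -> R).
Hypotheses (rs : root_system Phi) (ps : positive_subsystem Phi Rp)
  (mk : multiplicity_function Phi k).
Variable D : 'rV[R]_n -> 'rV[R]_n -> R.
Hypothesis hD : is_dunkl_kernel Rp k D.
Hypothesis k12 : forall a, a \in Phi -> 1 / 2 <= k a.

Local Notation Q := (transition_operator (dunkl_density Rp k D)).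

Variables (f : 'rV[R]_n -> R) (rho b0 : R).
Hypotheses (rho0 : 0 <= rho) (cf : continuous f) (f01 : forall y, 0 <= f y <= 1)
  (fsupp : forall y, rho < eucl y -> f y = 0) (b00 : 0 <= b0).
Hypothesis Qf01 : forall t x, 0 < t -> 0 <= Q t f x <= 1.
Hypothesis Qf_cvg : forall e : R, 0 < e -> \forall t \near 0^'+, forall x, `|Q t f x - f x| < e.
Hypothesis fb : forall x, barrier Phi x <= expR (- (b0 * f x)).

(** Extending by f to negative times gives a function on all of R x R^n, so that continuity at time
    0 is continuity on full neighbourhoods. *)
Definition heat_extension (z : R * 'rV[R]_n) : R :=
  if z.1 <= 0 then f z.2 else Q z.1 f z.2.
Local Notation U := heat_extension.

Let U01 z : 0 <= U z <= 1.
Proof. by rewrite /U; case: (leP z.1 0) => z0; [exact: f01|exact: Qf01]. Qed.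

Let mf : measurable_fun setT f := continuous_measurable_rV cf.

(** At t <= 0 the difference splits into f x - f y and f y - Q s f y; the Feller property makes the
    second small uniformly in y, which is what joint continuity requires. *)
Lemma heat_extension_cvg (t : R) (x : 'rV[R]_n) : U z @[z --> (t, x)] --> U (t, x).
Proof.
have [t0|t0] := ltP 0 t.
  have [M bF] := weighted_dominated ps mk f01 fsupp.
  have mF := measurable_weighted Rp k mf.
  suff : U z @[z --> (t, x)] --> heat_integral Rp k D (weighted Rp k f) t x.
    have -> // : heat_integral Rp k D (weighted Rp k f) t x = U (t, x).
    by rewrite /U /= leNgt t0 /= (transition_operator_heat rs ps mk hD).
  have lim := heat_integral_continuous rs ps mk hD rho0 mF bF (x := x) t0.
  apply: cvg_trans lim.
  apply: near_eq_cvg.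
  have : \forall z \near (t, x), 0 < z.1.
    have fc : z.1 @[z --> (t, x)] --> t by exact: cvg_fst.
    exact: (cvgr_gt t fc 0 t0).
  apply: filterS => -[s y] /= s0.
  by rewrite /U /= leNgt s0 /= (transition_operator_heat rs ps mk hD).
suff : U z @[z --> (t, x)] --> f x.
  have -> // : f x = U (t, x) by rewrite /U /= t0.
apply/cvgrPdist_lt => e e0.
have e20 : 0 < e / 2 by rewrite divr_gt0.
have /nbhs_ballP[d1 /= d10 Hd1] := Qf_cvg e20.
have fx : \forall y \near nbhs x, `|f x - f y| < e / 2.
  exact: (proj1 (@cvgrPdist_lt _ _ _ (nbhs x) (nbhs_filter x) f (f x)) (@cf x) _ e20).
have h1 : \forall z \near (t, x), z.1 < d1.
  have fc : z.1 @[z --> (t, x)] --> t by exact: cvg_fst.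
  exact: (cvgr_lt t fc d1 (le_lt_trans t0 d10)).
have h2 : \forall z \near (t, x), `|f x - f z.2| < e / 2.
  have sc : z.2 @[z --> (t, x)] --> nbhs x by exact: cvg_snd.
  exact: (sc _ fx).
apply: filterS2 h1 h2 => -[s y] /= s1 fy.
rewrite /U /=; case: (leP s 0) => s0; first by lra.
have := Hd1 s; rewrite -ball_normE /= sub0r normrN gtr0_norm// => /(_ s1 s0 y) H.
rewrite (_ : f x - _ = (f x - f y) + (f y - Q s f y)); last by rewrite addrA subrK.
by apply: (le_lt_trans (ler_normD _ _)); rewrite (distrC (f y)); lra.
Qed.

Lemma heat_extension_continuous : continuous U.
Proof. by move=> [t x]; exact: heat_extension_cvg. Qed.

(* At a maximum of [barrier * expR (b0 * U - c * t)] over [0, t1] and a large ball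
   the backward differences of [b0 * U - (log_barrier + c * t)] are nonpositive,
   whereas their limit is positive. A maximum above 1 is at a positive time and
   off the hyperplanes. *)
Lemma heat_maximum_principle t1 x1 (c : R) :
  (#|`Phi|%:R + 1) * (n%:R + 2 * dunkl_gamma Rp k) < c -> 0 < t1 ->
  0 < barrier Phi x1 -> b0 * Q t1 f x1 <= - ln (barrier Phi x1) + c * t1.
Proof.
move=> c_gt t10 bx1; rewrite leNgt; apply/negP => Hlt.
have c0 : 0 < c.
  apply: le_lt_trans c_gt; rewrite mulr_ge0 ?addr_ge0 ?mulr_ge0//.
  by rewrite /dunkl_gamma big_seq sumr_ge0// => a aR; rewrite (mult_ge0 mk)// (positive_root ps).
pose Xi (z : R * 'rV[R]_n) := barrier Phi z.2 * expR (b0 * U z - c * z.1).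
have cXi : continuous Xi.
  apply: continuousM_fun.
    apply: (continuous_compose (f := snd)); last exact: barrier_continuous.
    by move=> z; exact: cvg_snd.
  apply: (continuous_compose (g := expR)); last exact: continuous_expR.
  apply: continuousB_fun; apply: continuous_mulc; first exact: heat_extension_continuous.
  by move=> z; exact: cvg_fst.
have Xi1 : 1 < Xi (t1, x1).
  rewrite /Xi /= {1}/U /= leNgt t10 /= -{1}(lnK bx1) -expRD expR_gt1.
  by lra.
(* Outside this ball |x| >= b0 + 1, so [Xi] is at most exp(b0 - |x|^2) <= 1 and cannot compete with
   the value at (t1, x1). *)
pose B := eucl x1 + b0 + 1.
pose K := [set` `[0, t1]] `*` [set x : 'rV[R]_n | eucl x <= B].
have cK : compact K by apply: compact_setX; [exact: segment_compact|exact: compact_eucl_ball].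
have K1 : K (t1, x1).
  split => /=; first by rewrite in_itv /= (ltW t10) lexx.
  by rewrite /B -addrA lerDl addr_ge0.
have [||[t0 x0]] := @compact_EVT_max _ _ Xi K _ cK.
- by exists (t1, x1).
- exact: continuous_subspaceT.
rewrite inE => -[/=]; rewrite in_itv /= => /andP[t0_ge0 t0t1] x0B Hmax.
have Xi0 : 1 < Xi (t0, x0) by apply: (lt_le_trans Xi1); apply: Hmax; rewrite inE.
have Hglob t x : 0 <= t -> t <= t1 -> Xi (t, x) <= Xi (t0, x0).
  move=> t_ge0 tt1; have [xB|xB] := leP (eucl x) B.
    by apply: Hmax; rewrite inE; split => //=; rewrite in_itv /= t_ge0.
  apply: (@le_trans _ _ 1); last exact: ltW.
  rewrite /Xi /= (le_trans (ler_wpM2r (expR_ge0 _) (barrier_le rs x)))//.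
  rewrite -expRD -[leRHS]expR0 ler_expR -sqr_eucl.
  have : b0 + 1 <= eucl x by rewrite (le_trans _ (ltW xB))// /B -addrA lerDr eucl_ge0.
  have /andP[_ U1] := U01 (t, x).
  have : b0 * U (t, x) <= b0 by rewrite ler_piMr.
  have : 0 <= c * t by rewrite mulr_ge0// ltW.
  by move: (U _) (c * t) (eucl x) => u ct N; nra.
have t00 : 0 < t0.
  rewrite lt_def t0_ge0 andbT; apply: contraTneq Xi0 => ->.
  rewrite -leNgt /Xi /= /U /= lexx /= mulr0 subr0.
  apply: (le_trans (ler_wpM2r (expR_ge0 _) (fb x0))).
  by rewrite -expRD addNr expR0.
have bx0 : 0 < barrier Phi x0.
  rewrite lt_def barrier_ge0 andbT; apply: contraTneq Xi0 => bx0.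
  by rewrite /Xi /= bx0 mul0r -leNgt.
have rx0 := barrier_gt0_regular bx0.
have [M bF] := weighted_dominated ps mk f01 fsupp.
have mF := measurable_weighted Rp k mf.
pose u := heat_integral Rp k D (weighted Rp k f).
have Hlog t x : 0 < t -> t <= t1 -> regular Phi x ->
    b0 * u t x - (log_barrier Phi x + c * t) <=
    b0 * u t0 x0 - (log_barrier Phi x0 + c * t0).
  move=> tt0 tt1 rx; have := Hglob t x (ltW tt0) tt1.
  rewrite /Xi /U /= (leNgt t) (leNgt t0) tt0 t00 /=.
  rewrite !(transition_operator_heat rs ps mk hD)// -/(u _ _) -/(u _ _).
  rewrite -(lnK (barrier_gt0 rx)) -{1}(lnK bx0) !ln_barrier// -!expRD ler_expR.
  by lra.
have [r gr] := good_radius_exists k t00 rx0.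
have lim1 := backward_difference_heat_integral rs ps mk hD t00 rx0 gr rho0 mF bF.
have lim2 := @backward_difference_log_barrier _ _ _ k rs t0 x0 rx0 r gr c.
have lim : backward_difference Phi k (step_size r m) t0 x0
    (fun t x => b0 * u t x - (log_barrier Phi x + c * t)) @[m --> \oo] -->
    b0 * 0 - (2^-1 * \sum_(i < n) log_barrier_dxx Phi (delta_mx ord0 i) x0 +
    log_barrier_dx Phi (drift Phi k x0) x0 - c).
  under eq_cvg do rewrite backward_difference_lin.
  by apply: cvgB; [exact: cvg_mulc|exact: lim2].
have : b0 * 0 - (2^-1 * \sum_(i < n) log_barrier_dxx Phi (delta_mx ord0 i) x0 +
    log_barrier_dx Phi (drift Phi k x0) x0 - c) <= 0.
  rewrite -(cvg_lim (@Rhausdorff R) lim); apply: limr_le.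
    by apply/cvg_ex; eexists; exact: lim.
  apply: nearW => m; have /andP[e0 er] := step_size_bounds gr m.
  have /andP[e20 e2r] := step_size_sqr gr m.
  have e2t := step_size_sqr_lt gr m.
  apply: backward_difference_le0 => //.
  - by move=> a aP; exact: (mult_ge0 mk).
  - move=> i; apply: Hlog => //; apply: (good_regular gr); last by right; exists i.
    by rewrite ger0_norm// ltW.
  - move=> i; apply: Hlog => //; apply: (good_regular gr); last by right; exists i.
    by rewrite normrN ger0_norm// ltW.
  - apply: Hlog => //; apply: (good_regular gr); last by left.
    by rewrite ger0_norm// ltW.
  - by apply: Hlog => //; lra.
  - by move=> a aP; apply: Hlog => //; exact: regular_reflection.
have := log_barrier_generator_le rs ps mk rx0 k12.
by move: (2^-1 * _) (log_barrier_dx _ _ _) => u1 u2; lra.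
Qed.

End maximum_principle.

(** * The truncated logarithm of the barrier *)

Lemma continuous_maxr (R : realType) (T : topologicalType) (f g : T -> R) :
  continuous f -> continuous g -> continuous (fun x => Num.max (f x) (g x)).
Proof. by move=> cf cg x; apply: (@continuous_max R T f g x); [exact: cf|exact: cg]. Qed.

Lemma monotone_real_cvg d (T : measurableType d) (R : realType)
    (mu : {measure set T -> \bar R}) (A : set T) (g_ : nat -> T -> R) (g : T -> R) :
  measurable A -> (forall m, measurable_fun A (g_ m)) ->
  (forall m y, A y -> 0 <= g_ m y) ->
  (forall y, A y -> {homo g_ ^~ y : m p / (m <= p)%N >-> m <= p}) ->
  (forall y, A y -> g_ m y @[m --> \oo] --> g y) ->
  (\int[mu]_(y in A) (g_ m y)%:E)%E @[m --> \oo] --> (\int[mu]_(y in A) (g y)%:E)%E.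
Proof.
move=> mA mg g0 ndg cg.
rewrite (_ : (\int[mu]_(y in A) (g y)%:E)%E =
   (\int[mu]_(y in A) limn (fun m => (g_ m y)%:E))%E); last first.
  apply: eq_integral => y; rewrite inE => Ay; apply/esym/cvg_lim => //.
  by apply: cvg_EFin; [exact: nearW|exact: cg].
apply: (@cvg_monotone_convergence _ _ _ mu A mA (fun m y => (g_ m y)%:E)).
- by move=> m; apply/measurable_EFinP.
- by move=> m y Ay; rewrite lee_fin g0.
- by move=> y Ay m p mp; rewrite lee_fin; exact: ndg.
Qed.

Section cutoff.
Variables (R : realType) (n : nat).
Implicit Types (y : 'rV[R]_n).

Definition cutoff (m : nat) y : R := Num.max 0 (1 - eucl y / m.+1%:R).

Lemma cutoff_continuous m : continuous (cutoff m).
Proof.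
apply: continuous_maxr; first exact: cst_continuous.
apply: continuousB_fun; first exact: cst_continuous.
by apply: continuousM_fun; [exact: continuous_eucl|exact: cst_continuous].
Qed.

Lemma cutoff01 m y : 0 <= cutoff m y <= 1.
Proof. by rewrite le_max lexx /= ge_max ler01 lerBlDr lerDl divr_ge0// eucl_ge0. Qed.

Lemma cutoff_eq0 m y : m.+1%:R < eucl y -> cutoff m y = 0.
Proof.
move=> ym; apply/max_idPl; rewrite subr_le0 ler_pdivlMr// mul1r.
exact: ltW.
Qed.

Lemma cutoff_nd y : {homo cutoff ^~ y : m p / (m <= p)%N >-> m <= p}.
Proof.
move=> m p mp; rewrite /cutoff ge_max le_max lexx /= le_max; apply/orP; right.
by rewrite lerD2l lerN2 ler_wpM2l ?eucl_ge0// lef_pV2 ?posrE// ler_nat ltnS.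
Qed.

Lemma cutoff_cvg y : cutoff m y @[m --> \oo] --> (1 : R).
Proof.
have lim : 1 - eucl y * harmonic m @[m --> \oo] --> 1 - eucl y * (0 : R).
  by apply: cvgB; [exact: cvg_cst|apply: cvg_mulc; exact: cvg_harmonic].
rewrite mulr0 subr0 in lim.
apply: (squeeze_cvgr _ lim (cvg_cst (1 : R))); apply: nearW => m.
by rewrite le_max lexx orbT /=; case/andP: (cutoff01 m y).
Qed.

End cutoff.

Section truncated_barrier.
Variables (R : realType) (n : nat) (Phi : {fset 'rV[R]_n}).
Hypothesis rs : root_system Phi.
Variable lam : R.
Hypothesis lam0 : 0 < lam.
Implicit Types (x y : 'rV[R]_n).

(** The minimum of -ln beta and lam, written so that the logarithm sees only positive numbers; hence
    it is continuous across the hyperplanes. *)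
Definition trunc_barrier x : R := - ln (Num.max (barrier Phi x) (expR (- lam))).

Let max_pos x : 0 < Num.max (barrier Phi x) (expR (- lam)).
Proof. by rewrite lt_max expR_gt0 orbT. Qed.

Lemma barrier_le1 x : barrier Phi x <= 1.
Proof.
apply: (le_trans (barrier_le rs x)).
by rewrite -[leRHS]expR0 ler_expR oppr_le0 dot_ge0.
Qed.

Lemma trunc_barrier_continuous : continuous trunc_barrier.
Proof.
move=> x; apply/continuousN_fun => {}x.
have lim : Num.max (barrier Phi z) (expR (- lam)) @[z --> x] -->
    Num.max (barrier Phi x) (expR (- lam)).
  by apply: continuous_maxr; [exact: barrier_continuous|exact: cst_continuous].
exact: (cvg_comp _ _ lim (continuous_ln (max_pos x))).
Qed.

Lemma trunc_barrier_bounds x : 0 <= trunc_barrier x <= lam.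
Proof.
have le1 : Num.max (barrier Phi x) (expR (- lam)) <= 1.
  by rewrite ge_max barrier_le1/= -[leRHS]expR0 ler_expR oppr_le0 ltW.
rewrite oppr_ge0 ln_le0//= lerNl -[leLHS]expRK ler_ln ?posrE ?expR_gt0//.
by rewrite le_max lexx orbT.
Qed.

Lemma trunc_barrier_ln x : expR (- lam) <= barrier Phi x ->
  trunc_barrier x = - ln (barrier Phi x).
Proof. by move=> bx; rewrite /trunc_barrier max_l. Qed.

Lemma trunc_barrier_eq x : barrier Phi x <= expR (- lam) -> trunc_barrier x = lam.
Proof. by move=> bx; rewrite /trunc_barrier max_r// expRK opprK. Qed.

Lemma barrier_le_trunc x : barrier Phi x <= expR (- trunc_barrier x).
Proof. by rewrite opprK lnK ?posrE// le_max lexx. Qed.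

(** [trunc_barrier] equals lam far from the origin, so it is not in C_0 and has to be cut off.
    Division by lam brings it into [0, 1], where the Feller property applies; lam returns as the
    factor [b0] of the maximum principle. *)
Definition test_function (m : nat) x : R := trunc_barrier x / lam * cutoff m x.

Lemma test_function_continuous m : continuous (test_function m).
Proof.
apply: continuousM_fun; last exact: cutoff_continuous.
by apply: continuousM_fun; [exact: trunc_barrier_continuous|exact: cst_continuous].
Qed.

Lemma test_function01 m x : 0 <= test_function m x <= 1.
Proof.
have /andP[g0 g1] := trunc_barrier_bounds x; have /andP[c0 c1] := cutoff01 m x.
rewrite mulr_ge0 ?divr_ge0 ?(ltW lam0)//= mulr_ile1 ?divr_ge0 ?(ltW lam0)//.
by rewrite ler_pdivrMr// mul1r.
Qed.

Lemma test_function_eq0 m x : m.+1%:R < eucl x -> test_function m x = 0.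
Proof. by move=> /cutoff_eq0 xm; rewrite /test_function xm mulr0. Qed.

Lemma barrier_le_test_function m x :
  barrier Phi x <= expR (- (lam * test_function m x)).
Proof.
apply: (le_trans (barrier_le_trunc x)); rewrite ler_expR lerN2 /test_function mulrA.
rewrite mulrCA divff ?lt0r_neq0// mulr1 ler_piMr//.
  by case/andP: (trunc_barrier_bounds x).
by case/andP: (cutoff01 m x).
Qed.

Lemma test_function_C0 m : C0_function (test_function m).
Proof.
split; first exact: test_function_continuous.
move=> e e0; exists m.+1%:R => x xm; rewrite test_function_eq0 ?normr0//.
exact: (lt_le_trans xm (norm_le_eucl x)).
Qed.

End truncated_barrier.

(** * The semigroup acting on the truncated barrier *)

Section semigroup_bound.
Variables (R : realType) (n : nat) (Phi Rp : {fset 'rV[R]_n}) (k : 'rV[R]_n -> R).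
Hypotheses (rs : root_system Phi) (ps : positive_subsystem Phi Rp)
  (mk : multiplicity_function Phi k).
Variable D : 'rV[R]_n -> 'rV[R]_n -> R.
Hypothesis hD : is_dunkl_kernel Rp k D.
Hypothesis k12 : forall a, a \in Phi -> 1 / 2 <= k a.
Hypothesis feller : feller_semigroup (transition_operator (dunkl_density Rp k D)).
Implicit Types (x y : 'rV[R]_n) (B : set 'rV[R]_n).

Local Notation p := (dunkl_density Rp k D).
Local Notation mu := (lebesgue_rV R n).

(** The final + 1 meets the strict inequality asked of c by the maximum principle. *)
Definition drift_bound : R := (#|`Phi|%:R + 1) * (n%:R + 2 * dunkl_gamma Rp k) + 1.

Lemma drift_bound_ge0 : 0 <= drift_bound.
Proof.
rewrite addr_ge0// mulr_ge0 ?addr_ge0 ?mulr_ge0// /dunkl_gamma big_seq sumr_ge0// => a aR.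
by rewrite (mult_ge0 mk)// (positive_root ps).
Qed.

Lemma integral_density_EFin (phi : 'rV[R]_n -> R) (rho t : R) x :
  0 < t -> 0 <= rho -> measurable_fun setT phi ->
  (forall y, 0 <= phi y <= 1) -> (forall y, rho < eucl y -> phi y = 0) ->
  (\int[mu]_y (p t x y * phi y)%:E)%E = (heat_integral Rp k D (weighted Rp k phi) t x)%:E.
Proof.
move=> t0 rho0 mphi phi01 phi0.
have [M bF] := weighted_dominated ps mk phi01 phi0.
have mF := measurable_weighted Rp k mphi.
rewrite -(transition_operator_heat rs ps mk hD)// /transition_operator /Rintegral fineK//.
apply: integrable_fin_num => //.
rewrite (_ : (fun _ => _) = EFin \o (fun y => heat Rp k D t x y * weighted Rp k phi y)).
  by apply: (admissible_integrable mF bF); exact: (admissible_heat rs ps mk hD rho0).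
apply/funext => y /=; congr EFin.
by rewrite (dunkl_density_heat rs ps mk hD)// /weighted; ring.
Qed.

(** The cutoffs increase to 1, so monotone convergence carries the maximum principle from
    [lam * test_function] to [trunc_barrier]. The condition on x makes [trunc_barrier] equal to -ln
    beta there. *)
Lemma semigroup_trunc_barrier (lam t : R) x : 0 < lam -> 0 < t ->
  expR (- lam) < barrier Phi x ->
  (\int[mu]_y (p t x y * trunc_barrier Phi lam y)%:E <=
   (trunc_barrier Phi lam x + drift_bound * t)%:E)%E.
Proof.
move=> lam0 t0 bx; have bx0 := lt_trans (expR_gt0 _) bx.
rewrite trunc_barrier_ln; last exact: ltW.
have lim := @monotone_real_cvg _ _ _ mu setT
  (fun m y => p t x y * (trunc_barrier Phi lam y * cutoff m y))
  (fun y => p t x y * trunc_barrier Phi lam y) measurableT.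
have p0 y : 0 <= p t x y := dunkl_density_ge0 rs ps mk hD x y t0.
have g0 y : 0 <= trunc_barrier Phi lam y by case/andP: (trunc_barrier_bounds rs lam0 y).
have mp := measurable_dunkl_density rs ps mk hD x t0.
have {}lim : (\int[mu]_y (p t x y * (trunc_barrier Phi lam y * cutoff m y))%:E)%E
    @[m --> \oo] --> (\int[mu]_y (p t x y * trunc_barrier Phi lam y)%:E)%E.
  apply: lim.
  - move=> m; apply: measurable_funM => //; apply: continuous_measurable_rV.
    by apply: continuousM_fun; [exact: trunc_barrier_continuous|exact: cutoff_continuous].
  - move=> m y _; rewrite mulr_ge0// mulr_ge0//.
    by case/andP: (cutoff01 m y).
  - by move=> y _ m q mq; rewrite ler_wpM2l// ler_wpM2l// cutoff_nd.
  - move=> y _.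
    have c : p t x y * (trunc_barrier Phi lam y * cutoff m y) @[m --> \oo] -->
        p t x y * (trunc_barrier Phi lam y * 1).
      by apply: cvg_mulc; apply: cvg_mulc; exact: cutoff_cvg.
    by rewrite mulr1 in c.
rewrite -(cvg_lim _ lim)//; apply: lime_le; first by apply/cvg_ex; eexists; exact: lim.
apply: nearW => m.
have t1 := @test_function01 _ _ _ rs lam lam0 m.
have tc := @test_function_continuous _ _ Phi lam m.
rewrite (_ : (\int[mu]_y _)%E =
    (\int[mu]_y (lam%:E * (p t x y * test_function Phi lam m y)%:E))%E); last first.
  apply: eq_integral => y _; rewrite -EFinM /test_function; congr EFin.
  by field; rewrite lt0r_neq0.
rewrite ge0_integralZl//; last 3 first.
- apply/measurable_EFinP; apply: measurable_funM => //.
  exact: continuous_measurable_rV.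
- by move=> y _; rewrite lee_fin mulr_ge0//; case/andP: (t1 y).
- by rewrite lee_fin ltW.
have tC0 := test_function_C0 Phi lam m.
have [_ F2 _ F4] := feller.
rewrite (@integral_density_EFin _ m.+1%:R)//; last 2 first.
- exact: continuous_measurable_rV.
- exact: test_function_eq0.
rewrite -EFinM lee_fin -(transition_operator_heat rs ps mk hD)//.
apply: (@heat_maximum_principle _ _ _ _ _ rs ps mk _ hD k12 _ m.+1%:R) => //.
- exact: test_function_eq0.
- exact: ltW.
- by move=> s y s0; exact: F2.
- exact: F4.
- exact: barrier_le_test_function.
- by rewrite /drift_bound ltrDl.
Qed.

(** For the part of B in a ball the integral is continuous in x; letting the radius grow gives a
    pointwise limit of continuous functions. *)
Lemma measurable_semigroup_set (t : R) B : 0 < t -> measurable B ->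
  measurable_fun setT (fun x => \int[mu]_(y in B) (p t x y)%:E)%E.
Proof.
move=> t0 mB; pose phi m := \1_(B `&` [set y | eucl y <= m%:R]) : 'rV[R]_n -> R.
have mphi m : measurable_fun setT (phi m).
  by apply: measurable_indic; apply: measurableI => //; exact: measurable_eucl_ball.
have phi01 m y : 0 <= phi m y <= 1 by rewrite /phi indicE; case: (_ \in _); rewrite /= ?lexx ?ler01.
have phi0 m y : m%:R < eucl y -> phi m y = 0.
  by move=> ym; rewrite /phi indicE memNset//= => -[_] /(lt_le_trans ym); rewrite ltxx.
apply: (@emeasurable_fun_cvg _ _ _ _
  (fun m x => (heat_integral Rp k D (weighted Rp k (phi m)) t x)%:E)).
  move=> m; apply/measurable_EFinP; apply: continuous_measurable_rV => x.
  have [M bF] := weighted_dominated ps mk (phi01 m) (phi0 m).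
  have mF := measurable_weighted Rp k (mphi m).
  have lim := heat_integral_continuous rs ps mk hD (ler0n R m) mF bF (x := x) t0.
  have pc : (t, z) @[z --> nbhs x] --> (t, x).
    have c1 : cst t z @[z --> nbhs x] --> t by exact: (@cst_continuous _ _ t x).
    have c2 : id z @[z --> nbhs x] --> x by exact: cvg_id.
    exact: (@cvg_pair _ _ _ (nbhs x) (nbhs t) (nbhs x) (nbhs_filter x) (nbhs_filter t)
      (nbhs_filter x) _ _ c1 c2).
  exact: (cvg_comp (fun z : 'rV[R]_n => (t, z)) _ pc lim).
move=> x _.
have p0 y : 0 <= p t x y := dunkl_density_ge0 rs ps mk hD x y t0.
have mp := measurable_dunkl_density rs ps mk hD x t0.
rewrite integral_mkcond.
rewrite (_ : (\int[mu]_y _)%E = (\int[mu]_y (p t x y * \1_B y)%:E)%E); last first.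
  by apply: eq_integral => y _; rewrite epatch_indic EFinM.
under eq_cvg do rewrite -(integral_density_EFin x t0 (ler0n R _) (mphi _) (phi01 _) (phi0 _)).
apply: monotone_real_cvg => //.
- by move=> m; exact: measurable_funM.
- by move=> m y _; rewrite mulr_ge0//; case/andP: (phi01 m y).
- move=> y _ m q mq; rewrite ler_wpM2l// /phi !indicE.
  case: (boolP (y \in B `&` [set y | eucl y <= m%:R])) => [/set_mem/= [By ym]|_].
    by rewrite mem_set//; split => //=; rewrite (le_trans ym)// ler_nat.
  by rewrite ler0n.
move=> y _; apply: cvg_mulc; apply: cvg_near_cst.
have [N HN] : exists N : nat, eucl y <= N%:R.
  by exists (Num.trunc (eucl y)).+1; rewrite ltW// truncnS_gt.
exists N => // m /= Nm; rewrite /phi !indicE; congr (_%:R); congr (nat_of_bool _).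
apply/idP/idP => /set_mem H; apply/mem_set; first by case: H.
by split => //=; rewrite (le_trans HN)// ler_nat.
Qed.

End semigroup_bound.

(** * The supermartingale inequality and dyadic times *)

Section layers.
Variables (R : realType) (delta z : R).
Hypothesis delta0 : 0 < delta.

(** For z >= 0 this is the integer part of z / delta capped at J: delta times it approximates z from
    below with error at most delta as long as z <= J delta. *)
Let layers J := \sum_(j < J) ((j.+1%:R * delta <= z)%R : nat)%:R : R.

Let layers_le J : layers J <= J%:R.
Proof.
rewrite -[X in _ <= X%:R]card_ord -sum1_card natr_sum; apply: ler_sum => j _.
by case: (_ <= z).
Qed.

Lemma layers_lower J : 0 <= z -> delta * layers J <= z.
Proof.
move=> z0; elim: J => [|J IH]; first by rewrite /layers big_ord0 mulr0.
rewrite /layers big_ord_recr/= -/(layers J).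
case: (leP (J.+1%:R * delta) z) => [Jz|_]; last by rewrite addr0.
apply: le_trans Jz; rewrite mulrC ler_pM2r// -natr1 lerD2r.
exact: layers_le.
Qed.

Lemma layers_upper J : z <= J%:R * delta -> z <= delta * (layers J + 1).
Proof.
elim: J => [|J IH] zJ.
  by rewrite /layers big_ord0 add0r mulr1; apply: (le_trans zJ); rewrite mul0r ltW.
case: (leP z (J%:R * delta)) => [/IH {}IH|Jz].
  apply: (le_trans IH); rewrite ler_pM2l// lerD2r /layers big_ord_recr/= lerDl.
  exact: ler0n.
apply: (le_trans zJ); rewrite mulrC ler_pM2l// -natr1 lerD2r.
rewrite /layers big_ord_recr/= -[leLHS]addr0 lerD ?ler0n//.
rewrite -[X in X%:R <= _]card_ord -sum1_card natr_sum; apply: ler_sum => j _.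
rewrite (_ : _ <= z)//; apply: le_trans (ltW Jz); rewrite ler_pM2r// ler_nat.
exact: ltn_ord.
Qed.

End layers.

(** * From transition probabilities of sets to expectations of functions *)

Section kernel_integral.
Variables (R : realType) (d d' : measure_display) (T : measurableType d)
  (Y : measurableType d') (P : probability T R) (nu : {measure set Y -> \bar R}).

(* Compare g with its J-level step functions from below and from above. *)
Lemma kernel_integral_le (A : set T) (X : T -> Y) (kap : T -> Y -> R)
    (g : Y -> R) (h : T -> R) (lam : R) :
  measurable A -> measurable_fun setT X -> measurable_fun setT g ->
  (forall y, 0 <= g y <= lam) ->
  (forall w, measurable_fun setT (kap w)) -> (forall w y, 0 <= kap w y) ->
  (forall B, measurable B ->
    measurable_fun setT (fun w => \int[nu]_(y in B) (kap w y)%:E)%E) ->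
  (forall B, measurable B ->
    P (A `&` X @^-1` B) = (\int[P]_(w in A) \int[nu]_(y in B) (kap w y)%:E)%E) ->
  measurable_fun setT h ->
  (forall w, A w -> \int[nu]_y (kap w y * g y)%:E <= (h w)%:E)%E ->
  (\int[P]_(w in A) (g (X w))%:E <= \int[P]_(w in A) (h w)%:E)%E.
Proof.
move=> mA mX mg g_bnd mkap kap0 mK PK mh hh.
apply/lee_addgt0Pr => e e0.
have [J Je] : exists J : nat, lam <= J%:R * e.
  exists (Num.trunc (lam / e)).+1.
  by rewrite -ler_pdivrMr// ltW// truncnS_gt.
pose B (j : 'I_J) := [set y | j.+1%:R * e <= g y].
have mB j : measurable (B j).
  by rewrite -[B j]setTI; apply: measurable_fun_ler => //; exact: measurable_cst.
have indicB j y : \1_(B j) y = ((j.+1%:R * e <= g y)%R : nat)%:R :> R.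
  rewrite indicE; congr ((nat_of_bool _)%:R).
  by apply/idP/idP => [/set_mem//|?]; exact/mem_set.
have mXB j : measurable (X @^-1` B j) by rewrite -[X in measurable X]setTI; exact: mX.
have e0' : (0 <= e%:E)%E by rewrite lee_fin ltW.
have mI j : measurable_fun A (fun w => (\1_(B j) (X w) : R)%:E).
  apply/measurable_EFinP; apply: (measurable_funS measurableT) => //.
  by apply: (measurableT_comp _ mX); exact: measurable_indic.
apply: (@le_trans _ _ (\int[P]_(w in A) (e%:E * (\sum_(j < J) (\1_(B j) (X w))%:E) + e%:E))%E).
  apply: ge0_le_integral => //.
  - by move=> w _; rewrite lee_fin; case/andP: (g_bnd (X w)).
  - apply/measurable_EFinP; apply: (measurable_funS measurableT) => //.
    exact: measurableT_comp.
  - apply: emeasurable_funD; last exact: measurable_cst.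
    by apply: emeasurable_funM; [exact: measurable_cst|exact: emeasurable_sum].
  - move=> w _; rewrite sumEFin -EFinM -EFinD lee_fin.
    rewrite (eq_bigr _ (fun j _ => indicB j (X w))) -[X in _ <= _ + X]mulr1 -mulrDr.
    apply: layers_upper => //; apply: le_trans Je.
    by case/andP: (g_bnd (X w)).
rewrite ge0_integralD//=; last 2 first.
- by move=> w _; rewrite mule_ge0// sume_ge0// => j _; rewrite lee_fin indicE ler0n.
- by apply: emeasurable_funM; [exact: measurable_cst|exact: emeasurable_sum].
apply: leeD; last first.
  have := lee_wpmul2l e0' (probability_le1 P mA).
  by rewrite mule1 integral_cst.
rewrite ge0_integralZl//=; last 2 first.
- exact: emeasurable_sum.
- by move=> w _; rewrite sume_ge0// => j _; rewrite lee_fin indicE ler0n.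
rewrite ge0_integral_sum//=.
(* The hypothesis on P concerns sets, so it is applied to the level sets B j, into which g has been
   decomposed. *)
rewrite (eq_bigr (fun j => \int[P]_(w in A) \int[nu]_(y in B j) (kap w y)%:E)%E); last first.
  move=> j _; rewrite -PK// setIC -integral_indic//.
have mKA j : measurable_fun A (fun w => \int[nu]_(y in B j) (kap w y)%:E)%E.
  by apply: (measurable_funS measurableT) => //; exact: mK.
have K0 j w : (0 <= \int[nu]_(y in B j) (kap w y)%:E)%E.
  by apply: integral_ge0 => y _; rewrite lee_fin.
rewrite -ge0_integral_sum// -ge0_integralZl//; last 2 first.
- exact: emeasurable_sum.
- by move=> w _; rewrite sume_ge0.
apply: ge0_le_integral => //.
- by move=> w _; rewrite mule_ge0// sume_ge0.
- by apply: emeasurable_funM; [exact: measurable_cst|exact: emeasurable_sum].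
- by apply/measurable_EFinP; exact: (measurable_funS measurableT).
move=> w Aw; apply: le_trans (hh w Aw).
rewrite (eq_bigr (fun j => \int[nu]_y (kap w y * \1_(B j) y)%:E)%E); last first.
  move=> j _; rewrite integral_mkcond; apply: eq_integral => y _.
  by rewrite epatch_indic EFinM.
have mKI j : measurable_fun setT (fun y => (kap w y * \1_(B j) y)%:E).
  by apply/measurable_EFinP; apply: measurable_funM => //; exact: measurable_indic.
have KI0 j y : (0 <= (kap w y * \1_(B j) y)%:E)%E.
  by rewrite lee_fin mulr_ge0// indicE ler0n.
rewrite -ge0_integral_sum// -ge0_integralZl//; last 2 first.
- exact: emeasurable_sum.
- by move=> y _; rewrite sume_ge0.
apply: ge0_le_integral => //.
- by move=> y _; rewrite mule_ge0// sume_ge0.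
- by apply: emeasurable_funM; [exact: measurable_cst|exact: emeasurable_sum].
- by apply/measurable_EFinP; exact: measurable_funM.
move=> y _; rewrite sumEFin -EFinM lee_fin -mulr_sumr mulrCA ler_wpM2l//.
rewrite (eq_bigr _ (fun j _ => indicB j y)); apply: layers_lower => //.
by case/andP: (g_bnd y).
Qed.

End kernel_integral.

Section natural_filtration.
Variables (R : realType) (n : nat) (d : measure_display) (Om : measurableType d).
Variable X : R -> Om -> 'rV[R]_n.
Hypothesis mX : forall t : R, 0 <= t -> measurable_fun setT (X t).

Lemma natural_filtration_measurable (s : R) A :
  natural_filtration X s A -> measurable A.
Proof.
apply: smallest_sub; first exact: sigma_algebra_measurable.
move=> B [u]; rewrite /= in_itv/= => /andP[u0 _] [C mC <-].
exact: mX.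
Qed.

Lemma natural_filtrationS (s s' : R) : s <= s' ->
  natural_filtration X s `<=` natural_filtration X s'.
Proof.
move=> ss'; apply: sub_sigma_algebra2 => B [u]; rewrite /= in_itv/= => /andP[u0 us] HB.
by exists u => //=; rewrite in_itv/= u0 (le_trans us).
Qed.

Lemma natural_filtration_preimage (s : R) B : 0 <= s -> measurable B ->
  natural_filtration X s (X s @^-1` B).
Proof.
move=> s0 mB; apply: sub_gen_smallest; exists s; first by rewrite /= in_itv/= s0 lexx.
by exists B => //; rewrite setTI.
Qed.

Lemma natural_filtrationI (s : R) A B : natural_filtration X s A ->
  natural_filtration X s B -> natural_filtration X s (A `&` B).
Proof.
move=> FA FB.
exact: (@measurableI _ (g_sigma_algebraType
  (\bigcup_(u in `[0, s]) preimage_set_system setT (X u) measurable)) A B).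
Qed.

End natural_filtration.

(** * The stopped supermartingale on a mesh of times *)

Section supermartingale.
Variables (R : realType) (n : nat) (Phi Rp : {fset 'rV[R]_n}) (k : 'rV[R]_n -> R).
Hypotheses (rs : root_system Phi) (ps : positive_subsystem Phi Rp)
  (mk : multiplicity_function Phi k).
Variable D : 'rV[R]_n -> 'rV[R]_n -> R.
Hypothesis hD : is_dunkl_kernel Rp k D.
Hypothesis k12 : forall a, a \in Phi -> 1 / 2 <= k a.
Hypothesis feller : feller_semigroup (transition_operator (dunkl_density Rp k D)).
Variables (d : measure_display) (Om : measurableType d) (P : probability Om R).
Variable X : R -> Om -> 'rV[R]_n.
Hypothesis mX : forall t : R, 0 <= t -> measurable_fun setT (X t).
Hypothesis markov : markov_process_with_densities P (dunkl_density Rp k D) X.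

Local Notation c := (drift_bound Phi Rp k).
Local Notation beta := (barrier Phi).
Local Notation g := (trunc_barrier Phi).

Let measurable_trunc lam (t : R) : 0 < lam -> 0 <= t ->
  measurable_fun setT (fun w => g lam (X t w)).
Proof.
move=> lam0 t0; apply: (measurableT_comp _ (mX t0)).
by apply: continuous_measurable_rV; exact: trunc_barrier_continuous.
Qed.

Let measurable_gt (e : R) : measurable [set y | e < beta y].
Proof.
rewrite -[X in measurable X]setTI.
apply: measurable_fun_ltr => //.
by apply: continuous_measurable_rV; exact: barrier_continuous.
Qed.

Let measurable_ge (e : R) : measurable [set y | e <= beta y].
Proof.
rewrite -[X in measurable X]setTI.
apply: measurable_fun_ler => //.
by apply: continuous_measurable_rV; exact: barrier_continuous.
Qed.

Lemma trunc_barrier_supermartingale (lam s t : R) A : 0 < lam -> 0 <= s -> s < t ->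
  natural_filtration X s A -> (forall w, A w -> expR (- lam) < beta (X s w)) ->
  (\int[P]_(w in A) (g lam (X t w))%:E <=
   \int[P]_(w in A) (g lam (X s w) + c * (t - s))%:E)%E.
Proof.
move=> lam0 s0 st FA Ab; have t0 : 0 <= t by rewrite (le_trans s0)// ltW.
have ts : 0 < t - s by rewrite subr_gt0.
apply: (@kernel_integral_le _ _ _ _ _ P (lebesgue_rV R n) A (X t)
  (fun w y => dunkl_density Rp k D (t - s) (X s w) y) (g lam) _ lam).
- exact: (natural_filtration_measurable mX FA).
- exact: mX.
- by apply: continuous_measurable_rV; exact: trunc_barrier_continuous.
- by move=> y; exact: trunc_barrier_bounds.
- by move=> w; exact: (measurable_dunkl_density rs ps mk hD).
- by move=> w y; exact: (dunkl_density_ge0 rs ps mk hD).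
- move=> B mB; have mK := measurable_semigroup_set rs ps mk hD ts mB.
  exact: (measurableT_comp mK (mX s0)).
- by move=> B mB; exact: markov.
- by apply: measurable_funD; [exact: measurable_trunc|exact: measurable_cst].
by move=> w /Ab; exact: (semigroup_trunc_barrier rs ps mk hD k12 feller).
Qed.

Section discrete_time.
Variables (M lam h : R).
Hypotheses (M0 : 0 <= M) (Mlam : M < lam) (h0 : 0 < h).

Let lam0 : 0 < lam. Proof. exact: le_lt_trans Mlam. Qed.

(** The event that the process starts with -ln beta <= M and has not been stopped by time i h. As M
    < lam, the initial condition already puts the process below lam at time 0. *)
Fixpoint survival i : set Om :=
  if i is i'.+1 then survival i' `&` X (i%:R * h) @^-1` [set y | expR (- lam) < beta y]
  else X 0 @^-1` [set y | expR (- M) <= beta y].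

Let time_ge0 i : 0 <= i%:R * h. Proof. by rewrite mulr_ge0// ltW. Qed.

Lemma survival_filtration i : natural_filtration X (i%:R * h) (survival i).
Proof.
elim: i => [|i IH] /=.
  by rewrite mul0r; apply: natural_filtration_preimage => //; exact: measurable_ge.
apply: natural_filtrationI.
  by apply: (natural_filtrationS _ IH); rewrite ler_pM2r// ler_nat.
by apply: natural_filtration_preimage => //; exact: measurable_gt.
Qed.

Lemma measurable_survival i : measurable (survival i).
Proof. exact: (natural_filtration_measurable mX (@survival_filtration i)). Qed.

Lemma survival_barrier i w : survival i w -> expR (- lam) < beta (X (i%:R * h) w).
Proof.
case: i => [|i] /= [//]; rewrite mul0r /=; apply: lt_le_trans.
by rewrite ltr_expR ltrN2.
Qed.

Lemma survival_sub i : survival i `<=` survival 0.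
Proof. by elim: i => // i IH w [/IH]. Qed.

Let a i := (\int[P]_(w in survival i) (g lam (X (i%:R * h) w))%:E)%E.

Let integrand_ge0 (t : R) w : (0 <= (g lam (X t w))%:E)%E.
Proof. by rewrite lee_fin; case/andP: (trunc_barrier_bounds rs lam0 (X t w)). Qed.

(** On leaving, the truncated barrier equals lam exactly, so its expectation at the next time over
    [survival i] splits into the survivors' part and lam times the probability of leaving. This is
    optional stopping, one step at a time. *)
Lemma survival_step i :
  (a i.+1 + lam%:E * P (survival i `\` survival i.+1) <= a i + (c * h)%:E)%E.
Proof.
have mS j := measurable_survival j.
have mD : measurable (survival i `\` survival i.+1) by exact: measurableD.
have mg (t : R) A : 0 <= t -> measurable_fun A (fun w => (g lam (X t w))%:E).
  move=> t0; apply/measurable_EFinP; apply: (measurable_funS measurableT) => //.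
  exact: measurable_trunc.
have SE : survival i = survival i.+1 `|` (survival i `\` survival i.+1).
  by rewrite setDUK// => w [].
rewrite -(integral_cst P mD) /cst.
rewrite (eq_integral (fun w => (g lam (X (i.+1%:R * h) w))%:E)); last first.
  move=> w /set_mem[Sw nSw]; rewrite trunc_barrier_eq//.
  by rewrite leNgt; apply/negP => bw; apply: nSw.
rewrite /a -ge0_integral_setU//; last 2 first.
- exact: mg.
- by apply/disj_setPS => w [? []].
rewrite -SE.
have iS : i%:R * h < i.+1%:R * h by rewrite ltr_pM2r// ltr_nat.
apply: (le_trans (trunc_barrier_supermartingale lam0 (time_ge0 i) iS
  (@survival_filtration i) (@survival_barrier i))).
have -> : i.+1%:R * h - i%:R * h = h by rewrite -natr1; ring.
have ch0 : (0 <= (c * h)%:E)%E.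
  by rewrite lee_fin mulr_ge0 ?(ltW h0)// (drift_bound_ge0 ps mk).
under eq_integral do rewrite EFinD.
rewrite ge0_integralD//; last exact: mg.
apply: leeD => //; rewrite integral_cst//.
have := lee_wpmul2l ch0 (probability_le1 P (mS i)).
by rewrite mule1.
Qed.

(** [a m] plus lam times the probability of having left is the expectation of the stopped process;
    it starts at most at M and grows by at most c h per step. *)
Lemma survival_bound m :
  (lam%:E * P (survival 0 `\` survival m) <= (M + c * (m%:R * h))%:E)%E.
Proof.
have mS j := measurable_survival j.
have bound : (a m + lam%:E * P (survival 0 `\` survival m) <=
    (M + c * (m%:R * h))%:E)%E.
  elim: m => [|m IH].
    rewrite setDv measure0 mule0 adde0 mul0r mulr0 addr0.
    apply: (@le_trans _ _ (\int[P]_(w in survival 0) M%:E)%E).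
      apply: ge0_le_integral => //.
      - apply/measurable_EFinP; apply: (measurable_funS measurableT) => //.
        by apply: measurable_trunc => //; rewrite mul0r.
      - move=> w /= Mw; rewrite mul0r lee_fin trunc_barrier_ln; last first.
          by apply: le_trans Mw; rewrite ler_expR lerN2 ltW.
        rewrite lerNl -[leLHS]expRK ler_ln ?posrE ?expR_gt0//.
        exact: (lt_le_trans (expR_gt0 _) Mw).
    rewrite integral_cst//.
    have M0' : (0 <= M%:E)%E by rewrite lee_fin.
    have := lee_wpmul2l M0' (probability_le1 P (mS 0)).
    by rewrite mule1.
  have -> : survival 0 `\` survival m.+1 =
      (survival 0 `\` survival m) `|` (survival m `\` survival m.+1).
    apply/seteqP; split=> [w [S0 nS]|w [[S0 nS]|[Sm nS]]].
    - by have [Sm|Sm] := pselect (survival m w); [right|left].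
    - by split=> // -[].
    - by split=> //; exact: survival_sub Sm.
  rewrite measureU//; last 3 first.
  - exact: measurableD.
  - exact: measurableD.
  - by apply/seteqP; split=> // w [[_ nS] [Sm _]].
  rewrite ge0_muleDr// addeCA.
  apply: (@le_trans _ _ (lam%:E * P (survival 0 `\` survival m) + (a m + (c * h)%:E))%E).
    by rewrite leeD2l// survival_step.
  rewrite addeCA addeA (_ : M + _ = M + c * (m%:R * h) + c * h); last first.
    by rewrite -natr1; ring.
  by rewrite EFinD leeD2r.
apply: le_trans bound; rewrite leeDr//.
by apply: integral_ge0.
Qed.

End discrete_time.

End supermartingale.

(** * From dyadic meshes to continuous time *)

Section dyadic_times.
Variables (R : realType) (n : nat) (Phi Rp : {fset 'rV[R]_n}) (k : 'rV[R]_n -> R).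
Hypotheses (rs : root_system Phi) (ps : positive_subsystem Phi Rp)
  (mk : multiplicity_function Phi k).
Hypothesis k12 : forall a, a \in Phi -> 1 / 2 <= k a.
Variables (d : measure_display) (Om : measurableType d) (P : probability Om R).
Variable X : R -> Om -> 'rV[R]_n.
Hypothesis dunklX : is_dunkl_process P Rp k X.

Local Notation c := (drift_bound Phi Rp k).
Local Notation beta := (barrier Phi).

Lemma survivalP (M lam h : R) i w : survival Phi X M lam h i w <->
  expR (- M) <= beta (X 0 w) /\
  forall l, (0 < l <= i)%N -> expR (- lam) < beta (X (l%:R * h) w).
Proof.
elim: i => [|i IH] /=.
  by split=> [?|[]//]; split=> // -[].
split=> [[/IH[b0 bi] bS]|[b0 bi]].
  split=> // l /andP[l0]; rewrite leq_eqVlt => /orP[/eqP->//|li].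
  by apply: bi; rewrite l0.
split; last by apply: bi; rewrite ltn0Sn /=.
by apply/IH; split=> // l /andP[l0 li]; apply: bi; rewrite l0 ltnW.
Qed.

Variables M T : nat.

Let level (q : nat) : R := M%:R + q.+1%:R.
Let mesh (j : nat) : R := 2 ^- j.
Let mesh_gt0 j : 0 < mesh j. Proof. by rewrite invr_gt0 exprn_gt0. Qed.

Let S q j := survival Phi X M%:R (level q) (mesh j).
Let hit q j : set Om := S q j 0 `\` S q j (T * 2 ^ j)%N.

(** Dyadic meshes are nested: index l at mesh j is index 2 l at mesh j + 1. Thus the union over j is
    an increasing limit, and a bound uniform in j passes to it. *)
Let hit_nd q : nondecreasing_seq (hit q).
Proof.
apply/nondecreasing_seqP => j; apply/subsetPset => w [S0 nS]; split=> // /survivalP[b0 bi].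
apply: nS; apply/survivalP; split=> // l /andP[l0 lj].
have -> : l%:R * mesh j = (2 * l)%:R * mesh j.+1.
  by rewrite /mesh exprS invfM natrM; field; rewrite expf_neq0.
by apply: bi; rewrite muln_gt0 l0 /= expnS mulnCA leq_mul2l.
Qed.

Let measurable_hit q j : measurable (hit q j).
Proof.
have [D hD [mX _ _ _]] := dunklX.
have Ml : M%:R < level q by rewrite /level ltrDl.
by apply: measurableD; apply: measurable_survival.
Qed.

Let measure_hits q : ((level q)%:E * P (\bigcup_j hit q j) <= (M%:R + c * T%:R)%:E)%E.
Proof.
have [D hD [mX cX markov feller]] := dunklX.
have lim : P (hit q j) @[j --> \oo] --> P (\bigcup_j hit q j).
  apply: nondecreasing_cvg_mu => //; exact: bigcupT_measurable.
have limM : ((level q)%:E * P (hit q j))%E @[j --> \oo] -->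
    ((level q)%:E * P (\bigcup_j hit q j))%E by apply: cvgeZl.
rewrite -(cvg_lim _ limM)//; apply: lime_le; first by apply/cvg_ex; eexists; exact: limM.
apply: nearW => j.
have -> : (T%:R : R) = (T * 2 ^ j)%:R * mesh j.
  by rewrite natrM natrX mulfK// expf_neq0.
apply: (survival_bound rs ps mk hD k12 feller mX markov) => //.
by rewrite /level ltrDl.
Qed.

(** A zero of beta before T forces, by right-continuity, a dyadic time before T with -ln beta above
    any given level; the events for all levels intersect in a null set, as [level q] times the
    probability stays bounded. *)
Lemma barrier_hit_negligible : P.-negligible
  [set w | expR (- M%:R) <= beta (X 0 w) /\
           exists2 t : R, 0 < t < T%:R & beta (X t w) = 0].
Proof.
have [D hD [mX cX markov feller]] := dunklX.
exists (\bigcap_q \bigcup_j hit q j); split.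
- by apply: bigcapT_measurable => q; exact: bigcupT_measurable.
- set G := (X in P X).
  have mG : measurable G by apply: bigcapT_measurable => q; exact: bigcupT_measurable.
  have PG : (fine (P G))%:E = P G by rewrite fineK// fin_num_measure.
  apply/eqP; rewrite -PG eqe eq_le fine_ge0// andbT leNgt; apply/negP => r0.
  (* If the intersection had positive probability, this q would make [level q] times it exceed the
     uniform bound K. *)
  pose K := M%:R + c * T%:R; pose q := Num.trunc (K / fine (P G)).
  have Kq : K < level q * fine (P G).
    rewrite -ltr_pdivrMr// /level ltr_wpDl//.
    exact: truncnS_gt.
  have := measure_hits q; rewrite leNgt => /negP; apply.
  apply: (@lt_le_trans _ _ ((level q)%:E * P G)%E); first by rewrite -PG -EFinM lte_fin.
  apply: lee_wpmul2l; first by rewrite lee_fin /level addr_ge0.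
  apply: le_measure; rewrite ?inE//; first exact: bigcupT_measurable.
  by apply: bigcap_inf.
move=> w [b0 [t /andP[t0 tT] bt]] q _.
have [rc _] := cX w.
have lim : beta (X s w) @[s --> t^'+] --> (0 : R).
  rewrite -bt; apply: (cvg_comp _ _ (rc t (ltW t0))).
  exact: barrier_continuous.
have [e /= e0 He] := cvgr_lt _ lim _ (expR_gt0 (- level q)).
(* A mesh finer than both numbers has a point just after t that lies in the interval where beta is
   small and does not pass T. *)
have m0 : 0 < Num.min e (T%:R - t) by rewrite lt_min e0 subr_gt0.
have [j _ /(_ _ (leqnn j)) /=] := near_infty_natSinv_expn_lt (PosNum m0).
rewrite lt_min => /andP[je jT].
rewrite -[1 / _]mul1r mul1r div1r -/(mesh j) in je jT.
exists j => //; split; first by apply/survivalP; split=> // -[].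
move=> /survivalP[_ bi].
(* The first mesh index strictly after t: the right-hand limit says nothing at t itself, and i > 0
   is needed for the survival condition to bear on it. *)
pose i := (Num.trunc (t * 2 ^+ j)).+1.
have ti : t < i%:R * mesh j.
  by rewrite -ltr_pdivrMr// invrK truncnS_gt.
have it : i%:R * mesh j <= t + mesh j.
  rewrite /i -[X in X * _]natr1 mulrDl mul1r lerD2r -ler_pdivlMr// invrK.
  by have /andP[] := truncn_itv (mulr_ge0 (ltW t0) (exprn_ge0 j (ler0n R 2))).
have : beta (X (i%:R * mesh j) w) < expR (- level q).
  apply: He => //=; rewrite ltr_distlC; lra.
apply/negP; rewrite -leNgt; apply: ltW; apply: bi => /=.
rewrite -(ler_nat R) natrM natrX -ler_pdivrMr ?exprn_gt0//.
by apply: (le_trans it); lra.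
Qed.

End dyadic_times.

(** * Transfer to the radial process *)

Theorem proposition6 (R : realType) (n : nat) (Phi Rp : {fset 'rV[R]_n})
    (k : 'rV[R]_n -> R) (d : measure_display) (Om : measurableType d)
    (P : probability Om R) (XW : R -> Om -> 'rV[R]_n) :
  root_system Phi ->
  positive_subsystem Phi Rp ->
  multiplicity_function Phi k ->
  is_radial_dunkl_process P Phi Rp k XW ->
  {ae P, forall w, weyl_chamber Rp (XW 0 w)} ->
  (forall a, a \in Phi -> 1 / 2 <= k a) ->
  {ae P, forall w, hitting_time XW (boundary (weyl_chamber Rp)) w = +oo%E}.
Proof.
move=> rs ps mk [X dunklX projX] XW0 k12.
have betaX t w : 0 <= t -> barrier Phi (X t w) = barrier Phi (XW t w).
  by move=> t0; have [[v vW ->] _] := projX t w t0; rewrite barrier_weyl.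
(* One index m bounds both the initial value of -ln beta and the time horizon, so countably many
   null sets cover every path that starts in the chamber and hits a zero of beta. *)
pose N (m : nat) := [set w | expR (- m%:R) <= barrier Phi (X 0 w) /\
           exists2 t : R, 0 < t < m%:R & barrier Phi (X t w) = 0].
have neg : P.-negligible ((~` [set w | weyl_chamber Rp (XW 0 w)]) `|` \bigcup_m N m).
  apply: negligibleU; first exact: XW0.
  apply: negligible_bigcup => m.
  exact: (barrier_hit_negligible rs ps mk k12 dunklX).
apply: negligibleS neg => w /= nT; apply: contrapT => /not_orP[/contrapT C0 nN].
apply: nT; rewrite /hitting_time.
suff -> : [set t%:E | t in [set t : R | 0 < t /\ boundary (weyl_chamber Rp) (XW t w)]] = set0.
  by rewrite ereal_inf0.
apply/seteqP; split=> // z [t [t0 bt]] _.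
have b0 : 0 < barrier Phi (X 0 w).
  rewrite betaX//; apply: barrier_gt0 => a aPhi.
  have [b bPhi RpE] := ps.
  have := bPhi a aPhi; rewrite neq_lt => /orP[ab|ab]; last first.
    by rewrite dotC gt_eqF// C0// RpE !inE aPhi.
  rewrite dotC -oppr_eq0 -dotNr gt_eqF// C0// RpE !inE root_opp//=.
  by rewrite dotNl oppr_gt0.
(* In the closed chamber all a.x with a in Rp are nonnegative; if beta were nonzero they would be
   positive, and finitely many open conditions would make the point interior. *)
have bt0 : barrier Phi (X t w) = 0.
  rewrite betaX ?ltW//; case: bt => clx ncx.
  have dot_cont a : continuous (fun y : 'rV[R]_n => dot y a).
    move=> y; apply: (@cvg_dot _ _ _ (nbhs y) _ id (cst a)); first exact: cvg_id.
    exact: cst_continuous.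
  have dot_cl a : a \in Rp -> 0 <= dot (XW t w) a.
    move=> aR; rewrite leNgt; apply/negP => a0.
    have [y [Cy ya]] := clx _ (dot_cont a _ _ (lt_nbhsl a0)).
    by have := Cy a aR; rewrite ltNge ltW.
  apply: contrapT => /eqP bn; apply: ncx.
  have ber : 0 < barrier Phi (XW t w) by rewrite lt_def bn barrier_ge0.
  have pos (a : Rp) : \forall y \near XW t w, 0 < dot y (val a).
    apply: (dot_cont (val a) _ _ (lt_nbhsr _)).
    rewrite lt_def dot_cl ?fsvalP// andbT dotC.
    exact: (barrier_gt0_regular ber (positive_root ps (fsvalP a))).
  apply: filterS (filter_forall (nbhs_filter (XW t w)) pos) => y Hy a aR.
  exact: (Hy [` aR]%fset).
apply: nN.
pose m := maxn (Num.trunc (- ln (barrier Phi (X 0 w)))).+1 (Num.trunc t).+1.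
exists m => //; split.
  rewrite -[leRHS]lnK// ler_expR lerNl ltW//.
  apply: (lt_le_trans (truncnS_gt _)); rewrite ler_nat; exact: leq_maxl.
exists t => //; rewrite t0 /=.
by apply: (lt_le_trans (truncnS_gt _)); rewrite ler_nat; exact: leq_maxr.
Qed.
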